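(* Let $\Omega\subset M$ be an open bounded domain. Suppose that a function $v\in C_0^\infty(\Omega)$ satisfies $\langle\nabla_X v,\nabla_X p(x)\rangle\equiv 0$ and is a solution of $-\mathscr{L}_p v=\mu\, a(x) f(v)$ in $\Omega$, $v>0$ in $\Omega$, $v=0$ on $\partial\Omega$, where the equation means $$\int_\Omega|\nabla_X v|^{p(x)-2}\langle\nabla_X v,\nabla_X\phi\rangle\,dx=\mu\int_\Omega a(x)f(v)\phi\,dx\quad\text{for all }\phi\in W_0^{1,p(x)}(\Omega),$$ $f:\mathbb{R}^+\to\mathbb{R}^+$ is $C^1$ and satisfies $f'(y)\ge(p(x)-1)\left[f(y)^{\frac{p(x)-2}{p(x)-1}}\right]$ (for $y>0$ and $x\in\Omega$), $\mu>0$ is a constant, and $a(x)$ is a positive continuous function. Then $$\int_\Omega|\nabla_X u|^{p(x)}\,dx\ge\mu\int_\Omega a(x)|u|^{p(x)}\,dx$$ for any $0\le u\in C_0^1(\Omega)$.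
   Context: $M$ is an $n$-dimensional smooth manifold equipped with a volume form $dx$, and $\{X_k\}_{k=1}^N$, $n\ge N$, is a family of vector fields on $M$. The horizontal gradient is $\nabla_X=(X_1,\dots,X_N)$, with $\langle\cdot,\cdot\rangle$ and $|\cdot|$ the Euclidean inner product and norm in $\mathbb{R}^N$. The exponent $p:\overline\Omega\to\mathbb{R}^+$ is $C^1$ with $1<p^-:=\operatorname{ess\,inf}p\le p(x)\le p^+:=\operatorname{ess\,sup}p<\infty$. $L^{p(\cdot)}(\Omega)$ is the space of (classes of) measurable real functions $u$ with $\int_\Omega|u|^{p(x)}dx<\infty$, with norm $\inf\{t>0:\int_\Omega|u/t|^{p(x)}dx\le1\}$; $W^{1,p(\cdot)}(\Omega)=\{u\in L^{p(\cdot)}(\Omega):|\nabla_Xu|\in L^{p(\cdot)}(\Omega)\}$ with norm $\|u\|_{L^{p(\cdot)}}+\|\nabla_Xu\|_{L^{p(\cdot)}}$; $W_0^{1,p(x)}(\Omega)$ is the closure of $C_0^\infty(\Omega)$ in $W^{1,p(\cdot)}(\Omega)$. $\mathscr{L}_p$ denotes the $p(x)$-sub-Laplacian, understood in the weak sense written in the claim. *)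

(* Defs.v *)
From mathcomp Require Import all_boot all_order all_algebra.
From mathcomp Require Import all_classical all_reals all_analysis ess_sup_inf.

Set Implicit Arguments.
Unset Strict Implicit.
Unset Printing Implicit Defensive.

Import Order.TTheory GRing.Theory Num.Theory.
Import numFieldNormedType.Exports.

Local Open Scope classical_set_scope.
Local Open Scope ring_scope.

Section EuclideanCalculus.
Variable R : realType.

Definition partial n (i : 'I_n) (g : 'rV[R]_n -> R) : 'rV[R]_n -> R :=
  'D_(delta_mx 0 i) g.

(* [g] is of class C^k on [V]; only meant for open [V], so that the partial
   derivatives at points of [V] depend only on the values of [g] on [V]. *)
Fixpoint Ck n (k : nat) (V : set 'rV[R]_n) (g : 'rV[R]_n -> R) : Prop :=
  {within V, continuous g} /\
  if k is k'.+1 then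
    forall i : 'I_n, (forall y, V y -> derivable g y (delta_mx 0 i)) /\
                     Ck k' V (partial i g)
  else True.

(* Iterated one-dimensional Lebesgue integral; by Tonelli it is the integral
   against n-dimensional Lebesgue measure for Borel [g >= 0]. *)
Fixpoint iterated_integral n : ('rV[R]_n -> \bar R) -> \bar R :=
  if n is n'.+1 then fun g =>
    (\int[lebesgue_measure]_(t in [set: R])
       iterated_integral (fun y : 'rV[R]_n' =>
         g (row_mx (t%:M : 'rV[R]_1) y : 'rV[R]_(1 + n'))))%E
  else fun g => g 0.

Definition dotp N (a b : 'rV[R]_N) : R := \sum_(k < N) a 0 k * b 0 k.
Definition enorm N (a : 'rV[R]_N) : R := Num.sqrt (dotp a a).

End EuclideanCalculus.

Section Manifold.
Variables (R : realType) (n : nat).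

(* Only the values of [cfun] on [cdom], and those of [cinv] on the image of
   [cdom], are meaningful. *)
Record chart (M : topologicalType) := Chart {
  cdom : set M;
  cfun : M -> 'rV[R]_n;
  cinv : 'rV[R]_n -> M;
  cdom_open : open cdom;
  cimg_open : open (cfun @` cdom);
  cfunK : forall x, cdom x -> cinv (cfun x) = x;
  cfun_continuous : {within cdom, continuous cfun};
  cinv_continuous : {within cfun @` cdom, continuous cinv}
}.

Definition transition (M : topologicalType) (c c' : chart M) :
  'rV[R]_n -> 'rV[R]_n := cfun c' \o cinv c.

(* The carrier is a pointed (i.e. nonempty) topological space. *)
Record smooth_manifold := SmoothManifold {
  carrier :> ptopologicalType;
  manifold_hausdorff : hausdorff_space carrier;
  manifold_second_countable : @second_countable carrier;
  atlas : set (chart carrier);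
  atlas_cover : forall x : carrier, exists2 c, atlas c & cdom c x;
  atlas_smooth : forall c c', atlas c -> atlas c' ->
    forall (i : 'I_n) (k : nat),
      Ck k (cfun c @` (cdom c `&` cdom c'))
           (fun y => transition c c' y 0 i)
}.

Variable M : smooth_manifold.
Implicit Types (c : chart M) (x : M) (u psi : M -> R).

Definition chart_at x : chart M := s2val (cid2 (atlas_cover x)).

Definition Ck_on (k : nat) (U : set M) u : Prop :=
  forall c, atlas c -> Ck k (cfun c @` (U `&` cdom c)) (u \o cinv c).

Definition Cinfty_on (U : set M) u : Prop := forall k, Ck_on k U u.

(* The i-th partial derivative at [x] in the coordinates of [c]. *)
Definition chart_partial c (i : 'I_n) u x : R :=
  partial i (u \o cinv c) (cfun c x).

(* The closure of {u <> 0} is a compact subset of U. *)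
Definition compact_support_in (U : set M) u : Prop :=
  compact (closure [set x | u x != 0]) /\ closure [set x | u x != 0] `<=` U.

(* Members of C_0^k(U), C_0^oo(U) are seen as functions on M, extended by 0. *)
Definition Ck_compact (k : nat) (U : set M) u : Prop :=
  Ck_on k [set: M] u /\ compact_support_in U u.

Definition Cinfty_compact (U : set M) u : Prop :=
  Cinfty_on [set: M] u /\ compact_support_in U u.

(* Smooth in [U], continuous on the closure, zero on the boundary ([U] open). *)
Definition Cinfty_vanishing (U : set M) u : Prop :=
  [/\ Cinfty_on U u, {within closure U, continuous u} &
      forall x, (closure U `\` U) x -> u x = 0].

(* C^1 in [U], with [u] and its first derivatives in charts extending
   continuously to the closure of [U]. *)
Definition C1_closure (U : set M) u : Prop :=
  [/\ {within closure U, continuous u}, Ck_on 1 U u &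
      forall c, atlas c -> forall i : 'I_n, exists q : M -> R,
        {within closure U `&` cdom c, continuous q} /\
        forall x, (U `&` cdom c) x -> q x = chart_partial c i u x].

(* A (smooth) vector field: components in each chart, related by the Jacobians
   of the transition maps ('D_v g y = v *m 'J g y in the library). *)
Record vector_field := VectorField {
  vfc : chart M -> M -> 'rV[R]_n;
  vfc_smooth : forall c, atlas c ->
    forall i : 'I_n, Cinfty_on (cdom c) (fun x => vfc c x 0 i);
  vfc_transform : forall c c' x, atlas c -> atlas c' ->
    cdom c x -> cdom c' x ->
    vfc c' x = vfc c x *m 'J (transition c c') (cfun c x)
}.

(* A nowhere vanishing smooth n-form, [volc c] being its coefficient on
   dy_1 /\ ... /\ dy_n in the chart [c]. *)
Record volume_form := VolumeForm {
  volc : chart M -> M -> R;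
  volc_smooth : forall c, atlas c -> Cinfty_on (cdom c) (volc c);
  volc_neq0 : forall c x, atlas c -> cdom c x -> volc c x != 0;
  volc_transform : forall c c' x, atlas c -> atlas c' ->
    cdom c x -> cdom c' x ->
    volc c x = \det ('J (transition c c') (cfun c x)) * volc c' x
}.

Local Notation borel := (g_sigma_algebraType (@open M)).

Lemma open_borel (U : set M) : open U -> measurable (U : set borel).
Proof. exact: sub_sigma_algebra. Qed.

(* [vol] is the Borel measure dx given by the volume form [w]. *)
Definition volume_measure (w : volume_form)
    (vol : {measure set borel -> \bar R}) : Prop :=
  forall c, atlas c -> forall A : set borel, measurable A -> A `<=` cdom c ->
    vol A = iterated_integral
      (fun y => (\1_(cfun c @` A) y * `|volc w c (cinv c y)|)%:E).

Definition vf_apply (X : vector_field) u x : R :=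
  \sum_(i < n) vfc X (chart_at x) x 0 i * chart_partial (chart_at x) i u x.

Definition hgrad N (X : 'I_N -> vector_field) u x : 'rV[R]_N :=
  \row_(k < N) vf_apply (X k) u x.

(* Formal adjoint of [X] for dx = |w_c| dy, in the chart [c]:
   X^* psi = - (1 / w_c) \sum_i d_i (w_c X^i psi). *)
Definition vf_adjoint (w : volume_form) (X : vector_field) c psi x : R :=
  - (\sum_(i < n)
       chart_partial c i (fun z => volc w c z * vfc X c z 0 i * psi z) x)
    / volc w c x.

Section Sobolev.
Variables (w : volume_form) (vol : {measure set borel -> \bar R}).
Variables (Omega : set M) (p : M -> R).

(* X u = g in the sense of distributions on Omega, tested in charts. *)
Definition weak_vf_apply (X : vector_field) (u g : M -> R) : Prop :=
  forall c, atlas c -> forall psi, Cinfty_compact (Omega `&` cdom c) psi ->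
    (\int[vol]_(x in Omega `&` cdom c) (g x * psi x) =
     \int[vol]_(x in Omega `&` cdom c) (u x * vf_adjoint w X c psi x))%R.

Definition Lpx (u : M -> R) : Prop :=
  measurable_fun (Omega : set borel) (u : borel -> R) /\
  (\int[vol]_(x in Omega) (`|u x| `^ p x)%:E < +oo)%E.

Definition Lpx_norm (u : M -> R) : \bar R :=
  ereal_inf [set t%:E | t in
    [set t : R | 0 < t /\ (\int[vol]_(x in Omega) (`|u x / t| `^ p x)%:E <= 1)%E]].

Variables (N : nat) (X : 'I_N -> vector_field).

(* [u] is in W^{1,p(.)}(Omega), with (weak) horizontal gradient [G]. *)
Definition W1px (u : M -> R) (G : M -> 'rV[R]_N) : Prop :=
  [/\ Lpx u, Lpx (fun x => enorm (G x)) &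
      forall k : 'I_N,
        measurable_fun (Omega : set borel) ((fun x => G x 0 k) : borel -> R) /\
        weak_vf_apply (X k) u (fun x => G x 0 k)].

Definition W1px_norm (u : M -> R) (G : M -> 'rV[R]_N) : \bar R :=
  (Lpx_norm u + Lpx_norm (fun x => enorm (G x)))%E.

(* [u] is in the W^{1,p(.)}-closure of C_0^oo(Omega), with gradient [G]. *)
Definition W01px (u : M -> R) (G : M -> 'rV[R]_N) : Prop :=
  W1px u G /\
  forall e : R, 0 < e -> exists psi, Cinfty_compact Omega psi /\
    (W1px_norm (fun x => u x - psi x)%R (fun x => G x - hgrad X psi x)%R
       < e%:E)%E.

(* - L_p v = h in Omega in the weak sense; that both integrals converge is part
   of the meaning of the equation (the library's integral is total). *)
Definition weak_solution (v h : M -> R) : Prop :=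
  forall (phi : M -> R) (G : M -> 'rV[R]_N), W01px phi G ->
    let lhs := fun x => enorm (hgrad X v x) `^ (p x - 2) *
                        dotp (hgrad X v x) (G x) in
    let rhs := fun x => h x * phi x in
    [/\ vol.-integrable Omega (EFin \o lhs),
        vol.-integrable Omega (EFin \o rhs) &
        \int[vol]_(x in Omega) lhs x = \int[vol]_(x in Omega) rhs x].

End Sobolev.

End Manifold.

Notation borel M := (g_sigma_algebraType (@open (carrier M))).

(* Main.v *)
From HB Require Import structures.
Require Import Defs.
From mathcomp Require Import all_boot all_order all_algebra.
From mathcomp Require Import all_classical all_reals all_analysis ess_sup_inf.
From mathcomp Require Import measurable_realfun.
From mathcomp Require Import ring lra.

Set Implicit Arguments.
Unset Strict Implicit.
Unset Printing Implicit Defensive.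

Import Order.TTheory GRing.Theory Num.Theory.
Import numFieldNormedType.Exports.

Local Open Scope classical_set_scope.
Local Open Scope ring_scope.

(** The equation for [v] is tested with [phi = u^p / f(v)]. Along a vector field,

      X phi = p u^(p-1) / f(v) X u + u^p ln u / f(v) X p - u^p f'(v) / f(v)^2 X v,

   and the logarithmic term disappears after pairing with the horizontal
   gradient of [v], which is orthogonal to that of [p]. What remains is bounded
   pointwise: with [B = u |grad v| f(v)^(-1/(p-1))], the Cauchy-Schwarz and Young
   inequalities give

      |grad v|^(p-2) p u^(p-1) / f(v) <grad v, grad u> <= |grad u|^p + (p-1) B^p,

   and the growth condition on [f'] says exactly that the term with [f'] is at
   least [(p-1) B^p]. Hence [|grad v|^(p-2) <grad v, grad phi> <= |grad u|^p]
   (lemma [picone]). The integral of the left-hand side is, by the equation, the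
   integral of [mu a f(v) phi = mu a u^p], which is the claim.

   Most of the work is to show that [phi] is an admissible test function.
   It is only C^1, whereas test functions are limits of smooth ones and carry a
   distributional gradient. Three facts are used.

   - [phi] is C^1 up to the zeros of [u] ([Ck1_powR], [vf_apply_test]): there the
     derivatives of [u >= 0] vanish, and [p > 1] makes [u^p] and [u^p ln u] small.

   - The classical gradient of a C^1 function is its distributional gradient
     ([classical_weak_derivative]). In a chart this is an integration by parts,
     that is, the vanishing of the integral of a partial derivative of a compactly
     supported function on R^n ([integral_partial_eq0]), a consequence of the
     translation invariance of Lebesgue measure ([integral_lebV_shift]).

   - A C^1 function with compact support in an open set is a limit of smooth ones
     ([C1_compact_approximable]): cut it by a partition of unity and mollify the
     pieces in charts ([C1_approx]). The convergence is uniform, with first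
     derivatives, and the differences live in a fixed compact set; such a set has
     finite volume ([vol_compact_finite]), so that the convergence holds in the
     Luxemburg norm ([Lpx_norm_le], [C1_compact_W01px]).

   The volume measure is given in charts by iterated one-dimensional integrals.
   [lebesgueV_exists] turns these into the integral against a measure on the Borel
   sets of R^n, and [Rintegral_transfer] extends the formula for the volume of
   sets to integrals of functions. *)

(** * Functions of class C^k on open subsets of R^n *)

Section CkTheory.
Variable R : realType.
Implicit Types (n k : nat).

Local Notation e_ i := (delta_mx 0 i).

Lemma CkS_open n k (V : set 'rV[R]_n) g : open V ->
  Ck k.+1 V g <-> (forall y, V y -> {for y, continuous g}) /\
    forall i : 'I_n, (forall y, V y -> derivable g y (e_ i)) /\
                     Ck k V (partial i g).
Proof.
move=> oV; split=> -[cg dg]; split=> //.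
  by move: cg; rewrite continuous_open_subspace// => cg y /mem_set; exact: cg.
by rewrite continuous_open_subspace// => y /set_mem; exact: cg.
Qed.

Lemma Ck0_open n (V : set 'rV[R]_n) g : open V ->
  Ck 0 V g <-> (forall y, V y -> {for y, continuous g}).
Proof.
rewrite /= => oV; rewrite continuous_open_subspace//.
split=> [[cg _] y /mem_set|cg]; first exact: cg.
by split=> // y /set_mem; exact: cg.
Qed.

Lemma Ck_continuous n k (V : set 'rV[R]_n) g y : open V -> Ck k V g -> V y ->
  {for y, continuous g}.
Proof. by move=> oV; case: k => [/(Ck0_open _ oV)|k /(CkS_open _ _ oV)[]]; auto. Qed.

Lemma CkW n k (V : set 'rV[R]_n) g : Ck k.+1 V g -> Ck k V g.
Proof.
elim: k V g => [|k IH] V g [cg dg]; first by split.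
by split => // i; split; [have [] := dg i|have [_ /IH] := dg i].
Qed.

Lemma Ck_le n k k' (V : set 'rV[R]_n) g : (k' <= k)%N -> Ck k V g -> Ck k' V g.
Proof.
elim: k => [|k IH]; first by rewrite leqn0 => /eqP ->.
by rewrite leq_eqVlt => /orP[/eqP->//|]; rewrite ltnS => /IH h /CkW.
Qed.

Lemma Ck_subset n k (V W : set 'rV[R]_n) g : V `<=` W -> Ck k W g -> Ck k V g.
Proof.
move=> VW; elim: k g => [|k IH] g [cg dg].
  by split=> //; exact: continuous_subspaceW cg.
split=> [|i]; first exact: continuous_subspaceW cg.
by have [h1 h2] := dg i; split=> [y /VW/h1//|]; exact: IH.
Qed.

Lemma near_eq_continuous (T U : topologicalType) (f g : T -> U) (x : T) :
  (\near x, f x = g x) -> {for x, continuous f} -> {for x, continuous g}.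
Proof.
move=> fg cf; rewrite /prop_for /continuous_at -(nbhs_singleton fg).
by apply: cvg_trans cf; exact: near_eq_cvg.
Qed.

Lemma Ck_ext n k (V : set 'rV[R]_n) g g' : open V ->
  (forall y, V y -> g y = g' y) -> Ck k V g -> Ck k V g'.
Proof.
move=> oV; elim: k g g' => [|k IH] g g' gg'.
  rewrite !Ck0_open// => cg y Vy; apply: near_eq_continuous (cg y Vy).
  by near=> z; apply: gg'; near: z; exact: open_nbhs_nbhs.
have gg'n y : V y -> \near y, g y = g' y.
  by move=> Vy; near=> z; apply: gg'; near: z; exact: open_nbhs_nbhs.
rewrite !CkS_open// => -[cg dg]; split=> [y Vy|i].
  by apply: near_eq_continuous (cg y Vy); exact: gg'n.
have [dgi Cgi] := dg i; split=> [y Vy|].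
  by apply: near_eq_derivable (dgi y Vy); exact: gg'n.
by apply: IH Cgi => y Vy; apply: near_eq_derive; exact: gg'n.
Unshelve. all: by end_near. Qed.

Lemma Ck_local n k (V : set 'rV[R]_n) g : open V ->
  (forall y, V y -> exists W, [/\ open W, W y & Ck k W g]) -> Ck k V g.
Proof.
move=> oV; elim: k g => [|k IH] g loc.
  apply/Ck0_open => // y /loc[W [oW Wy /Ck0_open]]; exact.
apply/CkS_open => //; split=> [y /loc[W [oW Wy /CkS_open]]|i].
  by move=> /(_ oW)[cg _]; exact: cg.
split=> [y /loc[W [oW Wy /CkS_open]]|].
  by move=> /(_ oW)[_ dg]; have [h _] := dg i; exact: h.
apply: IH => y /loc[W [oW Wy /CkS_open]] => /(_ oW)[_ dg].
by exists W; split=> //; have [_] := dg i.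
Qed.

Lemma Ck_cst n k (V : set 'rV[R]_n) (a : R) : Ck k V (cst a).
Proof.
elim: k V a => [|k IH] V a; first by split=> //; exact/continuous_subspaceT/cst_continuous.
split; first exact/continuous_subspaceT/cst_continuous.
move=> i; split=> [y _|]; first exact: derivable_cst.
rewrite (_ : partial i _ = cst 0)//.
by apply/funext => y; rewrite /partial derive_cst.
Qed.

Lemma Ck_add n k (V : set 'rV[R]_n) f g : open V ->
  Ck k V f -> Ck k V g -> Ck k V (fun y => f y + g y).
Proof.
move=> oV; elim: k f g => [|k IH] f g.
  rewrite !Ck0_open// => cf cg y Vy; apply: continuousD; [exact: cf|exact: cg].
rewrite !CkS_open// => -[cf df] [cg dg]; split=> [y Vy|i].
  by apply: continuousD; [exact: cf|exact: cg].
have [[dfi Cfi] [dgi Cgi]] := (df i, dg i); split=> [y Vy|].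
  by apply: derivableD; [exact: dfi|exact: dgi].
apply: Ck_ext (IH _ _ Cfi Cgi) => // y Vy.
by rewrite /partial -deriveD//; [exact: dfi|exact: dgi].
Qed.

Lemma Ck_mul n k (V : set 'rV[R]_n) f g : open V ->
  Ck k V f -> Ck k V g -> Ck k V (fun y => f y * g y).
Proof.
move=> oV; elim: k f g => [|k IH] f g.
  rewrite !Ck0_open// => cf cg y Vy; apply: continuousM; [exact: cf|exact: cg].
move=> Cf Cg; move: (CkW Cf) (CkW Cg) => Cfk Cgk; move: Cf Cg.
rewrite !CkS_open// => -[cf df] [cg dg]; split=> [y Vy|i].
  by apply: continuousM; [exact: cf|exact: cg].
have [[dfi Cfi] [dgi Cgi]] := (df i, dg i); split=> [y Vy|].
  by apply: derivableM; [exact: dfi|exact: dgi].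
apply: Ck_ext (Ck_add oV (IH _ _ Cfk Cgi) (IH _ _ Cgk Cfi)) => // y Vy.
by rewrite /partial deriveM//; [exact: dfi|exact: dgi].
Qed.

Lemma Ck_scale n k (V : set 'rV[R]_n) (a : R) f : open V ->
  Ck k V f -> Ck k V (fun y => a * f y).
Proof. by move=> oV; apply: Ck_mul => //; exact: Ck_cst. Qed.

Lemma Ck_opp n k (V : set 'rV[R]_n) f : open V ->
  Ck k V f -> Ck k V (fun y => - f y).
Proof.
move=> oV /(Ck_scale (-1) oV); apply: Ck_ext => // y _.
by rewrite mulN1r.
Qed.

Lemma Ck_sum n k (V : set 'rV[R]_n) (I : Type) (r : seq I) (F : I -> 'rV[R]_n -> R) :
  open V -> (forall i, Ck k V (F i)) -> Ck k V (fun y => \sum_(i <- r) F i y).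
Proof.
move=> oV CF; elim: r => [|i r IH].
  by apply: Ck_ext (Ck_cst k V 0) => // y _; rewrite big_nil.
by apply: Ck_ext (Ck_add oV (CF i) IH) => // y _; rewrite big_cons.
Qed.

Lemma Ck_prod n k (V : set 'rV[R]_n) (I : Type) (r : seq I) (F : I -> 'rV[R]_n -> R) :
  open V -> (forall i, Ck k V (F i)) -> Ck k V (fun y => \prod_(i <- r) F i y).
Proof.
move=> oV CF; elim: r => [|i r IH].
  by apply: Ck_ext (Ck_cst k V 1) => // y _; rewrite big_nil.
by apply: Ck_ext (Ck_mul oV (CF i) IH) => // y _; rewrite big_cons.
Qed.

Lemma Ck_inv n k (V : set 'rV[R]_n) f : open V ->
  (forall y, V y -> f y != 0) -> Ck k V f -> Ck k V (fun y => (f y)^-1).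
Proof.
move=> oV f0; elim: k => [|k IH].
  by rewrite !Ck0_open// => cf y Vy; apply: continuousV; [exact: f0|exact: cf].
move=> Cf; move: (CkW Cf) => /IH Cfk; move: Cf.
rewrite !CkS_open// => -[cf df]; split=> [y Vy|i].
  by apply: continuousV; [exact: f0|exact: cf].
have [dfi Cfi] := df i; split=> [y Vy|].
  by apply: derivableV; [exact: f0|exact: dfi].
apply: Ck_ext (Ck_opp oV (Ck_mul oV (Ck_mul oV Cfk Cfk) Cfi)) => // y Vy.
rewrite /partial deriveV//; [|exact: f0|exact: dfi].
by rewrite scaleNr -exprVn expr2.
Qed.

Lemma derive_coord n (i j : 'I_n) (y : 'rV[R]_n) :
  is_derive y (e_ i) (fun z => z 0 j) ((i == j)%:R : R).
Proof.
have df : differentiable (fun z : 'rV[R]_n => z 0 j : R) y.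
  exact: differentiable_coord.
apply: DeriveDef; first exact: diff_derivable.
have @f : {linear 'rV[R]_n -> R}.
  by exists (fun N : 'rV[R]_n => N 0 j); do 2![eexists]; do ?[constructor];
     rewrite ?mxE// => ? *; rewrite ?mxE//; move=> ?; rewrite !mxE.
have cf : continuous f by exact: coord_continuous.
rewrite (_ : (fun _ => _) = f)// deriveE; last exact: linear_differentiable.
by rewrite diff_lin//= !mxE eqxx eq_sym.
Qed.

Lemma Ck_coord n k (V : set 'rV[R]_n) (j : 'I_n) : Ck k V (fun y => y 0 j).
Proof.
case: k => [|k].
  by split=> //; apply: continuous_subspaceT => y; exact: coord_continuous.
split; first by apply: continuous_subspaceT => y; exact: coord_continuous.
move=> i; split=> [y _|].
  by have [] := derive_coord i j y.
rewrite (_ : partial i _ = cst ((i == j)%:R))//; first exact: Ck_cst.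
by apply/funext => y; exact: (@derive_val _ _ _ _ _ _ _ (derive_coord i j y)).
Qed.

End CkTheory.

(** * The mean value theorem and the chain rule for C^1 maps *)

Section Chain.
Variable R : realType.
Implicit Types (n m k : nat).

Local Notation e_ i := (delta_mx 0 i).

Lemma differentiable_of_linear (V W : normedModType R) (f : V -> W)
    (df : {linear V -> W}) x : continuous df ->
  (forall eps : R, 0 < eps ->
    \forall h \near (0 : V), `|f (h + x) - f x - df h| <= eps * `|h|) ->
  differentiable f x /\ 'd f x = df :> (V -> W).
Proof.
move=> cdf H.
have E : f \o shift x = cst (f x) + df +o_ 0 id.
  apply/eqaddoP => eps eps0; near=> h.
  rewrite /= opprD addrA; near: h; exact: H.
by rewrite diff_locallyP (diff_unique cdf E).
Unshelve. all: by end_near. Qed.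

Lemma derive_direction (V : normedModType R) (g : V -> R) (x v : V) (s : R) :
  derivable g (x + s *: v) v ->
  is_derive s 1 (fun t => g (x + t *: v)) ('D_v g (x + s *: v)).
Proof.
move=> dg.
have E : (fun h : R => h^-1 *: (((fun t => g (x + t *: v)) \o shift s) (h *: 1)
   - g (x + s *: v))) = (fun h : R => h^-1 *: ((g \o shift (x + s *: v)) (h *: v) - g (x + s *: v))).
  apply/funext => h /=; congr (_ *: (g _ - _)).
  by rewrite [h *: 1]mulr1 scalerDl addrCA.
apply: DeriveDef; first by rewrite /derivable E.
by rewrite /derive E.
Qed.

Lemma MVT_direction (V : normedModType R) (g : V -> R) (x v : V) :
  (forall s, 0 <= s <= 1 -> derivable g (x + s *: v) v) ->
  exists2 s, 0 <= s <= 1 & g (x + v) - g x = 'D_v g (x + s *: v).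
Proof.
move=> dg.
have [||s s01] := @MVT_segment R (fun t => g (x + t *: v))
    (fun s => 'D_v g (x + s *: v)) 0 1 ler01.
- move=> s; rewrite in_itv/= => /andP[s0 s1].
  by apply: derive_direction; apply: dg; rewrite !ltW.
- apply: derivable_within_continuous => s; rewrite in_itv/= => s01.
  by have [] := derive_direction (dg _ s01).
by rewrite scale1r scale0r addr0 subr0 mulr1; exists s.
Qed.

Lemma is_derive_scaledir (V : normedModType R) (g : V -> R) (x v : V) (t : R) :
  derivable g x v -> is_derive x (t *: v) g (t * 'D_v g x).
Proof.
move=> dg.
have dg0 : derivable g (x + 0 *: v) v by rewrite scale0r addr0.
have := derive_direction dg0 => -[d1 E1].
have [d2 E2] : is_derive (0:R) (1:R) (fun s => g (x + s *: (t *: v))) (t * 'D_v g x).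
  have -> : (fun s => g (x + s *: (t *: v))) = (fun t => g (x + t *: v)) \o (fun s : R => t * s).
    by apply/funext => s /=; rewrite scalerA mulrC.
  have dl : differentiable (fun s : R => t * s) 0.
    by apply/derivable1_diffP; apply: derivableM; [exact: derivable_cst|exact: derivable_id].
  have dr : differentiable (fun s : R => g (x + s *: v)) (t * 0 : R).
    by rewrite mulr0; apply/derivable1_diffP.
  have dc := differentiable_comp dl dr.
  apply: DeriveDef; first exact/derivable1_diffP.
  rewrite -derive1E derive1_comp; [|exact/derivable1_diffP|exact/derivable1_diffP].
  rewrite derive1E mulr0 E1 scale0r addr0 mulrC; congr (_ * _).
  by rewrite derive1Ml ?derive1_id ?mulr1.
move: d2 E2.
have E : (fun h : R => h^-1 *: (((fun s => g (x + s *: (t *: v))) \o shift 0) (h *: 1)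
   - g (x + 0 *: (t *: v)))) = (fun h : R => h^-1 *: ((g \o shift x) (h *: (t *: v)) - g x)).
  apply/funext => h /=; congr (_ *: (g _ - g _)); last by rewrite scale0r addr0.
  by rewrite [h *: 1]mulr1 addr0 addrC.
rewrite /derivable /derive E => d2 E2.
by apply: DeriveDef.
Qed.

Lemma cvg_sumr (T I : Type) (F : set_system T) {FF : Filter F} (r : seq I)
    (f : I -> T -> R) (l : I -> R) :
  (forall i, f i x @[x --> F] --> l i) ->
  \sum_(i <- r) f i x @[x --> F] --> \sum_(i <- r) l i.
Proof.
by move=> fl; apply: cvg_big => //; exact: add_continuous.
Qed.

(** The corners of the path from 0 to [h] along the coordinate directions. *)
Definition trunc_rv n (j : nat) (h : 'rV[R]_n) : 'rV[R]_n :=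
  \row_(i < n) (if (i < j)%N then h 0 i else 0).

Lemma norm_rv_le n (h : 'rV[R]_n) (a : R) : 0 <= a ->
  (`|h| <= a) <-> (forall i, `|h 0 i| <= a).
Proof.
move=> a0; rewrite [`|h|]mx_normrE; split=> [/bigmax_leP[_ H] i|H].
  exact: (H (0, i)).
by apply/bigmax_leP; split=> // -[i j] _ /=; rewrite (ord1 i).
Qed.

Lemma norm_coord_le n (h : 'rV[R]_n) i : `|h 0 i| <= `|h|.
Proof. by move: i; apply/norm_rv_le. Qed.

(** The increment of [g] is the sum of its increments along the path of
   [trunc_rv]; the mean value theorem and the continuity of one partial
   derivative control each of them. *)
Lemma C1_differentiable n (V : set 'rV[R]_n) g y : open V -> Ck 1 V g -> V y ->
  differentiable g y /\
  forall h, 'd g y h = \sum_(i < n) h 0 i * partial i g y.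
Proof.
move=> oV /(CkS_open _ _ oV)[_ dg] Vy.
pose L (h : 'rV[R]_n) : R := \sum_(i < n) h 0 i * partial i g y.
have linL : linear L.
  move=> a u v; rewrite /L scaler_sumr -big_split/=; apply: eq_bigr => i _.
  by rewrite !mxE mulrDl -mulrA.
pose LM := GRing.isLinear.Build _ _ _ _ _ linL.
pose LL : {linear 'rV[R]_n -> R} := HB.pack L LM.
suff [d E] : differentiable g y /\ 'd g y = LL :> (_ -> R).
  by split=> // h; rewrite E.
apply: differentiable_of_linear.
  move=> h; apply: (@cvg_sumr _ _ (nbhs h) _) => i.
  by apply: cvgM; [exact: coord_continuous|exact: cvg_cst].
move=> eps eps0.
have en0 : 0 < eps / n.+1%:R by rewrite divr_gt0.
have near1 : \forall z \near y, V z /\ forall i, `|partial i g z - partial i g y| <= eps / n.+1%:R.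
  near=> z; split; first by near: z; exact: open_nbhs_nbhs.
  near: z; apply: filter_forall => i.
  have [_ /(Ck0_open _ oV) cp] := dg i.
  have /cvgrPdist_le/(_ _ en0) := cp y Vy.
  by apply: filterS => z; rewrite distrC.
have /nbhs_ballP[r /= r0 Hr] := near1.
near=> h.
have hr : `|h| < r.
  near: h; apply/nbhs_ballP; exists r => //= h.
  by rewrite -ball_normE/= sub0r normrN.
have inr z : `|z| <= `|h| -> V (y + z) /\ forall i, `|partial i g (y + z) - partial i g y| <= eps / n.+1%:R.
  move=> zh; apply: Hr; rewrite -ball_normE/= opprD addrA subrr sub0r normrN.
  exact: le_lt_trans zh hr.
have step (i : 'I_n) : `|g (y + trunc_rv i.+1 h) - g (y + trunc_rv i h) - h 0 i * partial i g y| <= `|h| * (eps / n.+1%:R).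
  have tE : trunc_rv i.+1 h = trunc_rv i h + h 0 i *: e_ i.
    apply/rowP => j; rewrite !mxE eqxx/=; case: (ssrnat.ltngtP i j) => ij.
    - by rewrite ltnS leqNgt ij/= (_ : (j == i) = false) ?mulr0 ?addr0//; apply/negbTE/eqP => E; rewrite E ltnn in ij.
    - by rewrite ltnS (ltnW ij) (_ : (j == i) = false) ?mulr0 ?addr0//; apply/negbTE/eqP => E; rewrite E ltnn in ij.
    - by rewrite (val_inj ij) ltnSn eqxx mulr1 add0r.
  have sm s : 0 <= s <= 1 -> `|trunc_rv i h + s *: (h 0 i *: e_ i)| <= `|h|.
    move=> /andP[s0 s1]; apply/norm_rv_le => // j; rewrite !mxE eqxx/=.
    have [ji|ij] := ltnP j i.
      rewrite (_ : (j == i) = false) ?mulr0 ?addr0 ?norm_coord_le//.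
      by apply/negbTE/eqP => E; rewrite E ltnn in ji.
    rewrite add0r; case: eqP => _; last by rewrite !mulr0 normr0.
    rewrite mulr1 normrM (ger0_norm s0); apply: le_trans (norm_coord_le h i).
    by rewrite ler_piMl.
  have dd s : 0 <= s <= 1 -> is_derive (y + trunc_rv i h + s *: (h 0 i *: e_ i)) (h 0 i *: e_ i) g (h 0 i * partial i g (y + trunc_rv i h + s *: (h 0 i *: e_ i))).
    move=> s01; apply: is_derive_scaledir.
    by have [di _] := dg i; apply: di; rewrite -addrA; apply: (inr _ _).1; exact: sm.
  have [s s01|s s01] := @MVT_direction _ g (y + trunc_rv i h) (h 0 i *: e_ i).
    by have [] := dd _ s01.
  rewrite tE addrA => ->.
  rewrite (@derive_val _ _ _ _ _ _ _ (dd _ s01)) -mulrBr normrM.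
  apply: ler_pM => //; first exact: norm_coord_le.
  by rewrite -addrA; apply: (inr _ _).2; exact: sm.
have tele : g (h + y) - g y = \sum_(i < n) (g (y + trunc_rv i.+1 h) - g (y + trunc_rv i h)).
  rewrite -(big_mkord xpredT (fun i => g (y + trunc_rv i.+1 h) - g (y + trunc_rv i h))).
  rewrite telescope_sumr//; congr (g _ - g _).
    by rewrite addrC; congr (_ + _); apply/rowP => j; rewrite !mxE ltn_ord.
  by rewrite -[LHS]addr0; congr (_ + _); apply/rowP => j; rewrite !mxE ltn0.
rewrite /= /L tele -sumrB; apply: le_trans (ler_norm_sum _ _ _) _.
apply: (@le_trans _ _ (\sum_(i < n) `|h| * (eps / n.+1%:R))); first exact: ler_sum.
have nE : n%:R * (eps / n.+1%:R) <= eps.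
  by rewrite mulrCA ler_piMr ?ltW// ltr_pdivrMr ?ltr0n// mul1r ltr_nat.
rewrite sumr_const card_ord -[leLHS]mulr_natl mulrCA [leRHS]mulrC.
exact: ler_wpM2l.
Unshelve. all: by end_near. Qed.

Lemma C1_derive n (V : set 'rV[R]_n) g y (v : 'rV[R]_n) : open V -> Ck 1 V g -> V y ->
  is_derive y v g (\sum_(i < n) v 0 i * partial i g y).
Proof.
move=> oV Cg Vy; have [dg E] := C1_differentiable oV Cg Vy.
by apply: DeriveDef; [exact: diff_derivable|rewrite deriveE].
Qed.

Lemma differentiable_rV (W : normedModType R) m (T : W -> 'rV[R]_m) y :
  (forall j, differentiable (fun z => T z 0 j) y) -> differentiable T y.
Proof.
move=> dT.
have -> : T = \sum_(j < m) (fun z => T z 0 j *: (e_ j : 'rV[R]_m)).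
  apply/funext => z; rewrite fct_sumE; apply/rowP => j; rewrite summxE (bigD1 j)//=.
  rewrite !mxE !eqxx mulr1 big1 ?addr0// => i ij.
  by rewrite !mxE eqxx/= eq_sym (negbTE ij) mulr0.
by apply: differentiable_sum => j; exact: differentiableZl.
Qed.

Lemma derive_rV_coord (W : normedModType R) m (T : W -> 'rV[R]_m) y v j :
  derivable T y v -> ('D_v T y) 0 j = 'D_v (fun z => T z 0 j) y.
Proof. by move=> dT; rewrite derive_mx// mxE. Qed.

Lemma C1_comp_derive n m (V : set 'rV[R]_n) (W : set 'rV[R]_m)
    (T : 'rV[R]_n -> 'rV[R]_m) g y (v : 'rV[R]_n) : open V -> open W ->
  (forall j, Ck 1 V (fun z => T z 0 j)) -> Ck 1 W g -> V y -> W (T y) ->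
  is_derive y v (g \o T)
    (\sum_(j < m) 'D_v (fun z => T z 0 j) y * partial j g (T y)).
Proof.
move=> oV oW CT Cg Vy WTy.
have dT : differentiable T y.
  by apply: differentiable_rV => j; have [] := C1_differentiable oV (CT j) Vy.
have [dg Eg] := C1_differentiable oW Cg WTy.
have dgT : differentiable (g \o T) y by exact: differentiable_comp.
apply: DeriveDef; first exact: diff_derivable.
rewrite deriveE// diff_comp//= Eg; apply: eq_bigr => j _.
by rewrite -derive_rV_coord ?deriveE//; exact: diff_derivable.
Qed.

Lemma Ck_rV_continuous n m k (V : set 'rV[R]_n) (T : 'rV[R]_n -> 'rV[R]_m) y :
  open V -> (forall j, Ck k V (fun z => T z 0 j)) -> V y -> {for y, continuous T}.
Proof.
move=> oV CT Vy; apply/(@cvgrPdist_le _ _ _ (nbhs y) _) => eps eps0.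
have nT : \forall z \near y, forall j, `|T y 0 j - T z 0 j| <= eps.
  apply: (@filter_forall _ _ (fun j z => `|T y 0 j - T z 0 j| <= eps) (nbhs y) _) => j.
  have cT : {for y, continuous (fun z => T z 0 j)} by exact: Ck_continuous (CT j) Vy.
  exact: (cvgrPdist_le _ _).1 cT _ eps0.
apply: filterS nT => z Tz; apply/norm_rv_le => [|j]; first exact: ltW.
by rewrite !mxE; exact: Tz.
Qed.

(** Induction on [k]: by the chain rule the partial derivatives of [g \o T] are
   sums of products of functions of class C^(k-1). *)
Lemma Ck_comp n m k (V : set 'rV[R]_n) (W : set 'rV[R]_m)
    (T : 'rV[R]_n -> 'rV[R]_m) g : open V -> open W ->
  (forall y, V y -> W (T y)) ->
  (forall j, Ck k V (fun z => T z 0 j)) -> Ck k W g -> Ck k V (g \o T).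
Proof.
move=> oV oW VW; elim: k g => [|k IH] g CT Cg.
  apply/Ck0_open => // y Vy; apply: continuous_comp.
    exact: Ck_rV_continuous CT Vy.
  by apply: Ck_continuous Cg _ => //; exact: VW.
apply/CkS_open => //; split=> [y Vy|i].
  apply: continuous_comp; first exact: Ck_rV_continuous CT Vy.
  by apply: Ck_continuous Cg _ => //; exact: VW.
have CT1 j : Ck 1 V (fun z => T z 0 j) by exact: Ck_le (CT j).
have Cg1 : Ck 1 W g by exact: Ck_le Cg.
have D y : V y -> is_derive y (e_ i) (g \o T)
    (\sum_(j < m) 'D_(e_ i) (fun z => T z 0 j) y * partial j g (T y)).
  by move=> Vy; apply: (C1_comp_derive _ oV oW CT1 Cg1) => //; exact: VW.
split=> [y /D[]//|].
apply: (@Ck_ext _ _ _ _ (fun y => \sum_(j < m) partial i (fun z => T z 0 j) y * partial j g (T y))) => //.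
  by move=> y Vy; rewrite /partial (@derive_val _ _ _ _ _ _ _ (D _ Vy)).
apply: Ck_sum => // j; apply: Ck_mul => //.
  by move: (CT j) => /(CkS_open _ _ oV)[_ /(_ i)[]].
apply: IH; first by move=> l; exact: CkW.
by move: Cg => /(CkS_open _ _ oW)[_ /(_ j)[]].
Qed.

End Chain.

(** * Lebesgue measure on R^n *)

Section SigmaFinitePack.
Context d (T : measurableType d) (R : realType) (m : {measure set T -> \bar R}).
(** A copy of a measure to which a proof of sigma-finiteness is attached, so that
   Tonelli's theorem applies to measures known only through an existence
   statement. *)
Definition with_sigma_finite of sigma_finite setT m : set T -> \bar R := m.
Variable sf : sigma_finite setT m.
HB.instance Definition _ := Measure.on (with_sigma_finite sf).
HB.instance Definition _ :=
  Measure_isSigmaFinite.Build d T R (with_sigma_finite sf) sf.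
End SigmaFinitePack.

Section EuclideanMeasure.
Variable R : realType.
Implicit Types (n : nat).

Local Notation borelV n := (g_sigma_algebraType (@open 'rV[R]_n)).
Local Notation leb := (@lebesgue_measure R).

Lemma mx_ballP n (c : 'rV[R]_n) r y :
  ball c r y <-> 0 < r /\ forall j, `|c 0 j - y 0 j| < r.
Proof.
split=> [[r0 H]|[r0 H]]; first by split=> // j; exact: H.
by split=> // i j; rewrite (ord1 i); exact: H.
Qed.

Lemma rat_approx n (x : 'rV[R]_n) (r : R) : 0 < r ->
  exists q : 'rV[rat]_n, ball (map_mx ratr q : 'rV[R]_n) r x.
Proof.
move=> r0.
have H (i : 'I_n) : exists q : rat, `|ratr q - x 0 i| < r.
  have [|q] := @rat_in_itvoo R (x 0 i - r) (x 0 i + r).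
    by rewrite ltrBlDr -addrA ltrDl addr_gt0.
  by rewrite in_itv/= => q_in; exists q; rewrite ltr_distl.
have [q Hq] := choice H.
by exists (\row_i q i); apply/mx_ballP; split=> // j; rewrite !mxE.
Qed.

(** The balls with rational centre and radius 1/(k+1) contained in [U], enumerated
   with empty balls of radius 0 at the other indices. *)
Lemma open_bigcup_ball n (U : set 'rV[R]_n) : open U ->
  exists (c : nat -> 'rV[R]_n) (r : nat -> R), U = \bigcup_m ball (c m) (r m).
Proof.
move=> oU.
pose inU (qk : 'rV[rat]_n * nat) :=
  `[< ball (map_mx ratr qk.1 : 'rV[R]_n) qk.2.+1%:R^-1 `<=` U >].
pose c m : 'rV[R]_n := if @unpickle ('rV[rat]_n * nat)%type m is Some qk
  then map_mx ratr qk.1 else 0.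
pose r m : R := if @unpickle ('rV[rat]_n * nat)%type m is Some qk
  then (if inU qk then qk.2.+1%:R^-1 else 0) else 0.
exists c, r; apply/seteqP; split=> [x Ux|x [m _]].
  have /nbhs_ballP[e /= e0 He] : nbhs x U by exact: open_nbhs_nbhs.
  have [k] : exists k : nat, k.+1%:R^-1 < e / 2.
    have e20 : 0 < e / 2 by rewrite divr_gt0.
    have [k _ /(_ k (leqnn _)) ?] := near_infty_natSinv_lt (PosNum e20).
    by exists k.
  move=> ke; have [q Hq] := @rat_approx n x k.+1%:R^-1 ltac:(by rewrite invr_gt0).
  exists (pickle (q, k)) => //; rewrite /c /r !pickleK/=.
  rewrite /inU/= asboolT// => z qz; apply: He.
  rewrite [e]splitr; apply: (@ball_triangle _ _ (map_mx ratr q : 'rV[R]_n)).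
    by apply/ball_sym; apply: le_ball Hq; exact: ltW.
  by apply: le_ball qz; exact: ltW.
rewrite /c /r; case: unpickle => [[q k]|]; last first.
  by move=> /mx_ballP[]; rewrite ltxx.
by rewrite /inU/=; case: asboolP => [h /h//|_ /mx_ballP[]]; rewrite ltxx.
Qed.

Lemma measurable_ballV n (c : 'rV[R]_n) r : measurable (ball c r : set (borelV n)).
Proof.
suff : open (ball c r) by move=> o; exact: sub_sigma_algebra.
have [r0|r0] := ltP 0 r; first exact: ball_open.
rewrite (_ : ball c r = set0); first exact: open0.
by rewrite -subset0 => y /mx_ballP[] /lt_le_trans /(_ r0); rewrite ltxx.
Qed.

Lemma measurable_ballR (c r : R) : measurable (ball c r : set (measurableTypeR R)).
Proof. by rewrite ball_itv; exact: measurable_itv. Qed.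

(** The identification of R x R^n with R^(1+n) that [iterated_integral] uses. *)
Definition consV n (ty : R * 'rV[R]_n) : 'rV[R]_(1 + n) :=
  row_mx (ty.1%:M : 'rV[R]_1) ty.2.

Lemma measurable_consV n :
  measurable_fun [set: measurableTypeR R * borelV n] (@consV n : _ -> borelV (1 + n)).
Proof.
apply: (@measurability _ _ _ (borelV (1 + n)) _ _ (@open 'rV[R]_(1 + n))) => //.
move=> _ [U oU <-]; rewrite setTI.
have [c [r ->]] := open_bigcup_ball oU.
rewrite preimage_bigcup; apply: bigcup_measurable => m _.
rewrite (_ : _ @^-1` _ = (ball (c m 0 (lshift n 0)) (r m) : set (measurableTypeR R))
   `*` (ball (rsubmx (c m)) (r m) : set (borelV n))).
  apply: measurableX; last exact: measurable_ballV.
  exact: measurable_ballR.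
apply/seteqP; split=> [[t y] /mx_ballP[r0 H]|[t y] [/= H0 /mx_ballP[r0 H]]].
  split=> /=; first by have := H (lshift n 0); rewrite row_mxEl mxE eqxx mulr1n.
  apply/mx_ballP; split=> // j; have := H (rshift 1 j).
  by rewrite row_mxEr !mxE.
apply/mx_ballP; split=> // j; rewrite /consV; case: (split_ordP j) => i ->.
  by rewrite row_mxEl (ord1 i) mxE eqxx mulr1n.
by have := H i; rewrite row_mxEr !mxE.
Qed.

Lemma measurable_consV1 n (t : R) :
  measurable_fun [set: borelV n] (fun y => consV (t, y) : borelV (1 + n)).
Proof.
apply: (@measurableT_comp _ _ _ _ (measurableTypeR R * borelV n)%type (borelV (1 + n)) (@consV n)) => //.
exact: (@measurable_consV n).
Qed.

(** By induction on the dimension: push the product of one-dimensional Lebesgue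
   measure with the measure on R^n forward along [consV], and apply Tonelli's
   theorem. The bound on balls is carried along because it makes the measure
   sigma-finite, as the product requires. *)
Lemma lebesgueV_exists n : exists m : {measure set (borelV n) -> \bar R},
  (forall r : R, 0 < r -> (0 < m (ball (0%R : 'rV[R]_n) r) < +oo)%E) /\
  forall g : borelV n -> \bar R, measurable_fun setT g -> (forall y, 0 <= g y)%E ->
    (\int[m]_y g y = iterated_integral (g : 'rV[R]_n -> \bar R))%E.
Proof.
elim: n => [|n [m [mfin mE]]].
  exists (dirac ((0 : 'rV[R]_0) : borelV 0)); split=> [r r0|g mg g0 /=].
    rewrite -[X in (_ < X < _)%E]/((\1_(ball (0 : 'rV[R]_0) r : set 'rV[R]_0) (0 : 'rV[R]_0) : R)%:E).
    by rewrite ltry andbT lte_fin indicE mem_set//; exact: ballxx.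
  rewrite integral_dirac// -[X in (X * _)%E]/((\1_(setT : set 'rV[R]_0) (0 : 'rV[R]_0) : R)%:E).
  by rewrite indicE in_setT mul1e.
have sf : sigma_finite setT m.
  exists (fun k => ball (0 : 'rV[R]_n) k.+1%:R); last first.
    by move=> k; split; [exact: measurable_ballV|have /andP[] := mfin _ (ltr0Sn R k)].
  apply/esym; rewrite -subTset => y _.
  exists (Num.truncn `|y|) => //; rewrite -ball_normE/= sub0r normrN.
  exact: truncnS_gt.
pose mS : {sigma_finite_measure set (borelV n) -> \bar R} := @with_sigma_finite _ _ _ m sf.
have mSE A : mS A = m A by [].
pose MC := isMeasurableFun.Build _ _ _ _ _ (@measurable_consV n).
pose C : {mfun (measurableTypeR R * borelV n)%type >-> borelV (1 + n)} :=
  HB.pack (@consV n) MC.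
pose PM : {measure set (borelV (1 + n)) -> \bar R} := pushforward (leb \x mS)%E C.
exists (PM (@measurable_consV n)); split=> [r r0|g mg g0].
  have E : @consV n @^-1` ball (0 : 'rV[R]_(1 + n)) r =
      (ball (0 : R) r : set (measurableTypeR R))
      `*` (ball (0 : 'rV[R]_n) r : set (borelV n)).
    apply/seteqP; split=> [[t y] /mx_ballP[_ H]|[t y] [/= H0 /mx_ballP[_ H]]].
      split=> /=; first by have := H (lshift n 0); rewrite row_mxEl !mxE eqxx mulr1n.
      apply/mx_ballP; split=> // j; have := H (rshift 1 j).
      by rewrite row_mxEr !mxE.
    apply/mx_ballP; split=> // j; rewrite /consV; case: (split_ordP j) => i ->.
      by rewrite row_mxEl (ord1 i) !mxE eqxx mulr1n.
    by have := H i; rewrite row_mxEr !mxE.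
  suff : (0%E < (leb \x mS) ((ball (0 : R) r : set (measurableTypeR R))
      `*` (ball (0 : 'rV[R]_n) r : set (borelV n)))%R < +oo)%E by rewrite -E.
  rewrite product_measure1E//; [|exact: measurable_ballR|exact: measurable_ballV].
  have h := lebesgue_measure_ball (0 : R) (ltW r0).
  have /andP[m0 moo] := mfin _ r0.
  apply/andP; split.
    by apply: mule_gt0 => //; rewrite [X in (_ < X)%E]h lte_fin pmulrn_lgt0.
  apply: lte_mul_pinfty => //.
  by rewrite [X in X \is a fin_num]h.
rewrite /PM ge0_integral_pushforward//.
rewrite fubini_tonelli1; [| |by move=> x; exact: g0]; last first.
  exact: (measurableT_comp mg (@measurable_consV n)).
apply: eq_integral => t _; rewrite -[RHS]/(iterated_integral (fun y : 'rV[R]_n => g (consV (t, y)))).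
rewrite /fubini_F/= -mE//; last first.
  exact: (measurableT_comp mg (@measurable_consV1 n t)).
Qed.

Definition lebV n : {measure set (borelV n) -> \bar R} := sval (cid (lebesgueV_exists n)).

Lemma lebV_ball n (r : R) : 0 < r -> (0 < lebV n (ball (0%R : 'rV[R]_n) r) < +oo)%E.
Proof. by rewrite /lebV; case: cid => /= m [H _]; exact: H. Qed.

Lemma integral_lebV n (g : borelV n -> \bar R) : measurable_fun setT g ->
  (forall y, 0 <= g y)%E ->
  (\int[lebV n]_y g y = iterated_integral (g : 'rV[R]_n -> \bar R))%E.
Proof. by rewrite /lebV; case: cid => /= m [_]; exact. Qed.

Lemma lebV_sigma_finite n : sigma_finite setT (lebV n).
Proof.
exists (fun k => ball (0 : 'rV[R]_n) k.+1%:R); last first.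
  by move=> k; split; [exact: measurable_ballV|have /andP[] := lebV_ball n (ltr0Sn R k)].
apply/esym; rewrite -subTset => y _.
exists (Num.truncn `|y|) => //; rewrite -ball_normE/= sub0r normrN.
exact: truncnS_gt.
Qed.

End EuclideanMeasure.

(** * Translation invariance, and functions with bounded support *)

Lemma lebesgue_integral_shift (R : realType) (c : R) (h : R -> \bar R) :
  measurable_fun [set: measurableTypeR R] h -> (forall t, 0 <= h t)%E ->
  (\int[@lebesgue_measure R]_t h (t + c)%R = \int[@lebesgue_measure R]_t h t)%E.
Proof.
move=> mh h0.
have ms : measurable_fun [set: measurableTypeR R] (fun t : measurableTypeR R => t + c : measurableTypeR R).
  exact: measurable_funD.
transitivity (\int[pushforward (@lebesgue_measure R) (fun t : measurableTypeR R => (t + c)%R : measurableTypeR R)]_t h t)%E.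
  by rewrite ge0_integral_pushforward//.
apply: eq_measure_integral => A mA _; apply/esym.
apply: (@lebesgue_measure_unique R (pushforward (@lebesgue_measure R) _)) => //.
move=> _ [[a b] _ <-].
rewrite /pushforward -[RHS]/(lebesgue_measure (+%R^~ c @^-1` `]a, b]%classic)).
rewrite (_ : _ @^-1` _ = `](a - c), (b - c)]%classic); last first.
  by apply/seteqP; split=> t /=; rewrite !in_itv/= ltrBlDr lerBrDr.
by rewrite !lebesgue_measure_itv/= !lte_fin ltrD2r -!EFinD opprD opprK addrACA addNr addr0.
Qed.

Lemma open_measurable_fun (R : realType) (T : ptopologicalType) (T' : ptopologicalType)
    (D : set T) (g : T -> T') : open D -> (forall x, D x -> {for x, continuous g}) ->
  measurable_fun (D : set (g_sigma_algebraType (@open T)))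
    (g : g_sigma_algebraType (@open T) -> g_sigma_algebraType (@open T')).
Proof.
move=> oD cg.
apply: (@measurability _ _ _ (g_sigma_algebraType (@open T')) _ _ (@open T')) => //.
move=> _ [U oU <-]; apply: sub_sigma_algebra.
rewrite openE => x [Dx Ux] /=; apply: filterI; first exact: open_nbhs_nbhs.
by apply: cg => //; exact: open_nbhs_nbhs.
Qed.

Lemma open_measurable_funR (R : realType) (T : ptopologicalType)
    (D : set T) (g : T -> R) : open D -> (forall x, D x -> {for x, continuous g}) ->
  measurable_fun (D : set (g_sigma_algebraType (@open T)))
    (g : g_sigma_algebraType (@open T) -> R).
Proof.
move=> oD cg.
move=> mD; apply: (measurability _ (RGenOpens.measurableE R)) => //.
move=> _ [_ [a [b ->]] <-]; apply: sub_sigma_algebra.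
rewrite openE => x [Dx Ux] /=; apply: filterI; first exact: open_nbhs_nbhs.
by apply: cg => //; apply: open_nbhs_nbhs; split => //; exact: interval_open.
Qed.

Section EuclideanIntegral.
Variable R : realType.
Implicit Types (n : nat).

Local Notation borelV n := (g_sigma_algebraType (@open 'rV[R]_n)).
Local Notation leb := (@lebesgue_measure R).

Lemma measurable_shiftV n (v : 'rV[R]_n) :
  measurable_fun [set: borelV n] ((fun y : 'rV[R]_n => y + v) : borelV n -> borelV n).
Proof.
apply: (@open_measurable_fun R _ _ setT) => [|x _]; first exact: openT.
by apply: (@cvgD _ _ _ (nbhs x) _); [exact: cvg_id|exact: cvg_cst].
Qed.

(** On the iterated integral a translation acts coordinate by coordinate, so the
   one-dimensional invariance suffices. *)
Lemma integral_lebV_shift n (v : 'rV[R]_n) (g : borelV n -> \bar R) :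
  measurable_fun setT g -> (forall y, 0 <= g y)%E ->
  (\int[lebV R n]_y g (y + v)%R = \int[lebV R n]_y g y)%E.
Proof.
move=> mg g0; rewrite !integral_lebV//; last first.
  exact: (measurableT_comp mg (measurable_shiftV v)).
elim: n v g mg g0 => [|n IH] v g mg g0.
  by rewrite /= (_ : 0 + v = 0)//; apply/rowP => -[].
pose v0 := (v : 'rV[R]_(1 + n)) 0 (lshift n 0); pose v' : 'rV[R]_n := rsubmx (v : 'rV[R]_(1 + n)).
pose h (t : measurableTypeR R) := (\int[lebV R n]_y g (consV (t, y)))%E.
have mgc t : measurable_fun [set: borelV n] (fun y => g (consV (t, y))).
  exact: (measurableT_comp mg (@measurable_consV1 R n t)).
have mh : measurable_fun [set: measurableTypeR R] h.
  pose mS : {sigma_finite_measure set (borelV n) -> \bar R} :=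
    @with_sigma_finite _ _ _ (lebV R n) (@lebV_sigma_finite R n).
  apply: (@measurable_fun_fubini_tonelli_F _ _ _ _ _ mS (fun ty => g (consV ty))).
    by exact: (measurableT_comp mg (@measurable_consV R n)).
  by move=> x; exact: g0.
transitivity (\int[leb]_t h (t + v0)%R)%E.
  apply: eq_integral => t _.
  rewrite -[LHS]/(iterated_integral (fun y : 'rV[R]_n => g (consV (t, y) + v))).
  rewrite /h integral_lebV// -[RHS](IH v')//.
  congr iterated_integral; apply/funext => y; congr g.
  apply/rowP => j; rewrite /consV !mxE; case: splitP => i ij; rewrite !mxE.
    rewrite (ord1 i) eqxx !mulr1n; congr (_ + v _ _); apply/val_inj => /=.
    by rewrite ij (ord1 i).
  by congr (_ + v _ _); apply/val_inj => /=.
rewrite lebesgue_integral_shift//; last by move=> t; apply: integral_ge0.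
by apply: eq_integral => t _; rewrite /h integral_lebV.
Qed.

Lemma Rintegral_lebV_shift n (v : 'rV[R]_n) (f : borelV n -> R) :
  measurable_fun setT f ->
  \int[lebV R n]_y f (y + v) = \int[lebV R n]_y f y.
Proof.
move=> mf; rewrite /Rintegral; congr fine.
rewrite integralE [RHS]integralE.
have mp : measurable_fun [set: borelV n] (fun y => ((EFin \o f)^\+ y)%E).
  by apply: measurable_funepos; exact/measurable_EFinP.
have mn : measurable_fun [set: borelV n] (fun y => ((EFin \o f)^\- y)%E).
  by apply: measurable_funeneg; exact/measurable_EFinP.
congr (_ - _)%E.
  have h : forall y, (0 <= (EFin \o f)^\+ y)%E by move=> y; exact: funepos_ge0.
  by rewrite -(integral_lebV_shift v mp h); apply: eq_integral => y _; rewrite !funeposE.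
have h : forall y, (0 <= (EFin \o f)^\- y)%E by move=> y; exact: funeneg_ge0.
by rewrite -(integral_lebV_shift v mn h); apply: eq_integral => y _; rewrite !funenegE.
Qed.

(** The function is dominated by a constant on a ball, which has finite measure. *)
Lemma suppV_integrable n (f : borelV n -> R) (r C : R) : 0 < r ->
  measurable_fun setT f -> (forall y : 'rV[R]_n, r <= `|y| -> f y = 0) ->
  (forall y, `|f y| <= C) -> (lebV R n).-integrable setT (EFin \o f).
Proof.
move=> r0 mf fr fC.
have mB := @measurable_ballV R n 0 r.
have -> : EFin \o f = (EFin \o f) \_ (ball (0 : 'rV[R]_n) r).
  apply/funext => y; rewrite patchE; case: ifPn => //.
  rewrite notin_setE -ball_normE/= sub0r normrN => /negP; rewrite -leNgt => ry.
  by rewrite fr.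
apply: (integrable_mkcond _ mB).1; apply: measurable_bounded_integrable => //.
- by have /andP[] := lebV_ball n r0.
- exact: measurable_funS mf.
- exists C; split => [|x]; first exact: num_real.
  move=> Cx y _; apply: le_trans (fC y) _; exact: ltW.
Qed.

Lemma suppV_le_integral n (f : borelV n -> R) (r C : R) : 0 < r ->
  measurable_fun setT f -> (forall y : 'rV[R]_n, r <= `|y| -> f y = 0) ->
  (forall y, `|f y| <= C) ->
  `|\int[lebV R n]_y f y| <= C * fine (lebV R n (ball (0 : 'rV[R]_n) r)).
Proof.
move=> r0 mf fr fC.
have mB := @measurable_ballV R n 0 r.
have -> : \int[lebV R n]_y f y = \int[lebV R n]_(y in ball (0 : 'rV[R]_n) r) f y.
  rewrite [RHS]Rintegral_mkcond; apply: eq_Rintegral => y _; rewrite patchE; case: ifPn => //.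
  rewrite notin_setE -ball_normE/= sub0r normrN => /negP; rewrite -leNgt => ry.
  by rewrite fr.
have intf : (lebV R n).-integrable (ball (0 : 'rV[R]_n) r) (EFin \o f).
  by apply: integrableS (suppV_integrable r0 mf fr fC) => //.
apply: le_trans (le_normr_Rintegral _ intf) _ => //.
rewrite -Rintegral_cst//; apply: le_Rintegral => //.
  exact: (integrable_norm intf).
have /andP[_ lo] := lebV_ball n r0.
by apply: measurable_bounded_integrable => //; exact: bounded_cst.
Qed.

Lemma continuous_measurableV n (g : 'rV[R]_n -> R) : continuous g ->
  measurable_fun [set: borelV n] (g : borelV n -> R).
Proof. by move=> cg; apply: open_measurable_funR => [|x _]; [exact: openT|exact: cg]. Qed.

Lemma closed_ballV_compact n (r : R) : compact [set y : 'rV[R]_n | `|y| <= r].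
Proof.
apply: bounded_closed_compact.
  exists r; split; first exact: num_real.
  by move=> M rM y /= yr; apply: le_trans yr (ltW rM).
have -> : [set y : 'rV[R]_n | `|y| <= r] = Num.norm @^-1` [set t : R | t <= r] by [].
apply: closed_comp; last exact: closed_le.
by move=> y _; exact: norm_continuous.
Qed.

Lemma suppV_bounded n (g : 'rV[R]_n -> R) r : continuous g ->
  (forall y, r <= `|y| -> g y = 0) -> exists2 C, 0 <= C & forall y, `|g y| <= C.
Proof.
move=> cg gr.
have /compact_bounded[M [_ HM]] : compact (g @` [set y | `|y| <= r]).
  apply: continuous_compact; last exact: closed_ballV_compact.
  exact: continuous_subspaceT.
exists (`|M| + 1); first by rewrite addr_ge0.
move=> y; have [ry|yr] := leP r `|y|; first by rewrite gr// normr0 addr_ge0.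
apply: HM; first by rewrite ltr_pwDr// ler_norm.
by exists y => //=; exact: ltW.
Qed.

(** Compactness of the ball of radius [r + 1]; outside it, for [z] of norm less
   than 1, both values vanish. *)
Lemma suppV_unif_continuous n (g : 'rV[R]_n -> R) r : continuous g ->
  (forall y, r <= `|y| -> g y = 0) -> forall eps, 0 < eps ->
  exists2 d, 0 < d & forall y z, `|z| < d -> `|g (z + y) - g y| <= eps.
Proof.
move=> cg gr eps eps0.
have := (@compact_near_coveringP _ _).1 (@closed_ballV_compact n (r + 1)).
move=> /(_ 'rV[R]_n (nbhs (0 : 'rV[R]_n)) (fun z y => `|g (z + y) - g y| <= eps) _) H.
have /nbhs_ballP[d /= d0 Hd] : \forall z \near (0 : 'rV[R]_n), [set y | `|y| <= r + 1] `<=` (fun y => `|g (z + y) - g y| <= eps).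
  apply: H => y _.
  have e20 : 0 < eps / 2 by rewrite divr_gt0.
  have nyg : \forall w \near y, `|g y - g w| <= eps / 2.
    exact: (cvgrPdist_le _ _).1 (cg y) _ e20.
  have /nbhs_ballP[d /= d0 Hd] := nyg.
  have d20 : 0 < d / 2 by rewrite divr_gt0.
  exists (ball y (d / 2), ball 0 (d / 2)) => /=.
    by split; exact: nbhsx_ballx.
  move=> [y' z] /= [yy' zd].
  have zy' : `|g y - g (z + y')| <= eps / 2.
    apply: Hd; rewrite [d]splitr; apply: (@ball_triangle _ _ y') => //.
    by move: zd; rewrite -!ball_normE/= sub0r normrN opprD addrCA subrr addr0 normrN.
  have y'E : `|g y - g y'| <= eps / 2.
    by apply: Hd; apply: le_ball yy'; rewrite ler_pdivrMr// ler_peMr ?ler1n// ltW.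
  rewrite (_ : _ - _ = (g y - g y') - (g y - g (z + y'))); last by ring.
  by apply: le_trans (ler_normB _ _) _; rewrite [eps]splitr lerD.
exists (Num.min d 1); first by rewrite lt_min; apply/andP.
move=> y z; rewrite lt_min => /andP[zd z1].
have [yr|ry] := leP `|y| (r + 1).
  by apply: Hd => //=; rewrite -ball_normE/= sub0r normrN.
rewrite !gr ?subrr ?normr0 ?ltW//.
  by apply: lt_trans ry; rewrite ltrDl.
rewrite -(ltrD2r 1); apply: lt_le_trans ry _.
have := ler_normB (z + y) z; rewrite addrAC subrr add0r => h.
by apply: le_trans h _; rewrite lerD2l ltW.
Qed.

End EuclideanIntegral.

(** * Smooth bump functions *)

Lemma is_derive_line (R : realType) (V : normedModType R) (f : V -> R) (x v : V) (d : R) :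
  is_derive (0 : R) 1 (fun h : R => f (h *: v + x)) d -> is_derive x v f d.
Proof.
have E : (fun h : R => h^-1 *: (((fun t : R => f (t *: v + x)) \o shift 0) (h *: 1)
   - f (0 *: v + x))) = (fun h : R => h^-1 *: ((f \o shift x) (h *: v) - f x)).
  apply/funext => h /=; congr (_ *: (f _ - f _)); last by rewrite scale0r add0r.
  by rewrite addr0 [h *: 1]mulr1.
case; rewrite /derivable /derive E => d1 d2.
exact: DeriveDef.
Qed.

Lemma line_is_derive (R : realType) (V : normedModType R) (f : V -> R) (x v : V) (d : R) :
  is_derive x v f d -> is_derive (0 : R) 1 (fun h : R => f (h *: v + x)) d.
Proof.
have E : (fun h : R => h^-1 *: (((fun t : R => f (t *: v + x)) \o shift 0) (h *: 1)
   - f (0 *: v + x))) = (fun h : R => h^-1 *: ((f \o shift x) (h *: v) - f x)).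
  apply/funext => h /=; congr (_ *: (f _ - f _)); last by rewrite scale0r add0r.
  by rewrite addr0 [h *: 1]mulr1.
case; rewrite /derivable /derive -E => d1 d2.
exact: DeriveDef.
Qed.

Lemma is_derive_comp_real (R : realType) (V : normedModType R) (f : V -> R)
    (h : R -> R) (x v : V) (df dh : R) :
  is_derive x v f df -> is_derive (f x) 1 h dh ->
  is_derive x v (h \o f) (dh * df).
Proof.
move=> /line_is_derive[df1 df2] [dh1 dh2]; apply: is_derive_line.
have dh' : derivable h (f (0 *: v + x)) 1 by rewrite scale0r add0r.
have dif : differentiable (fun t : R => f (t *: v + x)) 0 by exact/derivable1_diffP.
have dih : differentiable h (f (0 *: v + x)) by exact/derivable1_diffP.
apply: DeriveDef.
  by apply/derivable1_diffP; exact: (differentiable_comp dif dih).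
rewrite -derive1E.
rewrite (_ : (fun t : R => (h \o f) (t *: v + x)) = h \o (fun t : R => f (t *: v + x)))//.
rewrite derive1_comp// !derive1E scale0r add0r dh2; congr (_ * _).
exact: df2.
Qed.

Section FlatFunction.
Variable R : realType.

(** The functions p(1/t) exp(-1/t), extended by 0 for t <= 0. The derivative of
   one of them is another one, so their smoothness is an induction on the order
   of differentiation. *)
Definition flat (p : {poly R}) (t : R) : R :=
  if 0 < t then p.[t^-1] * expR (- t^-1) else 0.

Lemma expR_ge_monomial (x : R) (m : nat) : 0 <= x -> x ^+ m <= m`!%:R * expR x.
Proof.
case: m => [|m] x0; first by rewrite expr0 fact0 mul1r -expR0 ler_expR.
rewrite mulrC -ler_pdivrMr ?ltr0n ?fact_gt0//.
by apply: le_trans (expR_ge1Dxn m x0); rewrite lerDr.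
Qed.

(** With x = 1/t, a multiple of exp(x) dominates the polynomial p(x) x^2. The
   square makes the difference quotient at 0 tend to 0. *)
Lemma flat_bound p : exists C : R, forall t, `|flat p t| <= C * t ^+ 2.
Proof.
exists (\sum_(i < size p) `|p`_i| * (i + 2)`!%:R) => t; rewrite /flat.
case: ifPn => [t0|_]; last first.
  rewrite normr0 mulr_ge0 ?sqr_ge0//; apply: sumr_ge0 => i _.
  by rewrite mulr_ge0.
have x0 : 0 < t^-1 by rewrite invr_gt0.
set x := t^-1 in x0 *.
have -> : t ^+ 2 = (x ^+ 2)^-1 by rewrite /x -exprVn invrK.
rewrite normrM (ger0_norm (expR_ge0 _)) expRN ler_pdivlMr ?exprn_gt0//.
rewrite mulrAC ler_pdivrMr ?expR_gt0//.
rewrite horner_coef mulr_suml.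
apply: (@le_trans _ _ ((\sum_(i < size p) `|p`_i| * x ^+ i) * x ^+ 2)).
  apply: ler_wpM2r; first by rewrite sqr_ge0.
  apply: le_trans (ler_norm_sum _ _ _) _; apply: ler_sum => i _.
  by rewrite normrM (ger0_norm (exprn_ge0 _ (ltW x0))).
rewrite mulr_suml; apply: ler_sum => i _.
by rewrite -!mulrA ler_wpM2l// -exprD; apply: expR_ge_monomial; exact: ltW.
Qed.

(** At 0 the derivative comes from the quadratic bound of [flat_bound]; elsewhere
   from the product and chain rules. *)
Lemma flat_derive (p : {poly R}) (t : R) : is_derive t 1 (flat p) (flat ('X ^+ 2 * (p - p^`())) t).
Proof.
have [t0|t0|<-] := ltgtP 0 t.
- have nE : \forall s \near t, p.[s^-1] * expR (- s^-1) = flat p s.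
    near=> s; rewrite /flat ifT//; near: s; exact: lt_nbhsr.
  apply: (near_eq_is_derive nE).
  rewrite /flat t0.
  have dV : is_derive t 1 (fun s : R => s^-1) (- t ^- 2).
    have t0' : (fun s : R => s) t != 0 by rewrite lt0r_neq0.
    apply: (is_derive_eq (@realfun.is_deriveV R (fun s : R => s) t 1 1 t0' (is_derive_id t 1))).
    by rewrite [_ *: 1]mulr1.
  have dp : is_derive t 1 (horner p \o (fun s : R => s^-1)) ((p^`()).[t^-1] * (- t ^- 2)).
    have dh : is_derive (t^-1) (1 : R) (horner p) ((p^`()).[t^-1]).
      apply: DeriveDef; first exact: derivable_horner.
      by rewrite -derive1E derivE.
    exact: (is_derive_comp_real dV dh).
  have de : is_derive t 1 (expR \o (fun s : R => - s^-1)) (expR (- t^-1) * (t ^- 2)).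
    have dN : is_derive t 1 (fun s : R => - s^-1) (t ^- 2).
      by have := is_deriveN dV; rewrite opprK.
    exact: (is_derive_comp_real dN (is_derive_expR _)).
  apply: (is_derive_eq (is_deriveM dp de)).
  rewrite /= !hornerE /GRing.scale/= -exprVn; ring.
- have nE : \forall s \near t, 0 = flat p s.
    near=> s; rewrite /flat ifF//; apply/negbTE; rewrite -leNgt ltW//.
    near: s; exact: lt_nbhsl.
  apply: (near_eq_is_derive nE).
  rewrite /flat ifF; last by apply/negbTE; rewrite -leNgt ltW.
  exact: is_derive_cst.
- have [C HC] := flat_bound p.
  have C0 : 0 <= C by have := HC 1; rewrite expr1n mulr1; apply: le_trans.
  rewrite {2}/flat ltxx.
  suff cv : (fun h : R => h^-1 *: ((flat p \o shift 0) (h *: 1) - flat p 0)) h @[h --> 0^'] --> (0 : R).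
    by apply: DeriveDef; [apply/cvg_ex; exists 0|exact: cvg_lim cv].
  apply/cvgrPdist_le => eps eps0; near=> h.
  rewrite sub0r normrN /= addr0 [h *: 1]mulr1 {2}/flat ltxx subr0.
  have h0 : h != 0 by near: h; exact: nbhs_dnbhs_neq.
  rewrite normrZ normfV ler_pdivrMl ?normr_gt0//.
  apply: le_trans (HC h) _.
  rewrite -real_normK ?num_real// expr2 mulrCA ler_wpM2l//.
  apply: (@le_trans _ _ ((C + 1) * `|h|)); first by rewrite ler_wpM2r// lerDl.
  rewrite mulrC -ler_pdivlMr ?ltr_pwDr//.
  rewrite ltW//; near: h; apply: dnbhs0_lt; rewrite divr_gt0//.
  by rewrite ltr_pwDr.
Unshelve. all: by end_near. Qed.

Lemma Ck_flat_coord n k (p : {poly R}) (s c : R) (j : 'I_n) :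
  Ck k [set: 'rV[R]_n] (fun y => flat p (s * y 0 j + c)).
Proof.
have oT := @openT 'rV[R]_n.
have dl i y : is_derive y (delta_mx 0 i) (fun y : 'rV[R]_n => s * y 0 j + c) (s * (i == j)%:R).
  apply: (is_derive_eq (is_deriveD (is_deriveM (is_derive_cst s _ _) (derive_coord i j y)) (is_derive_cst c _ _))).
  by rewrite /= scaler0 !addr0.
have cf (q : {poly R}) : continuous (flat q).
  move=> t; apply: differentiable_continuous; apply/derivable1_diffP.
  by have [] := flat_derive q t.
have cc (q : {poly R}) y : {for y, continuous (fun y : 'rV[R]_n => flat q (s * y 0 j + c))}.
  apply: (@cvg_comp _ _ _ (fun y : 'rV[R]_n => s * y 0 j + c) (flat q) _ (nbhs (s * y 0 j + c))).
    apply: (@cvgD _ _ _ (nbhs y) _ (fun y : 'rV[R]_n => s * y 0 j) (fun=> c)); last exact: cvg_cst.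
    apply: (@cvgM _ _ (nbhs y) _ (fun=> s) (fun y : 'rV[R]_n => y 0 j)); first exact: cvg_cst.
    exact: coord_continuous.
  exact: cf.
have dq (q : {poly R}) i y : is_derive y (delta_mx 0 i) (fun y : 'rV[R]_n => flat q (s * y 0 j + c))
    (flat ('X ^+ 2 * (q - q^`())) (s * y 0 j + c) * (s * (i == j)%:R)).
  exact: (is_derive_comp_real (dl i y) (flat_derive q (s * y 0 j + c))).
elim: k p => [|k IH] p; first by apply/Ck0_open => // y _; exact: cc.
apply/CkS_open => //; split=> [y _|i]; first exact: cc.
split=> [y _|]; first by have [] := dq p i y.
apply: (@Ck_ext _ _ _ _ (fun y => (s * (i == j)%:R) * flat ('X ^+ 2 * (p - p^`())) (s * y 0 j + c))) => //.
  by move=> y _; rewrite /partial (@derive_val _ _ _ _ _ _ _ (dq p i y)) mulrC.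
by apply: Ck_scale => //; exact: IH.
Qed.

(** A product over the coordinates, because the norm of a row is the maximum of
   the absolute values of its entries: for [d > 0] the bump is positive exactly on
   the ball of radius [d]. *)
Definition bump n (d : R) (y : 'rV[R]_n) : R :=
  \prod_(j < n) (flat 1 (-1 * y 0 j + d) * flat 1 (1 * y 0 j + d)).

Lemma flat1_gt0 t : (0 < flat 1 t) = (0 < t).
Proof.
rewrite /flat; have [t0|t0] := boolP (0 < t); last exact: ltxx.
by rewrite hornerC mul1r expR_gt0.
Qed.

Lemma flat1_ge0 t : 0 <= flat 1 t.
Proof.
rewrite /flat; case: ifPn => // t0.
by rewrite hornerC mul1r expR_ge0.
Qed.

Lemma bump_Ck n d k : Ck k setT (@bump n d).
Proof.
have oT := @openT 'rV[R]_n.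
apply: Ck_prod => // j; apply: Ck_mul => //; exact: Ck_flat_coord.
Qed.

Lemma bump_ge0 n d y : 0 <= @bump n d y.
Proof. by apply: prodr_ge0 => j _; rewrite mulr_ge0 ?flat1_ge0. Qed.

Lemma bump_gt0 n d y : 0 < d -> `|y| < d -> 0 < @bump n d y.
Proof.
move=> d0 yd; apply: prodr_gt0 => j _.
have := le_lt_trans (norm_coord_le y j) yd; rewrite ltr_norml => /andP[h1 h2].
by rewrite mulr_gt0// flat1_gt0; lra.
Qed.

Lemma bump_eq0 n d y : 0 < d -> d <= `|y| -> @bump n d y = 0.
Proof.
move=> d0 dy; have [j Hj] : exists j, d <= `|y 0 j|.
  apply/not_existsP => H; move: dy; rewrite leNgt => /negP; apply.
  have : ball (0 : 'rV[R]_n) d y.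
    apply/mx_ballP; split=> // j; rewrite mxE sub0r normrN ltNge.
    by apply/negP => h; exact: (H j).
  by rewrite -ball_normE/= sub0r normrN.
rewrite /bump (bigD1 j)//=.
suff -> : flat 1 (-1 * y 0 j + d) * flat 1 (1 * y 0 j + d) = 0 by rewrite mul0r.
have flat0 t : t <= 0 -> flat 1 t = 0.
  by move=> t0; rewrite /flat ifF//; apply/negbTE; rewrite -leNgt.
have [y0|y0] := leP 0 (y 0 j).
  by rewrite flat0 ?mul0r//; move: Hj; rewrite ger0_norm//; lra.
by rewrite mulrC flat0 ?mul0r//; move: Hj; rewrite ltr0_norm//; lra.
Qed.

End FlatFunction.

(** * Mollification in R^n *)

Section Convolution.
Variable R : realType.
Implicit Types (n : nat).

Local Notation borelV n := (g_sigma_algebraType (@open 'rV[R]_n)).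
Local Notation e_ i := (delta_mx 0 i).

Lemma affine_continuous n (c : R) (y : 'rV[R]_n) :
  continuous (fun z : 'rV[R]_n => z + c *: y).
Proof.
by move=> z; apply: (@cvgD _ _ _ (nbhs z) _); [exact: cvg_id|exact: cvg_cst].
Qed.

Lemma measurable_affine n (b : 'rV[R]_n -> R) (c : R) y : continuous b ->
  measurable_fun [set: borelV n] ((fun z => b (z + c *: y)) : borelV n -> R).
Proof.
move=> cb; apply: continuous_measurableV => z.
apply: (@cvg_comp _ _ _ (fun z : 'rV[R]_n => z + c *: y) b _ (nbhs (z + c *: y))).
  exact: affine_continuous.
exact: cb.
Qed.

(** The parameter [c] covers both forms of the smoothing of a function g: with
   c = 1, [a] the kernel and [b] = g, derivatives fall on g; with c = -1, [a] = g
   and [b] the kernel, they fall on the kernel. *)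
Definition correl n (a b : 'rV[R]_n -> R) (c : R) (y : 'rV[R]_n) : R :=
  \int[lebV R n]_z (a z * b (z + c *: y)).

Section correl.
Variables (n : nat) (a : 'rV[R]_n -> R) (r Ca : R).
Hypotheses (r0 : 0 < r) (ma : measurable_fun [set: borelV n] (a : borelV n -> R))
  (ar : forall y, r <= `|y| -> a y = 0) (aC : forall y, `|a y| <= Ca).

Lemma correl_integrable (b : 'rV[R]_n -> R) c y (Cb : R) :
  continuous b -> (forall y, `|b y| <= Cb) ->
  (lebV R n).-integrable setT (EFin \o (fun z => a z * b (z + c *: y))).
Proof.
move=> cb bC; apply: (@suppV_integrable _ _ _ r (Ca * Cb)) => //.
- by apply: measurable_funM => //; exact: measurable_affine.
- by move=> z /ar ->; rewrite mul0r.
- by move=> z; rewrite normrM; apply: ler_pM.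
Qed.

(** Differentiation under the integral sign; the dominating function is a
   multiple of the indicator of a ball that contains the support of [a]. *)
Lemma correl_derive (b : 'rV[R]_n -> R) c y i (Cb Cb' : R) :
  Ck 1 setT b -> (forall y, `|b y| <= Cb) -> (forall y, `|partial i b y| <= Cb') ->
  is_derive y (e_ i) (correl a b c) (c * correl a (partial i b) c y).
Proof.
move=> b1 bC bC'.
have oT := @openT 'rV[R]_n.
have cb : continuous b by move=> z; exact: Ck_continuous b1 _.
have [_ /(_ i)[db /(Ck0_open _ oT) cdb']] := (CkS_open _ _ oT).1 b1.
have cdb : continuous (partial i b) by move=> z; exact: cdb'.
have Cb'0 : 0 <= Cb' by exact: le_trans (bC' 0).
have Ca0 : 0 <= Ca by exact: le_trans (aC 0).
apply: is_derive_line.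
pose F (s : R) (z : borelV n) : R := a z * b (z + c *: (s *: e_ i + y)).
have dF (s : R) (z : 'rV[R]_n) : is_derive s 1 (F^~ z) (a z * (c * partial i b (z + c *: (s *: e_ i + y)))).
  have Eq (t : R) : z + c *: (t *: e_ i + y) = (z + c *: y) + t *: (c *: e_ i).
    by rewrite scalerDr !scalerA (mulrC t) addrCA addrC.
  have d1 : is_derive s 1 (fun t : R => b ((z + c *: y) + t *: (c *: e_ i)))
      (c * partial i b (z + c *: (s *: e_ i + y))).
    rewrite Eq.
    have [e1 e2] := @is_derive_scaledir R _ b (z + c *: y + s *: (c *: e_ i)) (e_ i) c (db _ I).
    by have := @derive_direction R _ b (z + c *: y) (c *: e_ i) s e1; rewrite e2.
  have d2 := is_deriveM (is_derive_cst (a z) s 1) d1.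
  have -> : F^~ z = (cst (a z)) * (fun t : R => b ((z + c *: y) + t *: (c *: e_ i))).
    by apply/funext => t; rewrite /F Eq.
  by apply: (is_derive_eq d2); rewrite scaler0 addr0.
pose G (z : borelV n) : R := Ca * `|c| * Cb' * \1_(ball (0 : 'rV[R]_n) r) z.
have mB := @measurable_ballV R n 0 r.
have intF s : s \in `]-1, 1[%R -> (lebV R n).-integrable setT (EFin \o F s).
  by move=> _; exact: correl_integrable cb bC.
have derF s z : (`]-1, 1[%classic : set R) s -> setT z -> derivable (F^~ z) s 1.
  by move=> _ _; have [] := dF s z.
have G0 z : 0 <= G z by rewrite /G !mulr_ge0.
have intG : (lebV R n).-integrable setT (EFin \o G).
  apply: (@suppV_integrable _ _ _ r (Ca * `|c| * Cb')) => //.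
  - apply: measurable_funM => //; exact: measurable_indic.
  - move=> z rz; rewrite /G indicE memNset ?mulr0//.
    by rewrite -ball_normE/= sub0r normrN; apply/negP; rewrite -leNgt.
  - move=> z; rewrite /G ger0_norm ?G0// indicE ler_piMr ?mulr_ge0//.
    by case: (_ \in _).
have GF s z : (`]-1, 1[%classic : set R) s -> setT z -> `|partial1of2 F s z| <= G z.
  move=> _ _; rewrite partial1of2E (@derive_val _ _ _ _ _ _ _ (dF s z)).
  have [rz|zr] := leP r `|z : 'rV[R]_n|.
    by rewrite ar// mul0r normr0.
  rewrite /G indicE mem_set ?mulr1; last by rewrite -ball_normE/= sub0r normrN.
  rewrite !normrM -mulrA; apply: ler_pM => //; apply: ler_wpM2l => //.
have I0 : (`]-1, 1[%classic : set R) 0 by rewrite /= in_itv/= oppr_lt0 ltr01.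
have D := @derivable_under_integral R _ _ (lebV R n) F setT measurableT 0 (-1) 1 I0
  (fun s h => intF s h) derF G G0 intG GF.
have E := @differentiation_under_integral R _ _ (lebV R n) F setT measurableT 0 (-1) 1 I0
  (fun s h => intF s h) derF G G0 intG GF.
apply: DeriveDef; first exact: D.
rewrite -derive1E.
rewrite (_ : (fun h : R => correl a b c (h *: e_ i + y)) = (fun x' => \int[lebV R n]_(y in setT) F x' y))// E.
transitivity (\int[lebV R n]_z (c * (a z * partial i b (z + c *: y)))).
  apply: eq_Rintegral => z _; rewrite partial1of2E (@derive_val _ _ _ _ _ _ _ (dF 0 z)).
  by rewrite scale0r add0r mulrCA.
by rewrite RintegralZl//; exact: correl_integrable cdb bC'.
Qed.

Lemma correl_continuous (b : 'rV[R]_n -> R) c rb :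
  continuous b -> (forall y, rb <= `|y| -> b y = 0) -> continuous (correl a b c).
Proof.
move=> cb brb y.
have [Cb Cb0 bC] := suppV_bounded cb brb.
have Ca0 : 0 <= Ca by exact: le_trans (aC 0).
pose L := fine (lebV R n (ball (0 : 'rV[R]_n) r)).
have L0 : 0 <= L by rewrite fine_ge0.
apply/(@cvgrPdist_le _ _ _ (nbhs y) _) => eps eps0.
have e'0 : 0 < eps / (Ca * L + 1) by rewrite divr_gt0// ltr_wpDl// mulr_ge0.
have [d d0 Hd] := suppV_unif_continuous cb brb e'0.
have d'0 : 0 < d / (`|c| + 1) by rewrite divr_gt0// ltr_wpDl.
have nb : \forall y' \near y, `|y - y'| < d / (`|c| + 1).
  by apply/nbhs_ballP; exists (d / (`|c| + 1)) => //= y'; rewrite -ball_normE.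
apply: filterS nb => y' yy'.
rewrite /correl -RintegralB//; [|exact: correl_integrable cb bC|exact: correl_integrable cb bC].
apply: le_trans (@suppV_le_integral _ _ _ r (Ca * (eps / (Ca * L + 1))) r0 _ _ _) _.
- apply: measurable_funB; apply: measurable_funM => //; exact: measurable_affine.
- by move=> z /ar ->; rewrite !mul0r subrr.
- move=> z; rewrite -mulrBr normrM; apply: ler_pM => //.
  have -> : z + c *: y = c *: (y - y') + (z + c *: y').
    by rewrite scalerBr addrCA subrK.
  apply: Hd; rewrite normrZ.
  apply: (@le_lt_trans _ _ ((`|c| + 1) * `|y - y'|)); first by rewrite ler_wpM2r// lerDl.
  by rewrite mulrC -ltr_pdivlMr// ltr_wpDl.
- rewrite -/L mulrAC mulrCA; apply: ler_piMr; first exact: ltW.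
  by rewrite ler_pdivrMr ?mul1r ?lerDl// ltr_wpDl// mulr_ge0.
Qed.

Lemma partial_supp (b : 'rV[R]_n -> R) rb i : (forall y, rb <= `|y| -> b y = 0) ->
  forall y, rb + 1 <= `|y| -> partial i b y = 0.
Proof.
move=> brb y yr.
rewrite /partial (@near_eq_derive _ _ _ b (cst 0) y (e_ i)) ?derive_cst//.
have nb : \forall y' \near y, `|y - y'| < 1.
  by apply/nbhs_ballP; exists 1 => //= y'; rewrite -ball_normE.
apply: filterS nb => y' yy'; apply: brb.
rewrite -(lerD2r 1); apply: le_trans yr _.
have := ler_normD (y - y') y'; rewrite subrK => h.
by apply: le_trans h _; rewrite addrC lerD2l ltW.
Qed.

(** All derivatives fall on [b], so that [a] need only be measurable and bounded,
   with bounded support. *)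
Lemma correl_Ck k (b : 'rV[R]_n -> R) c rb : (forall k, Ck k setT b) ->
  (forall y, rb <= `|y| -> b y = 0) -> Ck k setT (correl a b c).
Proof.
have oT := @openT 'rV[R]_n.
elim: k b rb => [|k IH] b rb bk brb.
  apply/Ck0_open => // y _; apply: (@correl_continuous b c rb) => //.
  by move=> z; exact: Ck_continuous (bk 0%N) _.
have cb : continuous b by move=> z; exact: Ck_continuous (bk 0%N) _.
have bik i k' : Ck k' setT (partial i b).
  by have [_ /(_ i)[]] := (CkS_open _ _ oT).1 (bk k'.+1).
have cbi i : continuous (partial i b).
  by move=> z; exact: Ck_continuous (bik i 0%N) _.
have [Cb Cb0 bC] := suppV_bounded cb brb.
have bi i := partial_supp i brb.
apply/CkS_open => //; split=> [y _|i].
  exact: (@correl_continuous b c rb).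
have [Cb' Cb'0 bC'] := suppV_bounded (cbi i) (bi i).
have D y := correl_derive c y (bk 1%N) bC bC'.
split=> [y _|]; first by have [] := D y.
apply: (@Ck_ext _ _ _ _ (fun y => c * correl a (partial i b) c y)) => //.
  by move=> y _; rewrite /partial (@derive_val _ _ _ _ _ _ _ (D y)).
by apply: Ck_scale => //; exact: IH (bi i).
Qed.

End correl.

(** The integral of z |-> g (z + y) does not depend on y; differentiate it at
   y = 0. *)
Lemma integral_partial_eq0 n (g : 'rV[R]_n -> R) r i : Ck 1 setT g -> 0 < r ->
  (forall y, r <= `|y| -> g y = 0) -> \int[lebV R n]_y partial i g y = 0.
Proof.
move=> g1 r0 gr.
have oT := @openT 'rV[R]_n.
have cg : continuous g by move=> z; exact: Ck_continuous g1 _.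
have [_ /(_ i)[dg /(Ck0_open _ oT) cdg']] := (CkS_open _ _ oT).1 g1.
have cdg : continuous (partial i g) by move=> z; exact: cdg'.
have gi := partial_supp i gr.
have [C C0 gC] := suppV_bounded cg gr.
have [C' C'0 gC'] := suppV_bounded cdg gi.
pose r' := r + 1 + 1.
have r'0 : 0 < r' by rewrite !addr_gt0.
(* The indicator of a ball containing the support of every translate of g by a
   vector of norm less than 1 turns the integral into a correlation. *)
pose a : 'rV[R]_n -> R := \1_(ball (0 : 'rV[R]_n) r').
have ma : measurable_fun [set: borelV n] (a : borelV n -> R).
  by apply: measurable_indic; exact: measurable_ballV.
have a_out y : r' <= `|y| -> a y = 0.
  move=> ry; rewrite /a indicE memNset// -ball_normE/= sub0r normrN.
  by apply/negP; rewrite -leNgt.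
have a_in y : `|y| < r' -> a y = 1.
  by move=> ry; rewrite /a indicE mem_set// -ball_normE/= sub0r normrN.
have aC y : `|a y| <= 1 by rewrite /a indicE; case: (_ \in _); rewrite ?normr1 ?normr0.
have D := @correl_derive n a r' 1 r'0 ma a_out aC g 1 0 i C C' g1 gC gC'.
have E : correl a (partial i g) 1 0 = \int[lebV R n]_y partial i g y.
  apply: eq_Rintegral => z _; rewrite scaler0 addr0.
  have [rz|zr] := leP r' `|z : 'rV[R]_n|; last by rewrite a_in// mul1r.
  by rewrite gi ?mulr0//; apply: le_trans rz; rewrite /r' lerDl.
rewrite -E -[LHS]mul1r -(@derive_val _ _ _ _ _ _ _ D).
rewrite (@near_eq_derive _ _ _ _ (cst (\int[lebV R n]_y g y))) ?derive_cst//.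
have nb : \forall y \near (0 : 'rV[R]_n), `|y| < 1.
  by apply/nbhs_ballP; exists 1 => //= y; rewrite -ball_normE/= sub0r normrN.
apply: filterS nb => y y1.
rewrite /= -(Rintegral_lebV_shift y (continuous_measurableV cg)).
apply: eq_Rintegral => z _; rewrite scale1r.
have [rz|zr] := leP r' `|z : 'rV[R]_n|; last by rewrite a_in// mul1r.
rewrite gr ?mulr0//.
have := ler_normB (z + y : 'rV[R]_n) y; rewrite addrK => h.
rewrite -(lerD2r 1); apply: le_trans (_ : r' <= _); first by rewrite /r' lerDl.
by apply: le_trans rz _; apply: le_trans h _; rewrite lerD2l ltW.
Qed.

Lemma mollifier n (d : R) : 0 < d -> exists rho : 'rV[R]_n -> R,
  [/\ forall k, Ck k setT rho, forall y, 0 <= rho y,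
      forall y, d <= `|y| -> rho y = 0 & \int[lebV R n]_y rho y = 1].
Proof.
move=> d0; have oT := @openT 'rV[R]_n.
have Bk k := @bump_Ck R n d k.
have cB : continuous (@bump R n d) by move=> z; exact: Ck_continuous (Bk 0%N) _.
have B0 y : d <= `|y| -> bump d y = 0 := @bump_eq0 R n d y d0.
have [C C0 BC] := suppV_bounded cB B0.
have mBm := continuous_measurableV cB.
have Bint := suppV_integrable d0 mBm B0 BC.
pose b0 := @bump R n d 0 / 2.
have b00 : 0 < b0 by rewrite divr_gt0// bump_gt0// normr0.
have nb : \forall y \near (0 : 'rV[R]_n), `|@bump R n d 0 - bump d y| <= b0.
  exact: (cvgrPdist_le _ _).1 (cB 0) _ b00.
have /nbhs_ballP[e /= e0 He] := nb.
have mB := @measurable_ballV R n 0 e.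
have /andP[l0 loo] := lebV_ball n e0.
have Ipos : 0 < \int[lebV R n]_y bump d y.
  apply: (@lt_le_trans _ _ (\int[lebV R n]_(y in ball (0 : 'rV[R]_n) e) b0)).
    by rewrite Rintegral_cst// mulr_gt0// fine_gt0// l0.
  rewrite [leLHS]Rintegral_mkcond; apply: le_Rintegral => //.
    rewrite -restrict_EFin; apply: (integrable_mkcond _ mB).1.
    by apply: measurable_bounded_integrable => //; exact: bounded_cst.
  move=> y _; rewrite patchE; case: ifPn => [|_]; last exact: bump_ge0.
  move=> /set_mem ye; have := He y ye; rewrite /= ler_distl => /andP[_].
  by rewrite /b0; lra.
set I := \int[lebV R n]_y bump d y in Ipos.
exists (fun y => I^-1 * bump d y); split.
- by move=> k; apply: Ck_scale.
- by move=> y; rewrite mulr_ge0 ?bump_ge0// invr_ge0 ltW.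
- by move=> y /B0 ->; rewrite mulr0.
- by rewrite RintegralZl// mulVf// gt_eqF.
Qed.

(** Mollification: the values and the first derivatives of [psi] are averages of
   those of [g] over small balls, so uniform continuity bounds the differences; a
   change of variables moves all derivatives of [psi] to the smooth kernel. *)
Lemma C1_approx n (g : 'rV[R]_n -> R) r (eps d : R) : Ck 1 setT g -> 0 < r ->
  (forall y, r <= `|y| -> g y = 0) -> 0 < eps -> 0 < d ->
  exists psi : 'rV[R]_n -> R, [/\ forall k, Ck k setT psi,
    forall y, (forall z, `|z| < d -> g (z + y) = 0) -> psi y = 0,
    forall y, `|psi y - g y| <= eps &
    forall i y, `|partial i psi y - partial i g y| <= eps].
Proof.
move=> g1 r0 gr eps0 d0.
have oT := @openT 'rV[R]_n.
have cg : continuous g by move=> z; exact: Ck_continuous g1 _.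
have [_ dg] := (CkS_open _ _ oT).1 g1.
have cdg i : continuous (partial i g).
  by move=> z; have [_ /(Ck0_open _ oT)] := dg i; exact.
have gi i := partial_supp i gr.
have [C C0 gC] := suppV_bounded cg gr.
have [d1 d10 Hd1] := suppV_unif_continuous cg gr eps0.
have Hi i : \forall z \near (0 : 'rV[R]_n), forall y, `|partial i g (z + y) - partial i g y| <= eps.
  have [e e0 He] := suppV_unif_continuous (cdg i) (gi i) eps0.
  apply/nbhs_ballP; exists e => //= z; rewrite -ball_normE/= sub0r normrN => ze y.
  exact: He.
have Hall : \forall z \near (0 : 'rV[R]_n), forall i y, `|partial i g (z + y) - partial i g y| <= eps.
  by apply: (@filter_forall _ _ (fun i z => forall y, `|partial i g (z + y) - partial i g y| <= eps)
    (nbhs (0 : 'rV[R]_n)) _) => i; exact: Hi.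
have /nbhs_ballP[d2 /= d20 Hd2] := Hall.
pose e := Num.min d (Num.min d1 d2).
have e0 : 0 < e by rewrite !lt_min d0 d10.
have [rho [rhok rho0 rhoe rho1]] := mollifier n e0.
have crho : continuous rho by move=> z; exact: Ck_continuous (rhok 0%N) _.
have [Cr Cr0 rhoC] := suppV_bounded crho rhoe.
have mrho := continuous_measurableV crho.
(* The left-hand side is smooth because rho is; the right-hand side averages g. *)
have psiE : correl g rho (-1) = correl rho g 1.
  apply/funext => y; rewrite /correl.
  rewrite -(Rintegral_lebV_shift y); last first.
    by apply: measurable_funM; [exact: continuous_measurableV|exact: measurable_affine].
  by apply: eq_Rintegral => z _; rewrite scaleN1r addrK scale1r mulrC.
have avg (h : 'rV[R]_n -> R) Ch y : continuous h -> (forall y, `|h y| <= Ch) ->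
    (forall z, `|z| < e -> `|h (z + y) - h y| <= eps) ->
    `|correl rho h 1 y - h y| <= eps.
  move=> ch hC He.
  have rint := suppV_integrable e0 mrho rhoe rhoC.
  have rhint : (lebV R n).-integrable setT (EFin \o (fun z => rho z * h (z + 1 *: y))).
    exact: correl_integrable e0 mrho rhoe rhoC _ 1 y Ch ch hC.
  have hE : h y = \int[lebV R n]_z (rho z * h y) by rewrite RintegralZr// rho1 mul1r.
  have epsE : eps = \int[lebV R n]_z (rho z * eps) by rewrite RintegralZr// rho1 mul1r.
  have intc (c : R) : (lebV R n).-integrable setT (EFin \o (fun z => rho z * c)).
    rewrite (_ : _ \o _ = (fun z => (EFin \o rho) z * c%:E)%E)//.
    exact: integrableZr.
  have intd : (lebV R n).-integrable setT
      (EFin \o (fun z => rho z * h (z + 1 *: y) - rho z * h y)).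
    rewrite (_ : _ \o _ = (EFin \o (fun z => rho z * h (z + 1 *: y))%R)
      \- (EFin \o (fun z => rho z * h y)%R))%E//.
    exact: integrableB.
  rewrite {1}hE /correl -RintegralB//.
  apply: le_trans (le_normr_Rintegral _ intd) _ => //.
  rewrite [leRHS]epsE; apply: le_Rintegral => //; first exact: (integrable_norm intd).
  move=> z _; rewrite -mulrBr normrM ger0_norm//.
  have [ez|ze] := leP e `|z : 'rV[R]_n|; first by rewrite rhoe// !mul0r.
  by rewrite ler_wpM2l// scale1r; exact: He.
exists (correl rho g 1); split.
- move=> k; rewrite -psiE.
  exact: (@correl_Ck n g r C r0 (continuous_measurableV cg) gr gC k rho (-1) e rhok rhoe).
- move=> y gy0; rewrite /correl.
  rewrite (_ : (fun z => _) = cst 0) ?Rintegral_cst ?mul0r//.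
  apply/funext => z /=.
  have [ez|ze] := leP e `|z|; first by rewrite rhoe// mul0r.
  by rewrite scale1r gy0 ?mulr0//; move: ze; rewrite lt_min => /andP[].
- move=> y; apply: (avg g C) => // z; rewrite !lt_min => /and3P[_ z1 _].
  exact: Hd1.
- move=> i y.
  have [C' C'0 gC'] := suppV_bounded (cdg i) (gi i).
  have D := @correl_derive n rho e Cr e0 mrho rhoe rhoC g 1 y i C C' g1 gC gC'.
  rewrite /partial (@derive_val _ _ _ _ _ _ _ D) mul1r.
  apply: (avg (partial i g) C') => // z; rewrite !lt_min => /and3P[_ _ z2].
  by apply: Hd2; rewrite -ball_normE/= sub0r normrN.
Qed.

End Convolution.

(** * Functions and vector fields in charts *)

Section Charts.
Variables (R : realType) (n : nat) (M : smooth_manifold R n).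
Implicit Types (c : chart R n M) (U W K : set M) (x : M) (u : M -> R).

Lemma cfun_for_continuous c x : cdom c x -> {for x, continuous (cfun c)}.
Proof.
move=> cx; have := @cfun_continuous _ _ _ c.
by rewrite continuous_open_subspace; [move=> h; apply: h; exact: mem_set|exact: cdom_open].
Qed.

Lemma cinv_for_continuous c y : (cfun c @` cdom c) y -> {for y, continuous (cinv c)}.
Proof.
move=> cy; have := @cinv_continuous _ _ _ c.
by rewrite continuous_open_subspace; [move=> h; apply: h; exact: mem_set|exact: cimg_open].
Qed.

Lemma cinvK c y : (cfun c @` cdom c) y -> cfun c (cinv c y) = y.
Proof. by move=> [x cx <-]; rewrite cfunK. Qed.

Lemma cinv_cdom c y : (cfun c @` cdom c) y -> cdom c (cinv c y).
Proof. by move=> [x cx <-]; rewrite cfunK. Qed.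

Lemma cimgE c U : U `<=` cdom c ->
  cfun c @` U = (cfun c @` cdom c) `&` (cinv c @^-1` U).
Proof.
move=> Uc; apply/seteqP; split=> [y [x Ux <-]|y [yc Uy]].
  by split; [exists x => //; exact: Uc|rewrite /= cfunK//; exact: Uc].
by exists (cinv c y) => //; exact: cinvK.
Qed.

Lemma cimg_open_sub c U : open U -> U `<=` cdom c -> open (cfun c @` U).
Proof.
move=> oU Uc; rewrite cimgE//.
rewrite openE => y [yc Uy]; apply: filterI.
  by apply: open_nbhs_nbhs; split => //; exact: cimg_open.
by apply: (cinv_for_continuous yc); exact: open_nbhs_nbhs.
Qed.

Lemma cimg_near c x (P : set M) : cdom c x -> (\forall z \near x, P z) ->
  \forall y \near cfun c x, P (cinv c y).
Proof.
move=> cx Px; have yc : (cfun c @` cdom c) (cfun c x) by exists x.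
by apply: (cinv_for_continuous yc); rewrite /= cfunK.
Qed.

Lemma transition_smooth c c' k i : atlas (s := M) c -> atlas (s := M) c' ->
  Ck k (cfun c @` (cdom c `&` cdom c')) (fun y => transition c c' y 0 i).
Proof. by move=> ac ac'; exact: atlas_smooth. Qed.

Lemma openI_cdom c U : open U -> open (U `&` cdom c).
Proof. by move=> oU; apply: openI => //; exact: cdom_open. Qed.

Lemma cimgI_open c U : open U -> open (cfun c @` (U `&` cdom c)).
Proof. by move=> oU; apply: cimg_open_sub; [exact: openI_cdom|exact: subIsetr]. Qed.
Arguments cimgI_open c [U].

(** Every other chart is reached through a smooth transition map. *)
Lemma Ck_on_local k U u : open U ->
  (forall x, U x -> exists c W, [/\ atlas c, open W, W x, W `<=` cdom c &
     Ck k (cfun c @` W) (u \o cinv c)]) -> Ck_on k U u.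
Proof.
move=> oU H c ac; apply: Ck_local; first exact: cimgI_open.
move=> _ [x [Ux cx] <-]; have [c' [W [ac' oW Wx Wc' CW]]] := H x Ux.
have oV : open (cfun c @` (W `&` cdom c)) by exact: cimgI_open.
exists (cfun c @` (W `&` cdom c)); split => //; first by exists x.
apply: (@Ck_ext _ _ _ _ ((u \o cinv c') \o transition c c')) => //.
  move=> _ [z [Wz cz] <-]; rewrite /transition /= !cfunK//; exact: Wc'.
apply: (@Ck_comp _ _ _ _ _ (cfun c' @` W)) => //; first exact: cimg_open_sub.
  by move=> _ [z [Wz cz] <-]; exists z => //; rewrite /transition/= cfunK.
move=> j; apply: Ck_subset (transition_smooth k j ac ac').
by move=> _ [z [Wz cz] <-]; exists z => //; split => //; exact: Wc'.
Qed.

Lemma Ck_on_chart k U u c : atlas c -> Ck_on k U u ->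
  Ck k (cfun c @` (U `&` cdom c)) (u \o cinv c).
Proof. by move=> ac; exact. Qed.

Lemma Ck_on_sub k U W u : W `<=` U -> Ck_on k U u -> Ck_on k W u.
Proof.
move=> WU Cu c ac; apply: Ck_subset (Cu c ac).
by move=> _ [z [Wz cz] <-]; exists z => //; split => //; exact: WU.
Qed.

Lemma Ck_on_ext k U u u' : open U -> (forall x, U x -> u x = u' x) ->
  Ck_on k U u -> Ck_on k U u'.
Proof.
move=> oU uu' Cu c ac; apply: Ck_ext (Cu c ac); first exact: cimgI_open.
by move=> _ [z [Uz cz] <-] /=; rewrite cfunK// uu'.
Qed.

Lemma Ck_on_near k U u : open U ->
  (forall x, U x -> exists u' W, [/\ open W, W x, (forall z, W z -> u' z = u z) &
     Ck_on k W u']) -> Ck_on k U u.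
Proof.
move=> oU H; apply: Ck_on_local => // x Ux.
have [u' [W [oW Wx u'u Cu']]] := H x Ux.
have [c ac cx] := atlas_cover x.
exists c, (W `&` cdom c); split => //; [exact: openI_cdom|].
by apply: (Ck_on_ext oW u'u Cu').
Qed.

Lemma Ck_on_cst k U a : Ck_on k U (cst a).
Proof. by move=> c ac; exact: Ck_cst. Qed.

Lemma Ck_on_mul k U u u' : open U -> Ck_on k U u -> Ck_on k U u' ->
  Ck_on k U (fun x => u x * u' x).
Proof. by move=> oU Cu Cu' c ac; exact: (Ck_mul (cimgI_open c oU) (Cu c ac) (Cu' c ac)). Qed.

Lemma Ck_on_add k U u u' : open U -> Ck_on k U u -> Ck_on k U u' ->
  Ck_on k U (fun x => u x + u' x).
Proof. by move=> oU Cu Cu' c ac; exact: (Ck_add (cimgI_open c oU) (Cu c ac) (Cu' c ac)). Qed.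

Lemma Ck_on_sum k U (I : Type) (s : seq I) (u : I -> M -> R) : open U ->
  (forall i, Ck_on k U (u i)) -> Ck_on k U (fun x => \sum_(i <- s) u i x).
Proof.
move=> oU Cu c ac.
exact: (Ck_sum s (cimgI_open c oU) (fun i => Cu i c ac)).
Qed.

Lemma Ck_on_inv k U u : open U -> (forall x, U x -> u x != 0) -> Ck_on k U u ->
  Ck_on k U (fun x => (u x)^-1).
Proof.
move=> oU u0 Cu c ac; apply: (Ck_inv (cimgI_open c oU) _ (Cu c ac)).
by move=> _ [z [Uz cz] <-] /=; rewrite cfunK// u0.
Qed.

Lemma Ck_on_continuous k U u x : open U -> Ck_on k U u -> U x -> {for x, continuous u}.
Proof.
move=> oU Cu Ux; have [c ac cx] := atlas_cover x.
have cu : {for cfun c x, continuous (u \o cinv c)}.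
  apply: (Ck_continuous (cimgI_open c oU) (Cu c ac)).
  by exists x.
apply: (@near_eq_continuous _ _ ((u \o cinv c) \o cfun c)).
  have : \forall z \near x, cdom c z by apply: open_nbhs_nbhs; split => //; exact: cdom_open.
  by apply: filterS => z cz /=; rewrite cfunK.
by apply: continuous_comp => //; exact: cfun_for_continuous.
Qed.

(** [vf_apply] is computed in one chosen chart at each point. The transformation
   rule of the components of a vector field, combined with the chain rule for the
   transition map, gives the same value in every chart. *)
Lemma vf_apply_is_derive (X : vector_field M) U u x c : atlas c -> open U ->
  Ck_on 1 U u -> U x -> cdom c x ->
  is_derive (cfun c x) (vfc X c x) (u \o cinv c) (vf_apply X u x).
Proof.
move=> ac oU Cu Ux cx.
have D c' : atlas c' -> cdom c' x -> is_derive (cfun c' x) (vfc X c' x) (u \o cinv c')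
    (\sum_(i < n) vfc X c' x 0 i * chart_partial c' i u x).
  move=> ac' cx'; apply: (C1_derive _ (cimgI_open c' oU) (Cu c' ac')).
  by exists x.
pose c0 := chart_at x.
have ac0 : atlas c0 by rewrite /c0 /chart_at; case: cid2.
have cx0 : cdom c0 x by rewrite /c0 /chart_at; case: cid2.
suff -> : vf_apply X u x = \sum_(i < n) vfc X c x 0 i * chart_partial c i u x by exact: D.
rewrite -[LHS](@derive_val _ _ _ _ _ _ _ (D _ ac0 cx0)).
pose T := transition c0 c; pose W0 := cfun c0 @` (U `&` cdom c `&` cdom c0).
have oW0 : open W0 by apply: cimgI_open; exact: openI_cdom.
have W0x : W0 (cfun c0 x) by exists x.
have CT j : Ck 1 W0 (fun y => T y 0 j).
  apply: Ck_subset (transition_smooth 1 j ac0 ac).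
  by move=> _ [z [[Uz cz] cz0] <-]; exists z.
have Tx : T (cfun c0 x) = cfun c x by rewrite /T /transition/= cfunK.
have WT : (cfun c @` (U `&` cdom c)) (T (cfun c0 x)) by rewrite Tx; exists x.
have dT : differentiable T (cfun c0 x).
  by apply: differentiable_rV => j; have [] := C1_differentiable oW0 (CT j) W0x.
have E := C1_comp_derive (vfc X c0 x) oW0 (cimgI_open c oU) CT (Cu c ac) W0x WT.
have nE : \forall y \near cfun c0 x, ((u \o cinv c) \o T) y = (u \o cinv c0) y.
  have : \forall y \near cfun c0 x, W0 y by exact: open_nbhs_nbhs.
  apply: filterS => _ [z [[Uz cz] cz0] <-] /=.
  by rewrite /T /transition/= !cfunK.
rewrite -(near_eq_derive _ nE) (@derive_val _ _ _ _ _ _ _ E).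
apply: eq_bigr => j _; rewrite Tx; congr (_ * _).
rewrite (vfc_transform X ac0 ac cx0 cx) -/T -deriveEjacobian//.
by rewrite derive_rV_coord//; exact: diff_derivable.
Qed.

Lemma vf_applyE (X : vector_field M) U u x c : atlas c -> open U ->
  Ck_on 1 U u -> U x -> cdom c x ->
  vf_apply X u x = \sum_(i < n) vfc X c x 0 i * chart_partial c i u x.
Proof.
move=> ac oU Cu Ux cx.
rewrite -(@derive_val _ _ _ _ _ _ _ (vf_apply_is_derive X ac oU Cu Ux cx)).
have oV := cimgI_open c oU.
have Vx : (cfun c @` (U `&` cdom c)) (cfun c x) by exists x.
by rewrite (@derive_val _ _ _ _ _ _ _ (C1_derive (vfc X c x) oV (Cu c ac) Vx)).
Qed.

Lemma vf_apply_near (X : vector_field M) u u' x : (\forall z \near x, u z = u' z) ->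
  vf_apply X u x = vf_apply X u' x.
Proof.
move=> uu'; apply: eq_bigr => i _; congr (_ * _).
apply: near_eq_derive; apply: (@cimg_near _ x (fun z => u z = u' z)) => //.
by rewrite /chart_at; case: cid2.
Qed.

Lemma vf_apply_cst0 (X : vector_field M) u x : (\forall z \near x, u z = 0) ->
  vf_apply X u x = 0.
Proof.
move=> u0; rewrite (@vf_apply_near _ _ (cst 0))//.
by apply: big1 => i _; rewrite /chart_partial /partial derive_cst mulr0.
Qed.

Lemma vf_apply_add (X : vector_field M) U u u' x : open U ->
  Ck_on 1 U u -> Ck_on 1 U u' -> U x ->
  vf_apply X (fun z => u z + u' z) x = vf_apply X u x + vf_apply X u' x.
Proof.
move=> oU Cu Cu' Ux; have [c ac cx] := atlas_cover x.
have d1 := vf_apply_is_derive X ac oU Cu Ux cx.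
have d2 := vf_apply_is_derive X ac oU Cu' Ux cx.
have d3 := vf_apply_is_derive X ac oU (Ck_on_add oU Cu Cu') Ux cx.
rewrite -(@derive_val _ _ _ _ _ _ _ d3).
by rewrite (@derive_val _ _ _ _ _ _ _ (is_deriveD d1 d2)).
Qed.

Lemma vf_apply_continuous (X : vector_field M) U u x : open U -> Ck_on 1 U u -> U x ->
  {for x, continuous (vf_apply X u)}.
Proof.
move=> oU Cu Ux; have [c ac cx] := atlas_cover x.
apply: (@near_eq_continuous _ _ (fun z => \sum_(i < n) vfc X c z 0 i * chart_partial c i u z)).
  have : \forall z \near x, (U `&` cdom c) z.
    by apply: open_nbhs_nbhs; split => //; exact: openI_cdom.
  by apply: filterS => z [Uz cz]; rewrite (vf_applyE X ac oU Cu Uz cz).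
apply: (@cvg_sumr _ _ _ (nbhs x) _) => i; apply: cvgM.
  exact: (Ck_on_continuous (@cdom_open _ _ _ c) (@vfc_smooth _ _ _ X c ac i 0%N) cx).
have oV := cimgI_open c oU.
have Vx : (cfun c @` (U `&` cdom c)) (cfun c x) by exists x.
have [_ /(_ i)[_ /(Ck0_open _ oV) h]] := (CkS_open _ _ oV).1 (Cu c ac).
have cp : {for x, continuous (partial i (u \o cinv c) \o cfun c)}.
  by apply: continuous_comp; [exact: cfun_for_continuous|exact: h].
exact: cp.
Qed.

Definition push c (h : 'rV[R]_n -> R) x : R :=
  if x \in cdom c then h (cfun c x) else 0.

Lemma push_in c h x : cdom c x -> push c h x = h (cfun c x).
Proof. by move=> cx; rewrite /push mem_set. Qed.

Lemma push_neq0 c h x : push c h x != 0 -> cdom c x /\ h (cfun c x) != 0.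
Proof.
rewrite /push; case: ifPn => [/set_mem cx hx|_]; first by split.
by rewrite eqxx.
Qed.

Lemma cinv_compact c S : compact S -> S `<=` cfun c @` cdom c -> compact (cinv c @` S).
Proof.
move=> cS Sc; apply: continuous_compact => //.
exact: continuous_subspaceW (@cinv_continuous _ _ _ c).
Qed.

Lemma compact_closedM K : compact K -> closed K.
Proof. by apply: compact_closed; exact: manifold_hausdorff. Qed.

Lemma supp_closure u K : compact K -> (forall x, u x != 0 -> K x) ->
  closure [set x | u x != 0] `<=` K.
Proof.
move=> cK uK x ux.
have : closure K x by move: x ux; apply: closureS => z /uK.
by rewrite -((closure_id K).1 (compact_closedM cK)).
Qed.

Lemma compact_support_of U K u : compact K -> K `<=` U ->
  (forall x, u x != 0 -> K x) -> compact_support_in U u.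
Proof.
move=> cK KU uK; have sK := supp_closure cK uK; split.
  by apply: subclosed_compact sK => //; exact: closed_closure.
by move=> x /sK; exact: KU.
Qed.

(** Compact sets are closed, so a point outside [K] has a neighbourhood on which
   the function vanishes. *)
Lemma Ck_zero_extend k U K u : open U -> compact K -> K `<=` U ->
  (forall x, u x != 0 -> K x) -> Ck_on k U u -> Ck_on k setT u.
Proof.
move=> oU cK KU uK Cu; apply: Ck_on_near; first exact: openT.
move=> x _; have [Ux|nUx] := pselect (U x).
  by exists u, U; split.
exists (cst 0), (~` K); split => //.
- by apply: closed_openC; exact: compact_closedM.
- by move/KU.
- by move=> z; apply: contra_notP => /eqP; rewrite eq_sym => /uK.
- exact: Ck_on_cst.
Qed.

Lemma push_Ck c h S k : atlas c -> compact S -> S `<=` cfun c @` cdom c ->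
  (forall y, h y != 0 -> S y) -> Ck k setT h -> Ck_on k setT (push c h).
Proof.
move=> ac cS Sc hS Ch.
apply: (@Ck_zero_extend k (cdom c) (cinv c @` S)).
- exact: cdom_open.
- exact: cinv_compact.
- by move=> _ [y /Sc yc <-]; exact: cinv_cdom.
- move=> x /push_neq0[cx /hS Sx]; exists (cfun c x) => //; exact: cfunK.
apply: Ck_on_local; first exact: cdom_open.
move=> x cx; exists c, (cdom c); split => //; first exact: cdom_open.
apply: (@Ck_ext _ _ _ _ h); first exact: cimg_open.
  by move=> _ [z cz <-] /=; rewrite cfunK// push_in.
by apply: Ck_subset Ch.
Qed.

Lemma Ck_zero_extendV k (V S : set 'rV[R]_n) g : open V -> compact S -> S `<=` V ->
  (forall y, V y -> g y != 0 -> S y) -> Ck k V g ->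
  Ck k setT (fun y => if y \in V then g y else 0).
Proof.
move=> oV cS SV gS Cg; apply: Ck_local; first exact: openT.
move=> y _; have [Vy|nVy] := pselect (V y).
  exists V; split => //; apply: Ck_ext Cg => // z Vz; by rewrite mem_set.
have oS : open (~` S) by apply: closed_openC; apply: compact_closed => //; exact: norm_hausdorff.
exists (~` S); split => //; first by move/SV.
apply: (@Ck_ext _ _ _ _ (cst 0)) => //; last exact: Ck_cst.
move=> z nSz; case: ifPn => // /set_mem Vz.
by apply/esym; apply: contra_notP nSz => /eqP; exact: gS.
Qed.

End Charts.
Arguments cimgI_open {R n M} c [U].

(** * Smooth approximation on the manifold *)

Section SmoothApproximation.
Variables (R : realType) (n : nat) (M : smooth_manifold R n).
Variables (N : nat) (X : 'I_N -> vector_field M) (Omega : set M).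
Hypothesis oOmega : open Omega.
Implicit Types (c : chart R n M) (K : set M) (x : M) (u : M -> R).

Lemma cinfty_compact_Ck k (U : set M) u : Cinfty_compact U u -> Ck_on k setT u.
Proof. by case. Qed.

(** The approximation is uniform, and the compact set [K] does not depend on [eps]:
   this is what yields convergence in a Luxemburg norm. *)
Definition C1_approximable u := exists K, [/\ compact K, K `<=` Omega &
  forall eps : R, 0 < eps -> exists psi : M -> R, [/\ Cinfty_compact Omega psi,
    forall x, ~ K x -> u x = psi x,
    forall x, `|u x - psi x| <= eps &
    forall x k, `|vf_apply (X k) u x - vf_apply (X k) psi x| <= eps]].

Lemma C1_approximable_sum (I : Type) (s : seq I) (u : I -> M -> R) :
  (forall i, Ck_on 1 setT (u i)) ->
  (forall i, C1_approximable (u i)) ->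
  C1_approximable (fun x => \sum_(i <- s) u i x).
Proof.
have oT := @openT M.
move=> Cu Au; elim: s => [|i s [K [cK KO IH]]].
  exists set0; split => //; first exact: compact0.
  move=> eps eps0; exists (cst 0); split.
  - split; first by move=> k; exact: Ck_on_cst.
    apply: (@compact_support_of _ _ _ _ set0) => //; first exact: compact0.
    by move=> x; rewrite eqxx.
  - by move=> x _; rewrite big_nil.
  - by move=> x; rewrite big_nil subrr normr0 ltW.
  - move=> x k; rewrite !vf_apply_cst0 ?subrr ?normr0 ?ltW//; apply: nearW => z //.
    by rewrite big_nil.
have [K' [cK' K'O Ai]] := Au i.
exists (K' `|` K); split; [exact: compactU|by move=> x [/K'O|/KO]|].
move=> eps eps0; have e20 : 0 < eps / 2 by rewrite divr_gt0.
have [psi [Cpsi psi1 psi2 psi3]] := Ai _ e20.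
have [psi' [Cpsi' psi'1 psi'2 psi'3]] := IH _ e20.
exists (fun x => psi x + psi' x); split.
- split; first by move=> k; apply: Ck_on_add => //; [exact: (Cpsi.1 k)|exact: (Cpsi'.1 k)].
  have [_ [c1 s1]] := Cpsi; have [_ [c2 s2]] := Cpsi'.
  apply: (@compact_support_of _ _ _ _ (closure [set x | psi x != 0] `|` closure [set x | psi' x != 0])).
  + exact: compactU.
  + by move=> x [/s1|/s2].
  + move=> x; have [->|p0] := eqVneq (psi x) 0.
      by rewrite add0r => p'0; right; exact: (@subset_closure _ [set x | psi' x != 0]).
    by move=> _; left; exact: (@subset_closure _ [set x | psi x != 0]).
- by move=> x /not_orP[h1 h2]; rewrite big_cons psi1// psi'1.
- move=> x; rewrite big_cons opprD addrACA [eps]splitr.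
  by apply: le_trans (ler_normD _ _) _; rewrite lerD.
- move=> x k.
  rewrite (vf_apply_add _ oT (cinfty_compact_Ck 1 Cpsi) (cinfty_compact_Ck 1 Cpsi'))//.
  rewrite (@vf_apply_near _ _ _ _ _ (fun x => u i x + \sum_(j <- s) u j x)); last first.
    by apply: nearW => z; rewrite big_cons.
  rewrite (vf_apply_add _ oT (Cu i) (Ck_on_sum s oT Cu))// opprD addrACA [eps]splitr.
  by apply: le_trans (ler_normD _ _) _; rewrite lerD.
Qed.

(** A compact set stays at positive distance from the complement of an open one. *)
Lemma compact_thicken (S V : set 'rV[R]_n) : compact S -> open V -> S `<=` V ->
  exists2 d : R, 0 < d & [set y | exists2 s, S s & `|y - s| <= d] `<=` V.
Proof.
move=> cS oV SV.
have := (@compact_near_coveringP _ _).1 cS.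
move=> /(_ 'rV[R]_n (nbhs (0 : 'rV[R]_n)) (fun z y => V (z + y)) _) H.
have /nbhs_ballP[d /= d0 Hd] : \forall z \near (0 : 'rV[R]_n), S `<=` (fun y => V (z + y)).
  apply: H => y Sy.
  have /nbhs_ballP[d /= d0 Hd] : nbhs y V by apply: open_nbhs_nbhs; split => //; exact: SV.
  have d20 : 0 < d / 2 by rewrite divr_gt0.
  exists (ball y (d / 2), ball 0 (d / 2)) => /=; first by split; exact: nbhsx_ballx.
  move=> [y' z] /= [yy' zd]; apply: Hd; rewrite [d]splitr; apply: (@ball_triangle _ _ y') => //.
  by move: zd; rewrite -!ball_normE/= sub0r normrN opprD addrCA subrr addr0 normrN.
exists (d / 2); first by rewrite divr_gt0.
move=> y [s Ss ys]; rewrite -(subrK s y); apply: Hd => //=.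
rewrite -ball_normE/= sub0r normrN; apply: le_lt_trans ys _.
by rewrite ltr_pdivrMr// ltr_pMr// ltr1n.
Qed.

Lemma thicken_compact (S : set 'rV[R]_n) (d : R) : compact S ->
  compact [set y | exists2 s, S s & `|y - s| <= d].
Proof.
move=> cS; have cB := @closed_ballV_compact R n d.
have -> : [set y | exists2 s, S s & `|y - s| <= d] =
    (fun sz : 'rV[R]_n * 'rV[R]_n => sz.1 + sz.2) @` (S `*` [set z | `|z| <= d]).
  apply/seteqP; split=> [y [s Ss ys]|_ [[s z] /= [Ss zd] <-]].
    by exists (s, y - s) => //=; rewrite addrC subrK.
  by exists s => //; rewrite addrC addKr.
apply: continuous_compact; last exact: compact_setX.
by apply: continuous_subspaceT => y; exact: add_continuous.
Qed.

(** Mollify in the chart. The components of the vector fields are bounded on the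
   compact set that contains all supports, so closeness of the partial
   derivatives implies closeness of the derivatives along the vector fields. *)
Lemma push_C1_approximable c (g : 'rV[R]_n -> R) S : atlas c -> Ck 1 setT g ->
  compact S -> S `<=` cfun c @` (Omega `&` cdom c) ->
  (forall y, g y != 0 -> S y) -> C1_approximable (push c g).
Proof.
move=> ac Cg cS SV gS; have oT := @openT M.
pose V := cfun c @` (Omega `&` cdom c).
have oV : open V by exact: cimgI_open.
have Vc : V `<=` cfun c @` cdom c by move=> _ [x [_ cx] <-]; exists x.
have [d d0 S'V] := compact_thicken cS oV SV.
set S' := [set y | _] in S'V.
have cS' : compact S' by exact: thicken_compact.
have SS' : S `<=` S' by move=> y Sy; exists y => //; rewrite subrr normr0 ltW.
have S'c : S' `<=` cfun c @` cdom c by move=> y /S'V /Vc.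
pose K := cinv c @` S'.
have cK : compact K by exact: cinv_compact.
have KO : K `<=` Omega `&` cdom c.
  by move=> _ [y /S'V [x Ox <-] <-]; case: Ox => Ox cx; rewrite cfunK.
have [r r0 gr] : exists2 r : R, 0 < r & forall y, r <= `|y| -> g y = 0.
  have /compact_bounded[m [_ Hm]] := cS.
  exists (`|m| + 2); first by rewrite ltr_wpDl.
  move=> y; apply: contraTeq => /gS Sy; rewrite -ltNge.
  apply: le_lt_trans (Hm (`|m| + 1) _ y Sy) _; last by rewrite ltrD2l ltr1n.
  by rewrite ltr_pwDr// ler_norm.
have [B B0 HB] : exists2 B : R, 0 < B & forall k i x, K x -> `|vfc (X k) c x 0 i| <= B.
  have H (ki : 'I_N * 'I_n) : \forall B \near +oo, forall x, K x -> `|vfc (X ki.1) c x 0 ki.2| <= B.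
    have /compact_bounded[m [mr Hm]] : compact ((fun x => vfc (X ki.1) c x 0 ki.2) @` K).
      apply: continuous_compact => //.
      apply: (@continuous_subspaceW _ _ _ (cdom c)); first by move=> x /KO[].
      rewrite continuous_open_subspace; last exact: cdom_open.
      move=> x /set_mem cx.
      by apply: (Ck_on_continuous (@cdom_open _ _ _ c) (@vfc_smooth _ _ _ (X ki.1) c ac ki.2 0%N) cx).
    exists m; split => // B mB x Kx; apply: Hm => //.
    by exists x.
  have Hall : \forall B \near +oo, forall ki : 'I_N * 'I_n,
      forall x, K x -> `|vfc (X ki.1) c x 0 ki.2| <= B.
    by apply: filter_forall => ki; exact: H.
  have [m [mr Hm]] := Hall.
  exists (`|m| + 1); first by rewrite ltr_wpDl.
  move=> k i x Kx; apply: (Hm (`|m| + 1) _ (k, i)) => //.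
  by rewrite ltr_pwDr// ler_norm.
exists K; split => //; first by move=> x /KO[].
move=> eps eps0.
pose e := eps / (n%:R * B + 1).
have nB0 : 0 <= n%:R * B by rewrite mulr_ge0// ltW.
have nB1 : 0 < n%:R * B + 1 by rewrite ltr_wpDl.
have e0 : 0 < e by rewrite divr_gt0.
have ee : e <= eps by rewrite ler_pdivrMr// ler_peMr ?lerDr// ltW.
have [psi [psik psi0 psi1 psi2]] := C1_approx Cg r0 gr e0 d0.
have psiS y : psi y != 0 -> S' y.
  move=> py; apply: contrapT => nS'; move/negP: py; apply; apply/eqP; apply: psi0.
  move=> z zd; apply/eqP/negPn/negP => /gS Sz; apply: nS'; exists (z + y) => //.
  by rewrite opprD addrCA subrr addr0 normrN ltW.
have gS' y : g y != 0 -> S' y by move=> /gS /SS'.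
have pushK h x : (forall y, h y != 0 -> S' y) -> push c h x != 0 -> K x.
  by move=> hS /push_neq0[cx /hS Sx]; exists (cfun c x) => //; exact: cfunK.
have eqK x : ~ K x -> push c g x = push c psi x.
  move=> nK; transitivity (0 : R).
    by apply/eqP/negPn/negP => /(pushK _ _ gS').
  by apply/esym/eqP/negPn/negP => /(pushK _ _ psiS).
have Cpg : Ck_on 1 setT (push c g) by exact: (push_Ck ac cS' S'c gS' Cg).
have Cpp k : Ck_on k setT (push c psi) by exact: (push_Ck ac cS' S'c psiS (psik k)).
exists (push c psi); split => //.
- split => //; apply: (@compact_support_of _ _ _ _ K) => //.
    by move=> x /KO[].
  by move=> x; exact: pushK.
- move=> x; have [Kx|nKx] := pselect (K x); last by rewrite eqK// subrr normr0 ltW.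
  have [_ cx] := KO x Kx.
  by rewrite !push_in// distrC; apply: le_trans (psi1 _) ee.
- move=> x k; have [Kx|nKx] := pselect (K x); last first.
    rewrite (@vf_apply_near _ _ _ _ _ (push c psi)) ?subrr ?normr0 ?ltW//.
    have : \forall z \near x, (~` K) z.
      apply: open_nbhs_nbhs; split => //; apply: closed_openC; exact: compact_closedM.
    by apply: filterS.
  have [_ cx] := KO x Kx.
  have chart h i : chart_partial c i (push c h) x = partial i h (cfun c x).
    apply: near_eq_derive.
    have : \forall y \near cfun c x, (cfun c @` cdom c) y.
      by apply: open_nbhs_nbhs; split; [exact: cimg_open|exists x].
    by apply: filterS => _ [z cz <-] /=; rewrite cfunK// push_in.
  rewrite (vf_applyE _ ac oT Cpg)// (vf_applyE _ ac oT (Cpp 1%N))// -sumrB.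
  apply: le_trans (ler_norm_sum _ _ _) _.
  apply: (@le_trans _ _ (\sum_(i < n) B * e)).
    apply: ler_sum => i _; rewrite -mulrBr normrM; apply: ler_pM => //; first exact: HB.
    by rewrite !chart distrC; exact: psi2.
  rewrite sumr_const card_ord -[leLHS]mulr_natl mulrA /e mulrCA.
  apply: ler_piMr; first exact: ltW.
  by rewrite ler_pdivrMr// mul1r lerDl.
Qed.

(** A partition of unity: finitely many smooth bumps b_i in charts have a positive
   sum on the support of [u], and [u] is the sum of the functions
   (u / sum_j b_j) b_i, each of which lives in one chart. *)
Lemma C1_compact_approximable u : Ck_compact 1 Omega u -> C1_approximable u.
Proof.
move=> [Cu [cK KO]]; set K := closure _ in cK KO.
have oT := @openT M.
have uK x : u x != 0 -> K x by move=> ux; exact: (@subset_closure _ [set x | u x != 0]).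
have Kcl : closed K by exact: closed_closure.
pose c x := chart_at x.
have ac x : atlas (c x) by rewrite /c /chart_at; case: cid2.
have cx x : cdom (c x) x by rewrite /c /chart_at; case: cid2.
pose V x := cfun (c x) @` (Omega `&` cdom (c x)).
have oV x : open (V x) by exact: cimgI_open.
have Hr x : exists r : R, 0 < r /\ (K x -> [set y | `|y - cfun (c x) x| <= r] `<=` V x).
  have [Kx|nKx] := pselect (K x); last by exists 1.
  have [|d d0 Hd] := @compact_thicken [set cfun (c x) x] (V x) (@compact_set1 _ _) (oV x).
    by move=> _ ->; exists x => //; split; [exact: KO|exact: cx].
  exists d; split => // _ y yd; apply: Hd; by exists (cfun (c x) x).
have [r Hr'] := choice Hr.
pose bV x (y : 'rV[R]_n) : R := bump (r x) (y + (-1) *: cfun (c x) x).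
have bVk x k : Ck k setT (bV x).
  apply: (@Ck_comp _ _ _ _ setT setT (fun y => y + (-1) *: cfun (c x) x) (bump (r x))) => //; try exact: openT.
    move=> j; apply: (@Ck_ext _ _ _ _ (fun y => y 0 j + cst (((-1) *: cfun (c x) x) 0 j) y)); first exact: openT.
      by move=> y _; rewrite !mxE.
    by apply: Ck_add; [exact: openT|exact: Ck_coord|exact: Ck_cst].
  exact: bump_Ck.
have bV0 x y : bV x y != 0 -> `|y - cfun (c x) x| <= r x.
  apply: contraNle => ry; apply/eqP; apply: bump_eq0; first by have [] := Hr' x.
  by rewrite scaleN1r ltW.
pose S x := [set y : 'rV[R]_n | exists2 s, [set cfun (c x) x] s & `|y - s| <= r x].
have cS x : compact (S x) by apply: thicken_compact; exact: compact_set1.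
have SV x : K x -> S x `<=` V x.
  by move=> Kx y [_ -> yr]; have [_ /(_ Kx)] := Hr' x; exact.
have bVS x y : bV x y != 0 -> S x y by move=> /bV0 h; exists (cfun (c x) x).
have Vc x : V x `<=` cfun (c x) @` cdom (c x) by move=> _ [z [_ cz] <-]; exists z.
pose b x := push (c x) (bV x).
have bk x k : K x -> Ck_on k setT (b x).
  move=> Kx; apply: (push_Ck (ac x) (cS x)) (bVk x k) => //; last exact: bVS.
  by move=> y /(SV x Kx) /Vc.
have b0 x z : 0 <= b x z by rewrite /b /push; case: ifP => // _; exact: bump_ge0.
pose W x := (cdom (c x)) `&` [set z | b x z != 0].
have oW x : K x -> open [set z | b x z != 0].
  move=> Kx; have -> : [set z | b x z != 0] = b x @^-1` [set t | t != 0] by [].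
  apply: open_comp; last exact: open_neq.
  by move=> z _; apply: Ck_on_continuous (bk x 0%N Kx) _ => //; exact: openT.
have := cK; rewrite compact_cover => /(_ M K (fun x => [set z | b x z != 0])).
case=> [x Kx|z Kz|D DK Kcov]; first exact: oW.
  exists z => //=; rewrite /b push_in// /bV scaleN1r subrr gt_eqF// bump_gt0 ?normr0//; by have [] := Hr' z.
pose s := [seq x <- finmap.enum_fset D | `[< K x >]].
pose Sb z := \sum_(x <- s) (if `[< K x >] then b x z else 0).
have bk' x k : Ck_on k setT (fun z => if `[< K x >] then b x z else 0).
  by case: asboolP => Kx; [exact: bk|exact: Ck_on_cst].
have CSb k : Ck_on k setT Sb by apply: Ck_on_sum.
have Sb0 z : K z -> Sb z != 0.
  move=> /Kcov[x /= xD bxz].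
  have Kx : K x by apply/set_mem; exact: DK.
  have xs : x \in s by rewrite mem_filter asboolT.
  rewrite gt_eqF// /Sb (big_rem x xs)/= asboolT// ltr_pwDl//.
    by rewrite lt_neqAle eq_sym bxz b0.
  by apply: sumr_ge0 => x' _; case: ifP.
pose th z := u z / Sb z.
have thu z : Sb z * th z = u z.
  rewrite /th; have [Kz|nKz] := pselect (K z); first by rewrite mulrC divfK// Sb0.
  by rewrite (_ : u z = 0) ?mul0r ?mulr0//; apply/eqP/negPn/negP => /uK.
have thK z : th z != 0 -> K z.
  by move=> tz; apply: uK; apply: contraNneq tz => uz; rewrite /th uz mul0r.
have Cth : Ck_on 1 setT th.
  apply: Ck_on_near => // z _; have [Kz|nKz] := pselect (K z); last first.
    exists (cst 0), (~` K); split => //; [exact: closed_openC| |exact: Ck_on_cst].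
    by move=> t; apply: contra_notP => /eqP; rewrite eq_sym => /thK.
  have oS : open [set z | Sb z != 0].
    have -> : [set z | Sb z != 0] = Sb @^-1` [set t | t != 0] by [].
    apply: open_comp; last exact: open_neq.
    by move=> t _; apply: Ck_on_continuous (CSb 0%N) _.
  exists th, [set z | Sb z != 0]; split => //; first exact: Sb0.
  apply: Ck_on_mul => //; first exact: Ck_on_sub Cu.
  by apply: Ck_on_inv => //; exact: Ck_on_sub (CSb 1%N).
pose g x (y : 'rV[R]_n) : R := if y \in V x then th (cinv (c x) y) * bV x y else 0.
have gk x : K x -> Ck 1 setT (g x).
  move=> Kx; apply: (@Ck_zero_extendV R n 1%N (V x) (S x)) => //; first exact: SV.
    by move=> y _ gy; apply: bVS; apply: contraNneq gy => ->; rewrite mulr0.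
  apply: Ck_mul => //; last by apply: Ck_subset (bVk x 1%N).
  by apply: Ck_on_chart => //; exact: Ck_on_sub Cth.
have gS x y : g x y != 0 -> S x y.
  rewrite /g; case: ifP => [_ gy|]; last by rewrite eqxx.
  by apply: bVS; apply: contraNneq gy => ->; rewrite mulr0.
have gE x z : K x -> push (c x) (g x) z = th z * b x z.
  move=> Kx; rewrite /b /push; case: ifPn => [/set_mem cz|]; last by rewrite mulr0.
  rewrite /g; case: ifPn => [/set_mem Vz|/negP nVz]; first by rewrite cfunK.
  rewrite (_ : bV x _ = 0) ?mulr0//; apply/eqP/negPn/negP => /bVS /(SV x Kx) h.
  by apply: nVz; exact: mem_set.
pose G x z := if `[< K x >] then push (c x) (g x) z else 0.
have -> : u = fun z => \sum_(x <- s) G x z.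
  apply/funext => z; rewrite -thu mulrC /Sb mulr_sumr; apply: eq_bigr => x _.
  by rewrite /G; case: asboolP => Kx; rewrite ?mulr0// gE.
have SVc x : K x -> S x `<=` cfun (c x) @` cdom (c x) by move=> Kx y /(SV x Kx) /Vc.
apply: C1_approximable_sum => x; rewrite /G; case: asboolP => Kx.
- exact: (push_Ck (ac x) (cS x) (SVc x Kx) (gS x) (gk x Kx)).
- exact: Ck_on_cst.
- exact: (push_C1_approximable (ac x) (gk x Kx) (cS x) (SV x Kx) (gS x)).
- exists set0; split => //; first exact: compact0.
  move=> eps eps0; exists (cst 0); split => //.
  + split; first by move=> k; exact: Ck_on_cst.
    apply: (@compact_support_of _ _ _ _ set0) => //; first exact: compact0.
    by move=> z; rewrite eqxx.
  + by move=> z; rewrite subrr normr0 ltW.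
  + by move=> z k; rewrite subrr normr0 ltW.
Qed.

End SmoothApproximation.

(** * Integration in a parametrisation *)

Section Transfer.
Local Open Scope ereal_scope.
Context d d' (T : measurableType d) (T' : measurableType d') (R : realType).
Variables (m : {measure set T -> \bar R}) (m' : {measure set T' -> \bar R}).
Variables (D : set T) (V : set T') (s : T' -> T) (k : T' -> R).
Hypotheses (mD : measurable D) (mV : measurable V) (ms : measurable_fun V s)
  (VD : forall y, V y -> D (s y)) (mk : measurable_fun V k)
  (k0 : forall y, (0 <= k y)%R).
Hypothesis mE : forall A, measurable A -> A `<=` D ->
  m A = \int[m']_(y in V) (\1_A (s y) * k y)%:E.

Let mf_s dU (U : measurableType dU) (f : T -> U) : measurable_fun D f ->
  measurable_fun V (f \o s).
Proof.
move=> mf; apply: (@measurable_comp _ _ _ _ _ _ D) => //.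
by move=> _ [y Vy <-]; exact: VD.
Qed.

Import HBNNSimple.

Let transfer_nnsfun (h : {nnsfun T >-> R}) :
  \int[m]_(x in D) (h x)%:E = \int[m']_(y in V) (h (s y) * k y)%:E.
Proof.
have mA r : measurable (h @^-1` [set r]) by exact: measurable_funPTI.
have mi r : measurable_fun D (\1_(h @^-1` [set r]) : T -> R) by exact: measurable_indic.
have mik r : measurable_fun V (fun y => \1_(h @^-1` [set r]) (s y) * k y)%R.
  by apply: measurable_funM => //; exact: (mf_s (mi r)).
transitivity (\sum_(r \in range h) \int[m]_(x in D) (r%:E * (\1_(h @^-1` [set r]) x)%:E)).
  rewrite -ge0_integral_fsum//.
  - by apply: eq_integral => x _; rewrite fimfunE -fsumEFin//.
  - by move=> r; apply: measurable_funeM; exact/measurable_EFinP.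
  - by move=> r x _; rewrite -EFinM nnfun_muleindic_ge0.
transitivity (\sum_(r \in range h) \int[m']_(y in V) (r%:E * (\1_(h @^-1` [set r]) (s y) * k y)%:E)); last first.
  rewrite -ge0_integral_fsum//.
  - apply: eq_integral => y _; rewrite [in RHS]fimfunE EFinM -fsumEFin//.
    rewrite ge0_mule_fsuml; last by move=> r; rewrite nnfun_muleindic_ge0.
    by apply: eq_fsbigr => r _; rewrite -!EFinM mulrA.
  - by move=> r; apply: measurable_funeM; exact/measurable_EFinP.
  - move=> r y _; rewrite -EFinM lee_fin mulrA; apply: mulr_ge0 => //.
    by rewrite -lee_fin EFinM nnfun_muleindic_ge0.
apply: eq_fsbigr => r /set_mem [x _ <-].
have hx0 : (0 <= h x)%R by exact: fun_ge0.
rewrite ge0_integralZl_EFin//; last exact/measurable_EFinP.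
rewrite ge0_integralZl_EFin//; last 2 first.
- by move=> y _; rewrite lee_fin mulr_ge0.
- exact/measurable_EFinP.
rewrite integral_indic// mE; [|exact: measurableI|exact: subIsetr].
congr (_ * _); apply: eq_integral => y /set_mem Vy.
by rewrite indicI/= [\1_D _]indicE mem_set ?mulr1//; exact: VD.
Qed.

(** The hypothesis is the case of indicator functions; simple functions and the
   monotone convergence theorem do the rest. *)
Lemma integral_transfer (f : T -> \bar R) : measurable_fun D f ->
  (forall x, D x -> 0 <= f x) ->
  \int[m]_(x in D) f x = \int[m']_(y in V) (f (s y) * (k y)%:E).
Proof.
move=> mf f0; pose h := nnsfun_approx mD mf.
transitivity (limn (fun j => \int[m]_(x in D) (h j x)%:E)).
  rewrite -monotone_convergence//.
  - apply: eq_integral => x /[!inE] xD; apply/esym/cvg_lim => //.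
    exact: cvg_nnsfun_approx.
  - by move=> j; exact/measurable_EFinP/measurable_funTS.
  - by move=> j x _; rewrite lee_fin.
  - by move=> x _ a b ab; rewrite lee_fin; exact/lefP/nd_nnsfun_approx.
under eq_fun do rewrite transfer_nnsfun.
rewrite -monotone_convergence//.
- apply: eq_integral => y /[!inE] Vy; apply/cvg_lim => //.
  under eq_fun do rewrite EFinM.
  apply: cvgeZr => //; apply: cvg_nnsfun_approx => //; exact: VD.
- move=> j; apply/measurable_EFinP/measurable_funM => //.
  by apply: (@mf_s _ R (h j)); exact: measurable_funTS.
- by move=> j y _; rewrite lee_fin mulr_ge0.
- move=> y _ a b ab; rewrite lee_fin ler_wpM2r//.
  by exact/lefP/nd_nnsfun_approx.
Qed.

Lemma Rintegral_transfer (f : T -> R) : measurable_fun D f ->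
  (\int[m]_(x in D) f x = \int[m']_(y in V) (f (s y) * k y))%R.
Proof.
move=> mf; rewrite /Rintegral; congr fine; rewrite integralE [RHS]integralE.
have mEf : measurable_fun D (EFin \o f) by exact/measurable_EFinP.
congr (_ - _).
  rewrite integral_transfer//; last exact: measurable_funepos.
  by apply: eq_integral => y _; rewrite !funeposE/= -!EFin_max -EFinM maxr_pMl// mul0r.
rewrite integral_transfer//; last exact: measurable_funeneg.
apply: eq_integral => y _; rewrite !funenegE/= -!EFin_max -EFinM.
by rewrite maxr_pMl// mul0r mulNr.
Qed.

End Transfer.

(** * The volume measure in charts *)

Section Volume.
Variables (R : realType) (n : nat) (M : smooth_manifold R n) (w : volume_form M).
Variable vol : {measure set (borel M) -> \bar R}.
Hypothesis hvol : volume_measure w vol.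
Implicit Types (c : chart R n M) (U D K : set M) (x : M) (u : M -> R).

Local Notation borelV n := (g_sigma_algebraType (@open 'rV[R]_n)).

Lemma measurable_cinv c U : open U -> U `<=` cdom c ->
  measurable_fun (cfun c @` U : set (borelV n)) (cinv c : borelV n -> borel M).
Proof.
move=> oU Uc; apply: (@open_measurable_fun R) => [|y [x Ux <-]].
  exact: cimg_open_sub.
by apply: cinv_for_continuous; exists x => //; exact: Uc.
Qed.

Lemma density_continuous c x : atlas c -> cdom c x ->
  {for cfun c x, continuous (fun y => `|volc w c (cinv c y)|)}.
Proof.
move=> ac cx.
have cw := Ck_on_continuous (@cdom_open _ _ _ c) (@volc_smooth _ _ _ w c ac 0%N) cx.
apply: (@cvg_comp _ _ _ (fun y => volc w c (cinv c y)) Num.norm _ (nbhs (volc w c (cinv c (cfun c x))))).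
  apply: (@cvg_comp _ _ _ (cinv c) (volc w c) _ (nbhs (cinv c (cfun c x)))).
    by apply: cinv_for_continuous; exists x.
  by rewrite cfunK.
exact: norm_continuous.
Qed.

Lemma measurable_density c U : atlas c -> open U -> U `<=` cdom c ->
  measurable_fun (cfun c @` U : set (borelV n))
    ((fun y => `|volc w c (cinv c y)|) : borelV n -> R).
Proof.
move=> ac oU Uc; apply: open_measurable_funR => [|y [x Ux <-]].
  exact: cimg_open_sub.
by apply: density_continuous => //; exact: Uc.
Qed.

(** The iterated integral that defines the volume of [A] is an integral against
   [lebV], restricted to the image of [D] in the chart. *)
Lemma volE c D (A : set (borel M)) : atlas c -> open D -> D `<=` cdom c ->
  measurable A -> A `<=` D ->
  vol A = (\int[lebV R n]_(y in cfun c @` D)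
             (\1_A (cinv c y) * `|volc w c (cinv c y)|)%:E)%E.
Proof.
move=> ac oD Dc mA AD.
rewrite (hvol ac mA (subset_trans AD Dc)).
have oV : open (cfun c @` D) by exact: cimg_open_sub.
have mV : measurable (cfun c @` D : set (borelV n)) by exact: sub_sigma_algebra.
have E : (fun y => (\1_(cfun c @` A) y * `|volc w c (cinv c y)|)%:E) =
   (fun y => (\1_A (cinv c y) * `|volc w c (cinv c y)|)%:E) \_ (cfun c @` D).
  apply/funext => y; rewrite patchE; case: ifPn => [/set_mem [x Dx <-]|/negP nV].
    have cx := Dc x Dx; rewrite cfunK// !indicE; congr (_%:R * _)%:E.
    congr nat_of_bool; apply/idP/idP => /set_mem; last by move=> Ax; apply/mem_set; exists x.
    by move=> [z Az zx]; apply/mem_set; rewrite -(cfunK cx) -zx cfunK//; exact/Dc/AD.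
  rewrite indicE memNset ?mul0r//; apply: contra_not nV => -[x Ax <-].
  by apply/mem_set; exists x => //; exact: AD.
have mf : measurable_fun (cfun c @` D : set (borelV n))
    ((fun y => (\1_A (cinv c y) * `|volc w c (cinv c y)|)%:E) : borelV n -> \bar R).
  apply/measurable_EFinP; apply: measurable_funM; last exact: measurable_density.
  apply: (@measurableT_comp _ _ _ _ _ _ (\1_A : borel M -> R)).
    exact: measurable_indic.
  exact: measurable_cinv.
rewrite [RHS]integral_mkcond integral_lebV//.
- by rewrite E.
- exact: (measurable_restrictT _ mV).1.
- by move=> y; apply: erestrict_ge0 => z _; rewrite lee_fin mulr_ge0.
Qed.

Lemma Rintegral_vol_chart c D (f : M -> R) : atlas c -> open D -> D `<=` cdom c ->
  measurable_fun (D : set (borel M)) (f : borel M -> R) ->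
  \int[vol]_(x in D) f x =
  \int[lebV R n]_(y in cfun c @` D) (f (cinv c y) * `|volc w c (cinv c y)|).
Proof.
move=> ac oD Dc mf.
have mD : measurable (D : set (borel M)) by exact: sub_sigma_algebra.
have oV : open (cfun c @` D) by exact: cimg_open_sub.
have mV : measurable (cfun c @` D : set (borelV n)) by exact: sub_sigma_algebra.
apply: (@Rintegral_transfer _ _ (borel M) (borelV n) R vol (lebV R n) D (cfun c @` D)
  (cinv c) (fun y => `|volc w c (cinv c y)|) mD mV _ _ _ _ _ f mf) => //.
- exact: measurable_cinv.
- by move=> _ [x Dx <-]; rewrite cfunK//; exact: Dc.
- exact: measurable_density.
- by move=> A mA AD; exact: volE.
Qed.

(** The density of the volume form is bounded on a small closed ball in a chart. *)
Lemma vol_locally_finite x : exists2 W, open W /\ W x & (vol W < +oo)%E.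
Proof.
have [c ac cx] := atlas_cover x.
have oI := cimg_open (c := c).
have [|d d0 Hd] := @compact_thicken R n [set cfun c x] (cfun c @` cdom c) (@compact_set1 _ _) oI.
  by move=> _ ->; exists x.
set S := [set y | _] in Hd.
have cS : compact S by apply: thicken_compact; exact: compact_set1.
have [B HB] : exists B, forall y, S y -> `|volc w c (cinv c y)| <= B.
  have /compact_bounded[m [mr Hm]] : compact ((fun y => `|volc w c (cinv c y)|) @` S).
    apply: continuous_compact => //; apply: (@continuous_subspaceW _ _ _ (cfun c @` cdom c)) => //.
    rewrite continuous_open_subspace// => y /set_mem [z cz <-].
    exact: density_continuous.
  exists (`|m| + 1) => y Sy; have := Hm (`|m| + 1) _ `|volc w c (cinv c y)|.
  by rewrite /= normr_id; apply; [rewrite ltr_pwDr// ler_norm|exists y].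
pose W := cdom c `&` cfun c @^-1` (ball (cfun c x) d).
have oW : open W.
  rewrite openE => z [cz zd]; apply: filterI.
    by apply: open_nbhs_nbhs; split => //; exact: cdom_open.
  apply: (cfun_for_continuous cz); apply: open_nbhs_nbhs; split => //; exact: ball_open.
have Wc : W `<=` cdom c by move=> z [].
have WS : cfun c @` W `<=` S.
  move=> _ [z [cz zd] <-]; exists (cfun c x) => //.
  by move: zd; rewrite /= -ball_normE/= distrC => /ltW.
exists W; first by split=> //; split => //; exact: ballxx.
have mW : measurable (W : set (borel M)) by exact: sub_sigma_algebra.
have oV : open (cfun c @` W) by exact: cimg_open_sub.
have mV : measurable (cfun c @` W : set (borelV n)) by exact: sub_sigma_algebra.
have r0 : 0 < `|cfun c x| + d + 1 by rewrite ltr_wpDl// addr_ge0// ltW.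
have /andP[_ loo] := lebV_ball n r0.
rewrite (volE ac oW Wc mW)//.
apply: (@le_lt_trans _ _ (\int[lebV R n]_(y in cfun c @` W) B%:E)%E).
  apply: ge0_le_integral => //.
  - apply/measurable_EFinP; apply: measurable_funM; last exact: measurable_density.
    apply: (@measurableT_comp _ _ _ _ _ _ (\1_W : borel M -> R)); last exact: measurable_cinv.
    exact: measurable_indic.
  - move=> y Wy; rewrite lee_fin; apply: le_trans (HB y (WS _ Wy)).
    by rewrite ler_piMl// indicE; case: (_ \in _).
have B0 : 0 <= B.
  by apply: le_trans (HB (cfun c x) _) => //; exists (cfun c x) => //; rewrite subrr normr0 ltW.
rewrite integral_cst//; apply: lte_mul_pinfty => //.
apply: le_lt_trans loo; apply: le_measure; rewrite ?inE//; first exact: measurable_ballV.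
move=> y /WS [_ -> yd]; rewrite -ball_normE/= sub0r normrN.
rewrite ltr_pwDr// -{1}(subrK (cfun c x) y) addrC.
by apply: le_trans (ler_normD _ _) _; rewrite lerD2l.
Qed.

Lemma vol_compact_finite K : compact K -> (vol K < +oo)%E.
Proof.
move=> cK; have Kcl := compact_closedM cK.
have mcl : measurable (K : set (borel M)).
  by rewrite -[K]setCK; apply: measurableC; apply: sub_sigma_algebra; exact: closed_openC.
have H x : exists W, [/\ open W, W x & (vol W < +oo)%E].
  by have [W [oW Wx] Wfin] := vol_locally_finite x; exists W.
have [W HW] := choice H.
have := cK; rewrite compact_cover => /(_ M setT W).
case=> [x _|x Kx|D _ Kcov]; first by have [] := HW x.
  by exists x => //; have [] := HW x.
have mW x : measurable (W x : set (borel M)).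
  by apply: sub_sigma_algebra; have [] := HW x.
have fin (s : seq M) : (vol (\big[setU/set0]_(x <- s) W x) < +oo)%E.
  elim: s => [|x s IH]; first by rewrite big_nil measure0.
  rewrite big_cons; apply: le_lt_trans (measureU2 _ _ _) _ => //.
    exact: bigsetU_measurable.
  by apply: lte_add_pinfty => //; have [] := HW x.
apply: le_lt_trans (fin (finmap.enum_fset D)).
apply: le_measure; rewrite ?inE//; first exact: bigsetU_measurable.
move=> x /Kcov[z /= zD Wz]; rewrite -bigcup_seq; exists z => //.
Qed.

Lemma continuous_supp_bounded D K u : (forall x, D x -> {for x, continuous u}) ->
  open D -> compact K -> K `<=` D -> (forall x, D x -> u x != 0 -> K x) ->
  exists2 C, 0 <= C & forall x, D x -> `|u x| <= C.
Proof.
move=> cu oD cK KD uK.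
have /compact_bounded[m [mr Hm]] : compact (u @` K).
  apply: continuous_compact => //; apply: (@continuous_subspaceW _ _ _ D) => //.
  by rewrite continuous_open_subspace// => x /set_mem; exact: cu.
exists (`|m| + 1); first by rewrite addr_ge0.
move=> x Dx; have [->|ux] := eqVneq (u x) 0; first by rewrite normr0 addr_ge0.
apply: Hm; first by rewrite ltr_pwDr// ler_norm.
by exists x => //; exact: uK.
Qed.

Lemma continuous_supp_integrable D K u : (forall x, D x -> {for x, continuous u}) ->
  open D -> compact K -> K `<=` D -> (forall x, D x -> u x != 0 -> K x) ->
  vol.-integrable D (EFin \o u).
Proof.
move=> cu oD cK KD uK.
have [C C0 uC] := continuous_supp_bounded cu oD cK KD uK.
have Kcl := compact_closedM cK.
have mK : measurable (K : set (borel M)).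
  by rewrite -[K]setCK; apply: measurableC; apply: sub_sigma_algebra; exact: closed_openC.
have mD : measurable (D : set (borel M)) by exact: sub_sigma_algebra.
have mu : measurable_fun (D : set (borel M)) (u : borel M -> R) by exact: open_measurable_funR.
have intK : vol.-integrable K (EFin \o u).
  apply: measurable_bounded_integrable => //; first exact: vol_compact_finite.
    exact: measurable_funS mu.
  exists C; split; first exact: num_real.
  by move=> C' CC' x Kx; apply: le_trans (uC x (KD x Kx)) (ltW CC').
apply: (integrable_mkcond _ mD).2.
rewrite (_ : (EFin \o u) \_ D = (EFin \o u) \_ K); last first.
  apply/funext => x; rewrite !patchE; case: ifPn => [/set_mem Dx|/negP nD]; case: ifPn => //.
    by move=> /negP nK; apply/eqP/negPn/negP => ux; apply: nK; apply/mem_set; apply: uK => //; apply: contraNneq ux => /= ->.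
  by move=> /set_mem /KD Dx; exfalso; apply: nD; exact: mem_set.
exact: (integrable_mkcond _ mK).1.
Qed.

End Volume.

(** * Integration by parts on the manifold *)

Section WeakDerivative.
Variables (R : realType) (n : nat) (M : smooth_manifold R n) (w : volume_form M).
Variable vol : {measure set (borel M) -> \bar R}.
Hypothesis hvol : volume_measure w vol.
Implicit Types (c : chart R n M) (U D K : set M) (x : M) (u psi : M -> R).

Local Notation borelV n := (g_sigma_algebraType (@open 'rV[R]_n)).
Local Notation e_ i := (delta_mx 0 i).

Lemma sgr_locally_constant (T : topologicalType) (g : T -> R) (x : T) :
  {for x, continuous g} -> g x != 0 -> \forall z \near x, Num.sg (g z) = Num.sg (g x).
Proof.
move=> cg g0; have := cg => /cvgr_dist_lt /(_ _ (_ : 0 < `|g x|)).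
rewrite normr_gt0 => /(_ g0); apply: filterS => z.
have [gx0|gx0|gx0] := ltgtP (g x) 0.
- rewrite (ltr0_norm gx0) ltr_distl => /andP[h1 h2].
  by rewrite !ltr0_sg//; lra.
- rewrite (gtr0_norm gx0) ltr_distl => /andP[h1 h2].
  by rewrite !gtr0_sg//; lra.
- by rewrite gx0 eqxx in g0.
Qed.

Lemma chart_partial_is_derive c i U u x : atlas c -> open U -> Ck_on 1 U u ->
  U x -> cdom c x ->
  is_derive (cfun c x) (e_ i) (u \o cinv c) (chart_partial c i u x).
Proof.
move=> ac oU Cu Ux cx.
have [_ /(_ i)[d _]] := (CkS_open _ _ (cimgI_open c oU)).1 (Cu c ac).
by apply/derivableP/d; exists x.
Qed.

Lemma chart_partial_continuous c i U u x : atlas c -> open U -> Ck_on 1 U u ->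
  U x -> cdom c x -> {for x, continuous (chart_partial c i u)}.
Proof.
move=> ac oU Cu Ux cx; have oV := cimgI_open c oU.
have Vx : (cfun c @` (U `&` cdom c)) (cfun c x) by exists x.
have [_ /(_ i)[_ /(Ck0_open _ oV) h]] := (CkS_open _ _ oV).1 (Cu c ac).
have cp : {for x, continuous (partial i (u \o cinv c) \o cfun c)}.
  by apply: continuous_comp; [exact: cfun_for_continuous|exact: h].
exact: cp.
Qed.

(** Integration by parts in a chart. Multiplied by the density |w|, the difference
   of the two integrands is the divergence of the field (sgn w) w X^i psi u of
   R^n, which is compactly supported and C^1, so its integral vanishes. The sign
   of w is locally constant, hence commutes with the derivatives. *)
Lemma classical_weak_derivative (Omega : set M) (X : vector_field M) u :
  open Omega -> Ck_on 1 Omega u -> weak_vf_apply w vol Omega X u (vf_apply X u).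
Proof.
move=> oO Cu c ac psi [Cpsi [cK KD]].
set D := Omega `&` cdom c in KD *; set K := closure _ in cK KD.
have oD : open D by exact: openI_cdom.
have DO : D `<=` Omega by move=> x [].
have Dc : D `<=` cdom c by move=> x [].
have psiK x : psi x != 0 -> K x by move=> px; exact: (@subset_closure _ [set x | psi x != 0]).
have Kcl : closed K by exact: closed_closure.
have CuD : Ck_on 1 D u by exact: Ck_on_sub Cu.
have CpD k : Ck_on k D psi by exact: Ck_on_sub (Cpsi k).
have CwD k : Ck_on k D (volc w c) by apply: Ck_on_sub (volc_smooth w ac k).
have CXD i k : Ck_on k D (fun x => vfc X c x 0 i).
  by apply: Ck_on_sub (vfc_smooth X ac i k).
have w0 x : D x -> volc w c x != 0 by move=> /Dc; exact: volc_neq0.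
pose F i x := volc w c x * vfc X c x 0 i * psi x.
have CF i k : Ck_on k D (F i) by apply: Ck_on_mul => //; exact: Ck_on_mul.
have FK i x : F i x != 0 -> K x.
  by move=> Fx; apply: psiK; apply: contraNneq Fx => px; rewrite /F px mulr0.
have dFK i x : D x -> chart_partial c i (F i) x != 0 -> K x.
  move=> Dx; apply: contraNP => nK; apply/eqP.
  rewrite /chart_partial /partial (@near_eq_derive _ _ _ _ (cst 0)) ?derive_cst//.
  apply: (@cimg_near _ _ _ c x (fun z => F i z = 0)); first exact: Dc.
  have : \forall z \near x, (~` K) z.
    by apply: open_nbhs_nbhs; split => //; exact: closed_openC.
  by apply: filterS => z nKz; apply/eqP/negPn/negP => /FK.
have cvol x : D x -> {for x, continuous (volc w c)}.
  by move=> Dx; exact: Ck_on_continuous (CwD 0%N) Dx.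
pose q1 x := vf_apply X u x * psi x.
pose q2 x := u x * vf_adjoint w X c psi x.
have cu x : D x -> {for x, continuous u} by move=> Dx; exact: Ck_on_continuous CuD Dx.
have cpsi x : D x -> {for x, continuous psi} by move=> Dx; exact: Ck_on_continuous (CpD 0%N) Dx.
have cq1 x : D x -> {for x, continuous q1}.
  move=> Dx; apply: (@cvgM _ _ (nbhs x) _ (vf_apply X u) psi).
    exact: (vf_apply_continuous oD CuD Dx).
  exact: cpsi.
have cq2 x : D x -> {for x, continuous q2}.
  move=> Dx; apply: (@cvgM _ _ (nbhs x) _ u (vf_adjoint w X c psi)).
    exact: cu.
  apply: (@cvgM _ _ (nbhs x) _ (fun x => - _) (fun x => (volc w c x)^-1)).
    apply: cvgN; apply: (@cvg_sumr _ _ _ (nbhs x) _ _ (fun i => chart_partial c i (F i))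
      (fun i => chart_partial c i (F i) x)) => i.
    exact: (chart_partial_continuous ac oD (CF i 1%N) Dx (Dc x Dx)).
  by apply: cvgV; [exact: w0|exact: cvol].
have q1K x : D x -> q1 x != 0 -> K x.
  by move=> _ qx; apply: psiK; apply: contraNneq qx => px; rewrite /q1 px mulr0.
have q2K x : D x -> q2 x != 0 -> K x.
  move=> Dx; apply: contraNP => nK; apply/eqP.
  rewrite /q2 /vf_adjoint big1 ?oppr0 ?mul0r ?mulr0// => i _.
  by apply/eqP/negPn/negP => /(dFK i x Dx).
have mD : measurable (D : set (borel M)) by exact: sub_sigma_algebra.
have i1 := continuous_supp_integrable hvol cq1 oD cK KD q1K.
have i2 := continuous_supp_integrable hvol cq2 oD cK KD q2K.
apply/eqP; rewrite -subr_eq0 -RintegralB//; apply/eqP.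
pose q x := q1 x - q2 x.
have cq x : D x -> {for x, continuous q}.
  by move=> Dx; apply: (@cvgB _ _ _ (nbhs x) _ q1 q2); [exact: cq1|exact: cq2].
rewrite -/(\int[vol]_(x in D) q x).
rewrite (Rintegral_vol_chart hvol ac oD Dc); last exact: open_measurable_funR.
pose V := cfun c @` D.
have oV : open V by exact: cimg_open_sub.
have VE : V = cfun c @` (D `&` cdom c).
  by rewrite /V; congr (_ @` _); apply/seteqP; split=> [x Dx|x []//]; split => //; exact: Dc.
pose S := cfun c @` K.
have cS : compact S.
  apply: continuous_compact => //; apply: (@continuous_subspaceW _ _ _ (cdom c)).
    by move=> x /KD /Dc.
  exact: cfun_continuous.
have SV : S `<=` V by move=> _ [x Kx <-]; exists x => //; exact: KD.
pose h i y := Num.sg (volc w c (cinv c y)) * (F i (cinv c y) * u (cinv c y)).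
have h_near i x : D x -> \forall y \near cfun c x,
    Num.sg (volc w c x) * (F i (cinv c y) * u (cinv c y)) = h i y.
  move=> Dx; apply: (@cimg_near _ _ _ c x (fun z => Num.sg (volc w c x) * (F i z * u z) =
     Num.sg (volc w c z) * (F i z * u z))); first exact: Dc.
  have := sgr_locally_constant (cvol x Dx) (w0 x Dx).
  by apply: filterS => z ->.
have CFu i : Ck_on 1 D (fun x => F i x * u x) by exact: Ck_on_mul.
have Ch i : Ck 1 V (h i).
  apply: Ck_local => // _ [x Dx <-].
  have /nbhs_ballP[r /= r0 HW] := h_near i x Dx.
  set W := ball (cfun c x) r in HW.
  have oW : open W by exact: ball_open.
  have Wx : W (cfun c x) by exact: ballxx.
  suff CW : Ck 1 (W `&` V) (h i).
    by exists (W `&` V); split; [exact: openI|split => //; exists x|exact: CW].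
  apply: (@Ck_ext _ _ _ _ (fun y => Num.sg (volc w c x) * ((fun x => F i x * u x) \o cinv c) y)).
  - exact: openI.
  - by move=> y [Wy _]; exact: HW.
  - apply: Ck_scale; first exact: openI.
    apply: (@Ck_subset _ _ _ _ V) => //; rewrite VE; exact: (CFu i c ac).
have hS i y : V y -> h i y != 0 -> S y.
  move=> [x Dx <-]; rewrite /h cfunK//; last exact: Dc.
  move=> hx; exists x => //; apply: (FK i); apply: contraNneq hx => ->.
  by rewrite mul0r mulr0.
have dh i x : D x -> is_derive (cfun c x) (e_ i) (h i) (Num.sg (volc w c x) *
    (F i x * chart_partial c i u x + u x * chart_partial c i (F i) x)).
  move=> Dx; have cx := Dc x Dx.
  apply: (near_eq_is_derive (h_near i x Dx)).
  have dF := chart_partial_is_derive i ac oD (CF i 1%N) Dx cx.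
  have du := chart_partial_is_derive i ac oD CuD Dx cx.
  have d1 := is_deriveM dF du.
  have d2 := is_deriveM (is_derive_cst (Num.sg (volc w c x)) (cfun c x) (e_ i)) d1.
  by apply: (is_derive_eq d2); rewrite /= scaler0 addr0 !cfunK.
pose H i y := if y \in V then h i y else 0.
have CH i : Ck 1 setT (H i) by apply: Ck_zero_extendV cS SV (hS i) (Ch i).
have dH i x : D x -> partial i (H i) (cfun c x) = Num.sg (volc w c x) *
    (F i x * chart_partial c i u x + u x * chart_partial c i (F i) x).
  move=> Dx; rewrite -(@derive_val _ _ _ _ _ _ _ (dh i x Dx)).
  apply: near_eq_derive.
  have : \forall y \near cfun c x, V y by apply: open_nbhs_nbhs; split => //; exists x.
  by apply: filterS => y Vy; rewrite /H mem_set.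
have dH0 i y : ~ V y -> partial i (H i) y = 0.
  move=> nV; rewrite /partial (@near_eq_derive _ _ _ _ (cst 0)) ?derive_cst//.
  have : \forall z \near y, (~` S) z.
    apply: open_nbhs_nbhs; split; last by move/SV.
    by apply: closed_openC; apply: compact_closed => //; exact: norm_hausdorff.
  apply: filterS => z nSz; rewrite /H; case: ifP => // /set_mem Vz.
  by apply/eqP/negPn/negP => /(hS i z Vz).
have [r r0 Hr] : exists2 r : R, 0 < r & forall i y, r <= `|y| -> H i y = 0.
  have /compact_bounded[m [_ Hm]] := cS.
  exists (`|m| + 2); first by rewrite ltr_wpDl.
  move=> i y ry; apply/eqP/negPn/negP; rewrite /H; case: ifP => [/set_mem Vy /(hS i y Vy) Sy|]; last by rewrite eqxx.
  have m1 : m < `|m| + 1 by rewrite ltr_pwDr// ler_norm.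
  by have := Hm (`|m| + 1) m1 y Sy => /=; lra.
have oT := @openT 'rV[R]_n.
have cH i : continuous (H i) by move=> z; exact: Ck_continuous (CH i) _.
have cdH i : continuous (partial i (H i)).
  by move=> z; have [_ /(_ i)[_ /(Ck0_open _ oT)]] := (CkS_open _ _ oT).1 (CH i); exact.
have intH i : (lebV R n).-integrable setT (EFin \o partial i (H i)).
  have dHr := partial_supp i (Hr i).
  have [C C0 HC] := suppV_bounded (cdH i) dHr.
  by apply: (suppV_integrable _ (continuous_measurableV (cdH i)) dHr HC); rewrite addr_gt0.
transitivity (\int[lebV R n]_y (\sum_(i < n) partial i (H i) y)).
  rewrite Rintegral_mkcond; apply: eq_Rintegral => y _; rewrite patchE.
  case: ifPn => [/set_mem [x Dx <-]|/negP nV]; last first.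
    by rewrite big1// => i _; apply: dH0 => Vy; apply: nV; exact: mem_set.
  have cx := Dc x Dx; rewrite cfunK// /q /q1 /q2 /vf_adjoint.
  rewrite (vf_applyE X ac oD CuD Dx cx).
  rewrite [RHS](eq_bigr (fun i => Num.sg (volc w c x) * (F i x * chart_partial c i u x) +
    Num.sg (volc w c x) * u x * chart_partial c i (F i) x)); last first.
    by move=> i _; rewrite dH// mulrDr !mulrA.
  rewrite big_split/= -!mulr_sumr mulrBl; congr (_ + _).
    rewrite !mulr_suml mulr_sumr; apply: eq_bigr => i _.
    by rewrite /F normrEsg; ring.
  rewrite -/(F _) normrEsg.
  set s := Num.sg _; set A := \sum_(i < n) _; set W := volc w c x.
  have W0 : W != 0 by exact: w0.
  by field.
have I0 i : \int[lebV R n]_y partial i (H i) y = 0 by exact: integral_partial_eq0 (CH i) r0 (Hr i).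
suff [] : (lebV R n).-integrable setT (EFin \o (fun y => \sum_(i < n) partial i (H i) y)) /\
  \int[lebV R n]_y (\sum_(i < n) partial i (H i) y) = 0 by [].
elim: (index_enum 'I_n) => [|i l [IHi IH0]].
  rewrite (_ : (fun y => _) = cst 0); last by apply/funext => y; rewrite big_nil.
  by split; [exact: integrable0|rewrite Rintegral_cst// mul0r].
rewrite (_ : (fun y => _) = (fun y => partial i (H i) y + \sum_(j <- l) partial j (H j) y)); last first.
  by apply/funext => y; rewrite big_cons.
split; last by rewrite RintegralD// I0 IH0 addr0.
rewrite (_ : _ \o _ = (EFin \o partial i (H i)) \+ (EFin \o (fun y => \sum_(j <- l) partial j (H j) y)%R))%E//.
exact: integrableD.
Qed.

End WeakDerivative.

(** * Compactly supported C^1 functions in the variable exponent Sobolev space *)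

Lemma measurable_powR_fun d (T : measurableType d) (R : realType) (D : set T)
    (a p : T -> R) : measurable D -> measurable_fun D a -> measurable_fun D p ->
  (forall x, D x -> p x != 0) -> measurable_fun D (fun x => a x `^ p x).
Proof.
move=> mD ma mp p0.
apply: (@eq_measurable_fun _ _ _ _ _ (fun x => if a x == 0 then 0 else expR (p x * ln (a x)))).
  by move=> x /set_mem Dx; rewrite /powR (negbTE (p0 x Dx)).
apply: measurable_fun_if => //.
  by apply: measurable_fun_eqr => //; exact: measurable_cst.
apply: (@measurable_funS _ _ _ _ D) => //.
apply: (measurableT_comp (@measurable_expR R)); apply: measurable_funM => //.
exact: (measurableT_comp (@measurable_ln R)).
Qed.

Section LuxemburgNorm.
Variables (R : realType) (n : nat) (M : smooth_manifold R n) (w : volume_form M).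
Variable vol : {measure set (borel M) -> \bar R}.
Hypothesis hvol : volume_measure w vol.
Variables (Omega : set M) (oOmega : open Omega) (p : M -> R) (pmax : R).
Hypotheses (p_cont : forall x, Omega x -> {for x, continuous p})
  (p_gt1 : forall x, Omega x -> 1 < p x) (p_le : forall x, Omega x -> p x <= pmax).
Implicit Types (K : set M) (u g : M -> R).

Let mO : measurable (Omega : set (borel M)).
Proof. exact: sub_sigma_algebra. Qed.

Let mp : measurable_fun (Omega : set (borel M)) (p : borel M -> R).
Proof. exact: open_measurable_funR. Qed.

Let p0 x : Omega x -> p x != 0.
Proof. by move=> /p_gt1 h; rewrite gt_eqF// (lt_trans _ h). Qed.

Lemma measurable_Lpx_integrand u : measurable_fun (Omega : set (borel M)) (u : borel M -> R) ->
  measurable_fun (Omega : set (borel M)) ((fun x => `|u x| `^ p x) : borel M -> R).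
Proof.
move=> mu; apply: measurable_powR_fun => //.
exact: (measurableT_comp (@normr_measurable R setT)).
Qed.

Lemma measurable_compact K : compact K -> measurable (K : set (borel M)).
Proof.
move=> /compact_closedM Kcl; rewrite -[K]setCK; apply: measurableC.
by apply: sub_sigma_algebra; exact: closed_openC.
Qed.

Lemma integral_le_compact K g (C : R) : compact K -> K `<=` Omega ->
  measurable_fun (Omega : set (borel M)) (g : borel M -> R) ->
  (forall x, Omega x -> ~ K x -> g x = 0) -> (forall x, K x -> 0 <= g x <= C) -> 0 <= C ->
  (\int[vol]_(x in Omega) (g x)%:E <= C%:E * vol K)%E.
Proof.
move=> cK KO mg gK gC C0; have mK := measurable_compact cK.
have -> : (\int[vol]_(x in Omega) (g x)%:E = \int[vol]_(x in K) (g x)%:E)%E.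
  rewrite integral_mkcond [RHS]integral_mkcond; apply: eq_integral => x _.
  rewrite !patchE; case: ifPn => [/set_mem Ox|/negP nO]; case: ifPn => //.
    by move=> /negP nK; rewrite gK// => Kx; apply: nK; exact: mem_set.
  by move=> /set_mem /KO Ox; exfalso; apply: nO; exact: mem_set.
rewrite -integral_cst//; apply: ge0_le_integral => //.
- by move=> x /gC /andP[]; rewrite lee_fin.
- by apply/measurable_EFinP; exact: measurable_funS mg.
- by move=> x /gC /andP[]; rewrite lee_fin.
Qed.

Lemma Lpx_continuous_supp K u : (forall x, Omega x -> {for x, continuous u}) ->
  compact K -> K `<=` Omega -> (forall x, Omega x -> u x != 0 -> K x) ->
  Lpx vol Omega p u.
Proof.
move=> cu cK KO uK.
have [C C0 uC] := continuous_supp_bounded cu oOmega cK KO uK.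
have mu : measurable_fun (Omega : set (borel M)) (u : borel M -> R) by exact: open_measurable_funR.
split=> //.
have C1 : 1 <= 1 + C by rewrite lerDl.
apply: le_lt_trans (@integral_le_compact K _ ((1 + C) `^ pmax) cK KO _ _ _ (powR_ge0 _ _)) _.
- exact: measurable_Lpx_integrand.
- move=> x Ox nK; rewrite (_ : u x = 0) ?normr0 ?powR0 ?p0//.
  by apply/eqP/negPn/negP => /(uK x Ox).
- move=> x /KO Ox; rewrite powR_ge0/=.
  apply: (@le_trans _ _ ((1 + C) `^ p x)); last by apply: ler_powR => //; exact: p_le.
  apply: ge0_ler_powR; rewrite ?nnegrE//.
  + by rewrite ltW// (lt_trans _ (p_gt1 Ox)).
  + by rewrite addr_ge0.
  + by apply: le_trans (uC x Ox) _; rewrite lerDr.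
- by apply: lte_mul_pinfty => //; [rewrite lee_fin powR_ge0|exact: (vol_compact_finite hvol cK)].
Qed.

(** If |u| <= e <= t, then |u / t|^p <= e / t because p >= 1, so the modular of
   u / t is at most (e / t) vol(K) <= 1. *)
Lemma Lpx_norm_le K u (e t : R) : compact K -> K `<=` Omega ->
  measurable_fun (Omega : set (borel M)) (u : borel M -> R) ->
  (forall x, Omega x -> ~ K x -> u x = 0) -> 0 < t -> 0 <= e ->
  e * (fine (vol K) + 1) <= t ->
  (forall x, K x -> `|u x| <= e) -> (Lpx_norm vol Omega p u <= t%:E)%E.
Proof.
move=> cK KO mu uK t0 e0 et ue.
have vfin := vol_compact_finite hvol cK.
have L0 : 0 <= fine (vol K) by rewrite fine_ge0.
apply: ereal_inf_lbound; exists t => //; split => //.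
have et1 : e / t <= 1.
  by rewrite ler_pdivrMr// mul1r; apply: le_trans et; rewrite ler_peMr// lerDr.
apply: le_trans (@integral_le_compact K _ (e / t) cK KO _ _ _ _) _.
- apply: measurable_Lpx_integrand; apply: measurable_funM => //; exact: measurable_cst.
- by move=> x Ox nK; rewrite uK// mul0r normr0 powR0// p0.
- move=> x Kx; have Ox := KO x Kx; rewrite powR_ge0/=.
  have uet : `|u x / t| <= e / t.
    by rewrite normrM normfV (gtr0_norm t0) ler_pM2r ?invr_gt0//; exact: ue.
  have [->|ux0] := eqVneq (u x / t) 0.
    by rewrite normr0 powR0 ?p0// divr_ge0// ltW.
  apply: le_trans (uet); apply: ge1r_powR.
    by rewrite normr_gt0 ux0 (le_trans uet).
  by rewrite ltW// p_gt1.
- by rewrite divr_ge0// ltW.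
- rewrite -(fineK (_ : vol K \is a fin_num)); last by rewrite ge0_fin_numE.
  rewrite -EFinM lee_fin mulrAC ler_pdivrMr// mul1r; apply: le_trans et.
  by rewrite ler_wpM2l// lerDl.
Qed.

Variables (N : nat) (X : 'I_N -> vector_field M).

Lemma enorm0 : enorm (0 : 'rV[R]_N) = 0.
Proof. by rewrite /enorm /dotp big1 ?sqrtr0// => i _; rewrite mxE mul0r. Qed.

Lemma dotp_ge0 (a : 'rV[R]_N) : 0 <= dotp a a.
Proof. by apply: sumr_ge0 => i _; rewrite -expr2 sqr_ge0. Qed.

Lemma enorm_le (a : 'rV[R]_N) (e : R) : 0 <= e -> (forall k, `|a 0 k| <= e) ->
  enorm a <= (N%:R + 1) * e.
Proof.
move=> e0 ae; rewrite /enorm.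
(* N + 1 in place of sqrt N keeps the bound polynomial, and positive for N = 0. *)
have Ne0 : 0 <= (N%:R + 1) * e by rewrite mulr_ge0// addr_ge0.
rewrite -(ger0_norm Ne0) -sqrtr_sqr; apply: ler_wsqrtr.
apply: (@le_trans _ _ (\sum_(k < N) e ^+ 2)).
  apply: ler_sum => k _; rewrite -expr2 -real_normK ?num_real//.
  by rewrite lerXn2r ?nnegrE.
rewrite sumr_const card_ord -[leLHS]mulr_natl exprMn ler_wpM2r ?sqr_ge0//.
have N0 : 0 <= N%:R :> R by [].
by rewrite expr2; nra.
Qed.

Lemma enorm_continuous (G : M -> 'rV[R]_N) x :
  (forall k, {for x, continuous (fun z => G z 0 k)}) ->
  {for x, continuous (fun z => enorm (G z))}.
Proof.
move=> cG; apply: (@cvg_comp _ _ _ (fun z => dotp (G z) (G z)) Num.sqrt _ (nbhs (dotp (G x) (G x)))).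
  apply: (@cvg_sumr _ _ _ (nbhs x) _ _ (fun k z => G z 0 k * G z 0 k) (fun k => G x 0 k * G x 0 k)) => k.
  by apply: (@cvgM _ _ (nbhs x) _ (fun z => G z 0 k) (fun z => G z 0 k)); exact: cG.
exact: sqrt_continuous.
Qed.

Lemma hgrad_continuous u x k : Ck_on 1 Omega u -> Omega x ->
  {for x, continuous (fun z => hgrad X u z 0 k)}.
Proof.
move=> Cu Ox; rewrite (_ : (fun z => _) = vf_apply (X k) u).
  exact: (vf_apply_continuous oOmega Cu Ox).
by apply/funext => z; rewrite mxE.
Qed.

(** The distributional gradient is the classical one by
   [classical_weak_derivative]. The errors of the approximations of
   [C1_compact_approximable] live in a fixed compact set, where uniform smallness
   controls the Luxemburg norm. *)
Lemma C1_compact_W01px u : Ck_compact 1 Omega u ->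
  W01px w vol Omega p X u (hgrad X u).
Proof.
move=> [Cu [cK KO]].
have CuO : Ck_on 1 Omega u by exact: Ck_on_sub Cu.
have cu x : Omega x -> {for x, continuous u} by move=> Ox; exact: Ck_on_continuous CuO Ox.
set K := closure _ in cK KO.
have uK x : u x != 0 -> K x by move=> ux; exact: (@subset_closure _ [set x | u x != 0]).
have gK x : ~ K x -> hgrad X u x = 0.
  move=> nK; apply/rowP => k; rewrite !mxE; apply: vf_apply_cst0.
  have : \forall z \near x, (~` K) z.
    by apply: open_nbhs_nbhs; split => //; apply: closed_openC; exact: closed_closure.
  by apply: filterS => z nKz; apply/eqP/negPn/negP => /uK.
split.
  split.
  - exact: (Lpx_continuous_supp cu cK KO (fun x _ => uK x)).
  - apply: (@Lpx_continuous_supp K) => //.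
      by move=> x Ox; apply: enorm_continuous => k; exact: hgrad_continuous.
    move=> x Ox; apply: contraNP => nK; apply/eqP; by rewrite gK// enorm0.
  - move=> k; rewrite (_ : (fun x => hgrad X u x 0 k) = vf_apply (X k) u); last first.
      by apply/funext => z; rewrite mxE.
    split; last by apply: (classical_weak_derivative hvol _ oOmega CuO).
    apply: open_measurable_funR => // x Ox; exact: (vf_apply_continuous oOmega CuO Ox).
have [K' [cK' K'O app]] := C1_compact_approximable X oOmega (conj Cu (conj cK KO)).
move=> e e0.
have vK' : 0 <= fine (vol K') by rewrite fine_ge0.
pose t := e / 3; have t0 : 0 < t by rewrite divr_gt0.
(* A uniform error d makes each of the two Luxemburg norms at most t. *)
pose d := t / ((N%:R + 1) * (fine (vol K') + 1)).
have N1 : 1 <= N%:R + 1 :> R by rewrite lerDr.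
have N10 : 0 < N%:R + 1 :> R by rewrite ltr_pwDr.
have v1 : 1 <= fine (vol K') + 1 by rewrite lerDr.
have v10 : 0 < fine (vol K') + 1 by rewrite ltr_wpDl.
have d0 : 0 < d by rewrite divr_gt0// mulr_gt0.
have dE : (N%:R + 1) * d * (fine (vol K') + 1) = t.
  by rewrite /d; field; rewrite !gt_eqF.
have [psi [Cpsi psiK psi1 psi2]] := app d d0.
have CpO : Ck_on 1 Omega psi by exact: (Ck_on_sub _ (Cpsi.1 1%N)).
exists psi; split => //.
have cpsi x : Omega x -> {for x, continuous psi} by move=> Ox; exact: Ck_on_continuous CpO Ox.
have h1 : (Lpx_norm vol Omega p (fun x => u x - psi x)%R <= t%:E)%E.
  apply: (@Lpx_norm_le K' _ d) => //.
  - apply: open_measurable_funR => // x Ox; apply: (@cvgB _ _ _ (nbhs x) _ u psi).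
      exact: cu.
    exact: cpsi.
  - by move=> x _ nK; rewrite psiK// subrr.
  - exact: ltW.
  - rewrite -[leRHS]dE; apply: ler_wpM2r; first exact: ltW.
    by rewrite ler_peMl// ltW.
have h2 : (Lpx_norm vol Omega p (fun x => enorm (hgrad X u x - hgrad X psi x)%R) <= t%:E)%E.
  apply: (@Lpx_norm_le K' _ ((N%:R + 1) * d)) => //.
  - apply: open_measurable_funR => // x Ox; apply: enorm_continuous => k.
    rewrite (_ : (fun z => _) = (fun z => hgrad X u z 0 k - hgrad X psi z 0 k)); last first.
      by apply/funext => z; rewrite !mxE.
    by apply: (@cvgB _ _ _ (nbhs x) _ (fun z => hgrad X u z 0 k) (fun z => hgrad X psi z 0 k));
      exact: hgrad_continuous.
  - move=> x Ox nK; rewrite (_ : _ - _ = 0) ?enorm0//.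
    apply/rowP => k; rewrite !mxE (@vf_apply_near _ _ _ _ _ psi) ?subrr//.
    have : \forall z \near x, (~` K') z.
      apply: open_nbhs_nbhs; split => //; apply: closed_openC; exact: compact_closedM.
    by apply: filterS => z; exact: psiK.
  - by rewrite mulr_ge0 ?ltW.
  - by rewrite dE.
  - move=> x Kx; rewrite ger0_norm ?sqrtr_ge0//; apply: enorm_le => [|k]; first exact: ltW.
    by rewrite !mxE; exact: psi2.
apply: le_lt_trans (leeD h1 h2) _.
by rewrite -EFinD lte_fin /t; lra.
Qed.

End LuxemburgNorm.

(** * Powers with a variable exponent *)

Section PowerOfC1.
Variable R : realType.

(** At a zero of [u], the exponent is eventually larger than s = q(x) / 2, so
   u^q <= u^s, which tends to 0. *)
Lemma powR_continuous (T : topologicalType) (u q : T -> R) (x : T) :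
  {for x, continuous u} -> {for x, continuous q} -> 0 < q x ->
  (\forall z \near x, 0 <= u z) -> {for x, continuous (fun z => u z `^ q z)}.
Proof.
move=> cu cq q0 nu.
have ux0 := nbhs_singleton nu.
have [ux|ux] := eqVneq (u x) 0; last first.
  have ugt0 : 0 < u x by rewrite lt_neqAle eq_sym ux.
  apply: (@near_eq_continuous _ _ (fun z => expR (q z * ln (u z)))).
    have : \forall z \near x, 0 < u z by exact: (cvgr_gt _ cu).
    by apply: filterS => z uz; rewrite /powR gt_eqF.
  apply: (@cvg_comp _ _ _ (fun z => q z * ln (u z)) expR _ (nbhs (q x * ln (u x)))).
    apply: (@cvgM _ _ (nbhs x) _ q (@ln R \o u)) => //.
    by apply: continuous_comp => //; exact: continuous_ln.
  exact: continuous_expR.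
apply/(@cvgrPdist_le _ _ _ (nbhs x) _) => eps eps0.
rewrite ux powR0 ?gt_eqF//.
pose s := q x / 2; have s0 : 0 < s by rewrite divr_gt0.
pose d := Num.min 1 (eps `^ s^-1).
have d0 : 0 < d by rewrite lt_min ltr01 powR_gt0.
have nq : \forall z \near x, s < q z.
  by apply: (cvgr_gt _ cq); rewrite ltr_pdivrMr// ltr_pMr// ltr1n.
have nud : \forall z \near x, u z < d by apply: (cvgr_lt _ cu); rewrite ux.
near=> z; rewrite sub0r normrN ger0_norm ?powR_ge0//.
have qz : s < q z by near: z.
have uzd : u z < d by near: z.
have uz0 : 0 <= u z by near: z.
have [->|uz] := eqVneq (u z) 0; first by rewrite powR0 ?ltW// gt_eqF// (lt_trans s0).
have uzgt0 : 0 < u z by rewrite lt_neqAle eq_sym uz.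
move: uzd; rewrite lt_min => /andP[uz1 uze].
apply: (@le_trans _ _ (u z `^ s)).
  by apply: ger_powR; [rewrite uzgt0 ltW|exact: ltW].
rewrite -[leRHS](powRr1 (ltW eps0)) -(@mulVf _ s) ?gt_eqF// (powRrM _ s^-1 s).
by apply: (ge0_ler_powR (ltW s0)); rewrite ?nnegrE ?powR_ge0 ?ltW//.
Unshelve. all: by end_near. Qed.

(** This is ln (1/a) <= 1/a. *)
Lemma powR_ln_le (a q : R) : 0 < a <= 1 -> `|a `^ q * ln a| <= a `^ (q - 1).
Proof.
move=> /andP[a0 a1].
rewrite normrM (ger0_norm (powR_ge0 _ _)) ler0_norm ?ln_le0//.
rewrite powRB; last by rewrite (gt_eqF a0) implybT.
rewrite (powRr1 (ltW a0)); apply: ler_wpM2l; first exact: powR_ge0.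
rewrite -lnV ?posrE//; apply: ltW; apply: ln_sublinear; by rewrite invr_gt0.
Qed.

Lemma powR_ln_continuous (T : topologicalType) (u q : T -> R) (x : T) :
  {for x, continuous u} -> {for x, continuous q} -> 1 < q x ->
  (\forall z \near x, 0 <= u z) ->
  {for x, continuous (fun z => u z `^ q z * ln (u z))}.
Proof.
move=> cu cq q1 nu.
have q0 : 0 < q x by rewrite (lt_trans _ q1).
have ux0 := nbhs_singleton nu.
have [ux|ux] := eqVneq (u x) 0; last first.
  have ugt0 : 0 < u x by rewrite lt_neqAle eq_sym ux.
  apply: (@cvgM _ _ (nbhs x) _ (fun z => u z `^ q z) (@ln R \o u)).
    exact: powR_continuous.
  by apply: continuous_comp => //; exact: continuous_ln.
have cq1 : {for x, continuous (fun z => q z - 1)}.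
  by apply: (@cvgB _ _ _ (nbhs x) _ q (fun=> 1)) => //; exact: cvg_cst.
have c1 := powR_continuous cu cq1 (ltac:(by rewrite subr_gt0) : 0 < q x - 1) nu.
apply/(@cvgrPdist_le _ _ _ (nbhs x) _) => eps eps0.
have := (cvgrPdist_le _ _).1 c1 _ eps0.
rewrite ux !powR0 ?gt_eqF ?subr_gt0// mul0r => /(_ _) n1.
have nu1 : \forall z \near x, u z < 1 by apply: (cvgr_lt _ cu); rewrite ux.
near=> z; rewrite sub0r normrN.
have uz1 : u z < 1 by near: z.
have uz0 : 0 <= u z by near: z.
have [->|uz] := eqVneq (u z) 0; first by rewrite ln0// mulr0 normr0 ltW.
apply: le_trans (powR_ln_le _ _) _; first by rewrite lt_neqAle eq_sym uz uz0 (ltW uz1).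
have : `|0 - u z `^ (q z - 1)| <= eps by near: z.
by rewrite sub0r normrN ger0_norm ?powR_ge0.
Unshelve. all: by end_near. Qed.

Variable n : nat.
Local Notation e_ i := (delta_mx 0 i).

Lemma Ck1_of_is_derive (V : set 'rV[R]_n) g (dg : 'I_n -> 'rV[R]_n -> R) : open V ->
  (forall y, V y -> {for y, continuous g}) ->
  (forall i y, V y -> is_derive y (e_ i) g (dg i y)) ->
  (forall i y, V y -> {for y, continuous (dg i)}) -> Ck 1 V g.
Proof.
move=> oV cg Dg cdg; apply/CkS_open => //; split=> // i.
split=> [y Vy|]; first by have [] := Dg i y Vy.
apply: (@Ck_ext _ _ 0 _ (dg i)) => //.
  by move=> y Vy; rewrite /partial (@derive_val _ _ _ _ _ _ _ (Dg i y Vy)).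
by apply/Ck0_open => // y Vy; exact: cdg.
Qed.

Lemma partial_continuous (V : set 'rV[R]_n) g i y : open V -> Ck 1 V g -> V y ->
  {for y, continuous (partial i g)}.
Proof.
move=> oV Cg Vy; have [_ /(_ i)[_ /(Ck0_open _ oV)]] := (CkS_open _ _ oV).1 Cg.
exact.
Qed.

(** A zero of [u] is a minimum of [u] on [V]. *)
Lemma derive_min_eq0 (V : set 'rV[R]_n) (u : 'rV[R]_n -> R) y v : open V ->
  Ck 1 V u -> (forall z, V z -> 0 <= u z) -> V y -> u y = 0 -> 'D_v u y = 0.
Proof.
move=> oV Cu u0 Vy uy.
have c0 : {for (0 : R), continuous (fun s : R => y + s *: v)}.
  apply: (@cvgD _ _ _ (nbhs (0 : R)) _); first exact: cvg_cst.
  apply: (@cvgZ _ _ _ (nbhs (0 : R)) _); [exact: cvg_id|exact: cvg_cst].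
have nV : \forall s \near (0 : R), V (y + s *: v).
  by apply: c0; rewrite scale0r addr0; exact: open_nbhs_nbhs.
have [r /= r0 Hr] := nV.
have inV s : s \in `]-r, r[%R -> V (y + s *: v).
  by rewrite in_itv/= => sr; apply: Hr; rewrite /ball_/= sub0r normrN ltr_norml.
have D s : s \in `]-r, r[%R ->
    is_derive s 1 (fun t => u (y + t *: v)) ('D_v u (y + s *: v)).
  move=> /inV Vs; apply: derive_direction.
  by have [] := C1_derive v oV Cu Vs.
have zr : (0 : R) \in `]-r, r[%R by rewrite in_itv/= oppr_lt0 r0.
have := @derive1_at_min R (fun t => u (y + t *: v)) (-r) r 0 _ _ zr _.
case=> [|s /D[]//|s sr|_ <-].
- by rewrite ge0_cp// ltW.
- by rewrite scale0r addr0 uy; apply: u0; exact: inV.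
by rewrite (@derive_val _ _ _ _ _ _ _ (D 0 zr)) scale0r addr0.
Qed.

(** Where u > 0 this is the derivative of exp(p ln u). At a zero of u the
   derivative of u vanishes by [derive_min_eq0], and 0 <= u^p <= u nearby because
   p >= 1, so that the difference quotient of u^p tends to 0 as well. *)
Lemma powR_is_derive (V : set 'rV[R]_n) (u p : 'rV[R]_n -> R) y v : open V ->
  Ck 1 V u -> Ck 1 V p -> (forall z, V z -> 0 <= u z) -> (forall z, V z -> 1 < p z) ->
  V y -> is_derive y v (fun z => u z `^ p z)
    (p y * u y `^ (p y - 1) * 'D_v u y + u y `^ p y * ln (u y) * 'D_v p y).
Proof.
move=> oV Cu Cp u0 p1 Vy.
have Du := derivableP (let: DeriveDef d _ := C1_derive v oV Cu Vy in d).
have Dp := derivableP (let: DeriveDef d _ := C1_derive v oV Cp Vy in d).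
have cu := Ck_continuous oV Cu Vy.
have [uy|uy] := eqVneq (u y) 0; last first.
  have ugt0 : 0 < u y by rewrite lt_neqAle eq_sym uy u0.
  have nE : \forall z \near y, expR (p z * ln (u z)) = u z `^ p z.
    have : \forall z \near y, 0 < u z by exact: (cvgr_gt _ cu).
    by apply: filterS => z uz; rewrite /powR gt_eqF.
  apply: (near_eq_is_derive nE).
  have Dln := is_derive_comp_real Du (is_derive1_ln ugt0).
  have D := is_derive_comp_real (is_deriveM Dp Dln) (is_derive_expR _).
  apply: (is_derive_eq D).
  rewrite /= powRB ?(negbTE uy) ?implybT// powRr1 ?ltW// /powR (negbTE uy).
  by rewrite /GRing.scale/=; field.
have p0 : p y - 1 != 0 by rewrite subr_eq0 gt_eqF// p1.
have pp0 : p y != 0 by rewrite gt_eqF// (lt_trans _ (p1 y Vy)).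
rewrite uy !powR0// mulr0 !mul0r addr0.
have Du0 : is_derive y v u 0 by rewrite -(derive_min_eq0 v oV Cu u0 Vy uy).
suff cv : h^-1 *: (((fun z => u z `^ p z) \o shift y) (h *: v) - u y `^ p y) @[h --> 0^'] --> (0 : R).
  by apply: DeriveDef; [apply/cvg_ex; exists 0|exact: cvg_lim cv].
have [/cvg_ex[l cl] El] := Du0.
have {}cl : h^-1 *: ((u \o shift y) (h *: v) - u y) @[h --> 0^'] --> (0 : R).
  have lE : l = 0 by rewrite -El; apply/esym; exact: cvg_lim cl.
  by move: cl; rewrite lE.
apply/cvgrPdist_le => eps eps0.
have n1 : \forall h \near (0 : R)^', `|0 - h^-1 *: ((u \o shift y) (h *: v) - u y)| <= eps.
  exact: (cvgrPdist_le _ _).1 cl _ eps0.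
have c0 : (fun h : R => h *: v + y) @ (0 : R)^' --> y.
  rewrite -[X in _ --> X](add0r y) -[X in _ --> X + _](scale0r v).
  apply: (@cvgD _ _ _ (0^') _); last exact: cvg_cst.
  by apply: (@cvgZ _ _ _ (0^') _); [exact: cvg_within|exact: cvg_cst].
have nV : \forall h \near (0 : R)^', V (h *: v + y).
  exact: (c0 V (open_nbhs_nbhs (conj oV Vy))).
have nu1 : \forall h \near (0 : R)^', u (h *: v + y) < 1.
  apply: (c0 (fun z => u z < 1)).
  by apply: (cvgr_lt _ cu); rewrite uy.
near=> h.
have Vh : V (h *: v + y) by near: h.
have uh1 : u (h *: v + y) < 1 by near: h.
have nh : `|0 - h^-1 *: ((u \o shift y) (h *: v) - u y)| <= eps by near: h.
move: nh; rewrite /= uy !subr0 !sub0r !normrN powR0// subr0 !normrZ; apply: le_trans.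
apply: ler_wpM2l => //; rewrite ger0_norm ?powR_ge0// ger0_norm ?u0//.
have [->|uh0] := eqVneq (u (h *: v + y)) 0.
  by rewrite powR0// gt_eqF// (lt_trans _ (p1 _ Vh)).
by apply: ge1r_powR; [rewrite lt_neqAle eq_sym uh0 u0// (ltW uh1)|rewrite ltW// p1].
Unshelve. all: by end_near. Qed.

Lemma Ck1_powR (V : set 'rV[R]_n) (u p : 'rV[R]_n -> R) : open V ->
  Ck 1 V u -> Ck 1 V p -> (forall z, V z -> 0 <= u z) -> (forall z, V z -> 1 < p z) ->
  Ck 1 V (fun z => u z `^ p z).
Proof.
move=> oV Cu Cp u0 p1.
have nu y : V y -> \forall z \near y, 0 <= u z.
  move=> Vy; have : \forall z \near y, V z by exact: open_nbhs_nbhs.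
  by apply: filterS => z; exact: u0.
have cu y : V y -> {for y, continuous u} by exact: Ck_continuous Cu.
have cp y : V y -> {for y, continuous p} by exact: Ck_continuous Cp.
apply: (@Ck1_of_is_derive _ _ (fun i y => p y * u y `^ (p y - 1) * partial i u y +
    u y `^ p y * ln (u y) * partial i p y)) => //.
- move=> y Vy; apply: (@powR_continuous _ u p y); [exact: cu|exact: cp| |exact: nu].
  by rewrite (lt_trans _ (p1 y Vy)).
- by move=> i y Vy; exact: (powR_is_derive (e_ i) oV Cu Cp u0 p1 Vy).
- move=> i y Vy.
  apply: (@cvgD _ _ _ (nbhs y) _ (fun y => p y * u y `^ (p y - 1) * partial i u y)
    (fun y => u y `^ p y * ln (u y) * partial i p y)).
    apply: (@cvgM _ _ (nbhs y) _ (fun y => p y * u y `^ (p y - 1)) (partial i u)).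
      apply: (@cvgM _ _ (nbhs y) _ p (fun y => u y `^ (p y - 1))); first exact: cp.
      apply: (@powR_continuous _ u (fun z => p z - 1) y); [exact: cu| |by rewrite subr_gt0 p1|exact: nu].
      by apply: (@cvgB _ _ _ (nbhs y) _ p (fun=> 1)); [exact: cp|exact: cvg_cst].
    exact: partial_continuous Cu Vy.
  apply: (@cvgM _ _ (nbhs y) _ (fun y => u y `^ p y * ln (u y)) (partial i p)).
    by apply: (@powR_ln_continuous _ u p y); [exact: cu|exact: cp|exact: p1|exact: nu].
  exact: partial_continuous Cp Vy.
Qed.

Lemma Ck1_comp_real (V : set 'rV[R]_n) (v : 'rV[R]_n -> R) (f : R -> R) (A : set R) :
  open V -> open A -> Ck 1 V v -> (forall y, V y -> A (v y)) ->
  (forall t, A t -> derivable f t 1) -> {within A, continuous (derive1 f)} ->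
  Ck 1 V (f \o v).
Proof.
move=> oV oA Cv vA df cf'.
have cv y : V y -> {for y, continuous v} by exact: Ck_continuous Cv.
apply: (@Ck1_of_is_derive V (f \o v) (fun i y => derive1 f (v y) * partial i v y)) => //.
- move=> y Vy; apply: continuous_comp; first exact: cv.
  by apply: differentiable_continuous; apply/derivable1_diffP/df/vA.
- move=> i y Vy; apply: is_derive_comp_real.
    by apply/derivableP; have [] := C1_derive (e_ i) oV Cv Vy.
  by rewrite derive1E; exact/derivableP/df/vA.
- move=> i y Vy; apply: (@cvgM _ _ (nbhs y) _ (derive1 f \o v) (partial i v)).
    apply: continuous_comp; first exact: cv.
    by move: cf'; rewrite continuous_open_subspace// => h; apply: h; exact/mem_set/vA.
  exact: partial_continuous Cv Vy.
Qed.

End PowerOfC1.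

(** * The pointwise Picone inequality *)

Section Picone.
Variables (R : realType) (N : nat).
Implicit Types a b : 'rV[R]_N.

Lemma enorm_sqr a : enorm a ^+ 2 = dotp a a.
Proof. by rewrite sqr_sqrtr// dotp_ge0. Qed.

Lemma enorm_ge0 a : 0 <= enorm a.
Proof. exact: sqrtr_ge0. Qed.

Lemma enorm_eq0 a : enorm a = 0 -> a = 0.
Proof.
move=> a0; have /eqP := enorm_sqr a; rewrite a0 expr0n/= eq_sym.
rewrite psumr_eq0; last by move=> k _; rewrite -expr2 sqr_ge0.
move=> /allP H; apply/rowP => k; rewrite mxE; apply/eqP.
by have := H k (mem_index_enum k); rewrite -expr2 sqrf_eq0.
Qed.

Lemma cauchy_schwarz a b : dotp a b <= enorm a * enorm b.
Proof.
have [/eqP a0|a0] := boolP (enorm a == 0).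
  by rewrite (enorm_eq0 a0) enorm0 mul0r /dotp big1// => k _; rewrite mxE mul0r.
pose A := dotp a a; pose B := dotp b b; pose C := dotp a b.
have A0 : 0 < A by rewrite /A -enorm_sqr exprn_gt0// lt_neqAle eq_sym a0 enorm_ge0.
have sqE (t s : R) : \sum_(k < N) (t * b 0 k - s * a 0 k) ^+ 2 =
    t ^+ 2 * dotp b b - 2 * t * s * dotp a b + s ^+ 2 * dotp a a.
  rewrite /dotp !mulr_sumr -sumrB -big_split/=.
  by apply: eq_bigr => k _; ring.
have E : \sum_(k < N) (A * b 0 k - C * a 0 k) ^+ 2 = A * (A * B - C ^+ 2).
  by rewrite sqE -/A -/B -/C; ring.
have : 0 <= A * (A * B - C ^+ 2) by rewrite -E; apply: sumr_ge0 => k _; rewrite sqr_ge0.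
rewrite pmulr_rge0// subr_ge0 => CAB.
have ab0 : 0 <= enorm a * enorm b by rewrite mulr_ge0 ?enorm_ge0.
have [C0|C0] := leP C 0; first exact: le_trans C0 ab0.
rewrite -(@ler_pXn2r _ 2) ?nnegrE ?(ltW C0)//.
by rewrite exprMn !enorm_sqr.
Qed.

(** Put B = U |b| f^(-1/(p-1)). The Cauchy-Schwarz inequality, and Young's
   inequality for |a| and B^(p-1) with the exponents p and p/(p-1), bound the
   first term by |a|^p + (p-1) B^p; the lower bound on f' makes the subtracted
   term at least (p-1) B^p. *)
Lemma picone (p U f f' : R) a b : 1 < p -> 0 <= U -> 0 < f ->
  (p - 1) * f `^ ((p - 2) / (p - 1)) <= f' ->
  enorm b `^ (p - 2) * (p * U `^ (p - 1) / f * dotp b a - U `^ p * f' / f ^+ 2 * dotp b b)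
    <= enorm a `^ p.
Proof.
move=> p1 U0 f0 f'f.
have [b0|b0] := eqVneq (enorm b) 0.
  have bE := enorm_eq0 b0.
  have d1 : dotp b a = 0 by rewrite /dotp big1// => k _; rewrite bE mxE mul0r.
  have d2 : dotp b b = 0 by rewrite /dotp big1// => k _; rewrite {1}bE mxE mul0r.
  by rewrite d1 d2 !mulr0 subr0 mulr0 powR_ge0.
have bgt0 : 0 < enorm b by rewrite lt_neqAle eq_sym b0 enorm_ge0.
set x := enorm b in b0 bgt0 *; set y := enorm a.
have y0 : 0 <= y by exact: enorm_ge0.
have p10 : 0 < p - 1 by rewrite subr_gt0.
have p0 : 0 < p by rewrite (lt_trans _ p1).
have p1n : p - 1 != 0 by rewrite gt_eqF.
have fn : f != 0 by rewrite gt_eqF.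
pose g := f `^ (p - 1)^-1.
have g0 : 0 < g by rewrite powR_gt0.
pose B := U * x / g.
have B0 : 0 <= B by rewrite divr_ge0 ?mulr_ge0// ltW.
have powdiv (s t r : R) : 0 <= s -> 0 < t -> (s / t) `^ r = s `^ r / t `^ r.
  move=> s0 t0; rewrite powRM ?invr_ge0 ?(ltW t0)//; congr (_ * _).
  by rewrite -(powR_inv1 (ltW t0)) -powRrM mulN1r powRN.
have Bp1 : B `^ (p - 1) = U `^ (p - 1) * x `^ (p - 1) / f.
  rewrite /B (powdiv _ _ _ _ g0) ?mulr_ge0 ?(ltW bgt0)// powRM ?(ltW bgt0)//.
  by rewrite /g -powRrM mulVf// powRr1// ltW.
have Bp : B `^ p = U `^ p * x `^ p * f `^ ((p - 2) / (p - 1)) / f ^+ 2.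
  rewrite /B (powdiv _ _ _ _ g0) ?mulr_ge0 ?(ltW bgt0)// powRM ?(ltW bgt0)//.
  rewrite /g -powRrM -[RHS]mulrA; congr (_ * _).
  rewrite -(powR_mulrn 2 (ltW f0)) -!powRN -powRD ?fn ?implybT//.
  by congr (_ `^ _); field.
have x2 : x `^ (p - 2) * x = x `^ (p - 1).
  rewrite -[X in _ * X = _](powRr1 (ltW bgt0)) -powRD ?b0 ?implybT//; congr (_ `^ _); ring.
have x3 : x `^ (p - 2) * x ^+ 2 = x `^ p.
  rewrite -(powR_mulrn 2 (ltW bgt0)) -powRD ?b0 ?implybT//; congr (_ `^ _); ring.
have young : p * (y * B `^ (p - 1)) <= y `^ p + (p - 1) * B `^ p.
  have q0 : 0 < p / (p - 1) by rewrite divr_gt0.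
  have pq : p^-1 + (p / (p - 1))^-1 = 1 by field; rewrite p1n gt_eqF.
  have := conjugate_powR y0 (powR_ge0 B (p - 1)) p0 q0 pq.
  rewrite -powRrM (_ : (p - 1) * (p / (p - 1)) = p); last by field.
  move=> /(ler_wpM2l (ltW p0)) /le_trans -> //.
  by rewrite le_eqVlt; apply/orP; left; apply/eqP; field; rewrite p1n gt_eqF.
have t1 : x `^ (p - 2) * (p * U `^ (p - 1) / f * dotp b a) <= p * (y * B `^ (p - 1)).
  rewrite Bp1 -x2.
  have -> : p * (y * (U `^ (p - 1) * (x `^ (p - 2) * x) / f)) =
    x `^ (p - 2) * (p * U `^ (p - 1) / f * (x * y)) by ring.
  apply: ler_wpM2l; first exact: powR_ge0.
  apply: ler_wpM2l; last exact: cauchy_schwarz.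
  by rewrite divr_ge0 ?mulr_ge0 ?powR_ge0 ?ltW.
have t2 : (p - 1) * B `^ p <= x `^ (p - 2) * (U `^ p * f' / f ^+ 2 * dotp b b).
  rewrite -enorm_sqr -/x Bp -x3.
  have -> : x `^ (p - 2) * (U `^ p * f' / f ^+ 2 * x ^+ 2) =
    f' * (x `^ (p - 2) * x ^+ 2 * U `^ p / f ^+ 2) by ring.
  have -> : (p - 1) * (U `^ p * (x `^ (p - 2) * x ^+ 2) * f `^ ((p - 2) / (p - 1)) / f ^+ 2) =
    ((p - 1) * f `^ ((p - 2) / (p - 1))) * (x `^ (p - 2) * x ^+ 2 * U `^ p / f ^+ 2) by ring.
  apply: ler_wpM2r => //.
  by rewrite divr_ge0 ?sqr_ge0// mulr_ge0 ?powR_ge0// x3 powR_ge0.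
rewrite mulrBr; apply: le_trans (lerB t1 t2) _.
by rewrite lerBlDr.
Qed.

End Picone.

(** * The test function *)

Section TestFunction.
Variables (R : realType) (n : nat) (M : smooth_manifold R n).
Variables (U : set M) (oU : open U).
Implicit Types (u p v : M -> R) (f : R -> R) (X : vector_field M).

Lemma Ck1_on_powR u p : Ck_on 1 U u -> Ck_on 1 U p ->
  (forall x, U x -> 0 <= u x) -> (forall x, U x -> 1 < p x) ->
  Ck_on 1 U (fun x => u x `^ p x).
Proof.
move=> Cu Cp u0 p1 c ac.
apply: (Ck1_powR (cimgI_open c oU) (Cu c ac) (Cp c ac)).
- by move=> _ [z [Uz cz] <-] /=; rewrite cfunK// u0.
- by move=> _ [z [Uz cz] <-] /=; rewrite cfunK// p1.
Qed.

Lemma Ck1_on_comp_real v f : Ck_on 1 U v -> (forall x, U x -> 0 < v x) ->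
  (forall t, 0 < t -> derivable f t 1) ->
  {within [set t | 0 < t], continuous (derive1 f)} -> Ck_on 1 U (f \o v).
Proof.
move=> Cv v0 df cf c ac.
apply: (@Ck1_comp_real _ _ _ (v \o cinv c) f [set t | 0 < t]) => //.
- exact: cimgI_open.
- exact: Cv.
- by move=> _ [z [Uz cz] <-] /=; rewrite cfunK// v0.
Qed.

(** The variable exponent produces the logarithmic term in [X p]. *)
Lemma vf_apply_test u p v f X x :
  Ck_on 1 U u -> Ck_on 1 U p -> Ck_on 1 U v ->
  (forall z, U z -> 0 <= u z) -> (forall z, U z -> 1 < p z) ->
  (forall z, U z -> 0 < v z) ->
  (forall t, 0 < t -> 0 < f t) -> (forall t, 0 < t -> derivable f t 1) ->
  {within [set t | 0 < t], continuous (derive1 f)} -> U x ->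
  vf_apply X (fun z => u z `^ p z / f (v z)) x =
    p x * u x `^ (p x - 1) / f (v x) * vf_apply X u x
    + u x `^ p x * ln (u x) / f (v x) * vf_apply X p x
    - u x `^ p x * derive1 f (v x) / f (v x) ^+ 2 * vf_apply X v x.
Proof.
move=> Cu Cp Cv u0 p1 v0 f0 df cf Ux.
have [c ac cx] := atlas_cover x.
have Cup := Ck1_on_powR Cu Cp u0 p1.
have Cfv := Ck1_on_comp_real Cv v0 df cf.
have fv0 z : U z -> (f \o v) z != 0 by move=> Uz; rewrite /= gt_eqF// f0// v0.
have Cphi := Ck_on_mul oU Cup (Ck_on_inv oU fv0 Cfv).
have Dphi := vf_apply_is_derive X ac oU Cphi Ux cx.
rewrite -(@derive_val _ _ _ _ _ _ _ Dphi).
have Du := vf_apply_is_derive X ac oU Cu Ux cx.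
have Dp := vf_apply_is_derive X ac oU Cp Ux cx.
have Dv := vf_apply_is_derive X ac oU Cv Ux cx.
set y := cfun c x in Du Dp Dv *; set d := vfc X c x in Du Dp Dv *.
have Vy : (cfun c @` (U `&` cdom c)) y by exists x.
have D1 : is_derive y d (fun z => u (cinv c z) `^ p (cinv c z))
   (p x * u x `^ (p x - 1) * vf_apply X u x + u x `^ p x * ln (u x) * vf_apply X p x).
  have := @powR_is_derive _ _ _ (u \o cinv c) (p \o cinv c) y d (cimgI_open c oU)
    (Cu c ac) (Cp c ac).
  rewrite (@derive_val _ _ _ _ _ _ _ Du) (@derive_val _ _ _ _ _ _ _ Dp)/= cfunK//.
  apply => //.
    by move=> _ [z [Uz cz] <-] /=; rewrite cfunK// u0.
  by move=> _ [z [Uz cz] <-] /=; rewrite cfunK// p1.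
have D2 : is_derive y d ((fun t => (f t)^-1) \o (v \o cinv c))
    (- (f (v x)) ^- 2 * derive1 f (v x) * vf_apply X v x).
  apply: is_derive_comp_real => //=; rewrite cfunK//.
  have Df : is_derive (v x) 1 f (derive1 f (v x)).
    by rewrite derive1E; apply/derivableP/df/v0.
  exact: (is_deriveV (fv0 _ Ux : f (v x) != 0) Df).
have D3 := is_deriveM D1 D2.
have -> : (fun z => u z `^ p z * ((f \o v) z)^-1) \o cinv c =
  (fun z => u (cinv c z) `^ p (cinv c z)) * ((fun t => (f t)^-1) \o (v \o cinv c)) by [].
rewrite (@derive_val _ _ _ _ _ _ _ D3) /= cfunK//.
rewrite /GRing.scale/=.
move: (u x `^ p x) (u x `^ (p x - 1)) (ln (u x)) (fv0 _ Ux) => A B L /= fn.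
by field.
Qed.

End TestFunction.

(** * The integral inequality *)

Lemma dotp_lin3 (R : realType) N (b g1 g2 g3 : 'rV[R]_N) (s1 s2 s3 : R) :
  dotp b (s1 *: g1 + s2 *: g2 - s3 *: g3) =
    s1 * dotp b g1 + s2 * dotp b g2 - s3 * dotp b g3.
Proof.
rewrite /dotp !mulr_sumr -big_split -sumrB/=; apply: eq_bigr => k _.
by rewrite !mxE; ring.
Qed.

(** A point of [D] excludes the value [s = -oo]. *)
Lemma upper_bound_lt_pinfty (R : realType) (T : Type) (D : set T) (p : T -> R) (s : \bar R) :
  D !=set0 -> (s < +oo)%E -> (forall x, D x -> ((p x)%:E <= s)%E) ->
  exists C : R, forall x, D x -> p x <= C.
Proof.
move=> [z Dz]; case: s => [r _ ps|//|_ ps]; first by exists r => x /ps; rewrite lee_fin.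
by have := ps z Dz.
Qed.

Theorem proposition3p2 (R : realType) (n N : nat) (hnN : (N <= n)%N)
    (M : smooth_manifold R n) (w : volume_form M)
    (vol : {measure set (borel M) -> \bar R}) (hvol : volume_measure w vol)
    (X : 'I_N -> vector_field M)
    (Omega : set M) (oOmega : open Omega) (Omega0 : Omega !=set0)
    (cOmega : connected Omega) (bOmega : compact (closure Omega))
    (p : M -> R) (pC1 : C1_closure Omega p)
    (p_gt1 : (1 < ess_inf (mrestr vol (open_borel oOmega)) (EFin \o p))%E)
    (p_bounds : forall x : M, closure Omega x ->
      (ess_inf (mrestr vol (open_borel oOmega)) (EFin \o p) <= (p x)%:E
         <= ess_sup (mrestr vol (open_borel oOmega)) (EFin \o p))%E)
    (p_lty : (ess_sup (mrestr vol (open_borel oOmega)) (EFin \o p) < +oo)%E)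
    (f : R -> R) (f_gt0 : forall y : R, 0 < y -> 0 < f y)
    (f_derivable : forall y : R, 0 < y -> derivable f y 1)
    (f_C1 : {within [set y : R | 0 < y], continuous (derive1 f)})
    (f_ineq : forall (y : R) (x : M), 0 < y -> Omega x ->
      (p x - 1) * f y `^ ((p x - 2) / (p x - 1)) <= derive1 f y)
    (mu : R) (mu_gt0 : 0 < mu)
    (a : M -> R) (a_gt0 : forall x : M, Omega x -> 0 < a x)
    (a_cont : {within Omega, continuous a})
    (v : M -> R) (v_C0 : Cinfty_vanishing Omega v)
    (v_gt0 : forall x : M, Omega x -> 0 < v x)
    (v_p : forall x : M, Omega x -> dotp (hgrad X v x) (hgrad X p x) = 0)
    (v_sol : weak_solution w vol Omega p X v (fun x => mu * (a x * f (v x))))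
    (u : M -> R) (u_C0 : Ck_compact 1 Omega u) (u_ge0 : forall x : M, 0 <= u x) :
  (mu%:E * \int[vol]_(x in Omega) (a x * `|u x| `^ p x)%:E
     <= \int[vol]_(x in Omega) (enorm (hgrad X u x) `^ p x)%:E)%E.
Proof.
have clO x : Omega x -> closure Omega x by exact: subset_closure.
have p1 x : Omega x -> 1 < p x.
  move=> Ox; have /andP[+ _] := p_bounds x (clO x Ox).
  by move=> /(lt_le_trans p_gt1); rewrite lte_fin.
have [pmax p_le] : exists C : R, forall x, Omega x -> p x <= C.
  apply: (upper_bound_lt_pinfty Omega0 p_lty) => x Ox.
  by have /andP[] := p_bounds x (clO x Ox).
have Cp : Ck_on 1 Omega p by case: pC1.
have Cv : Ck_on 1 Omega v by case: v_C0 => /(_ 1%N).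
have [Cu' [cK KO]] := u_C0.
have Cu : Ck_on 1 Omega u by exact: Ck_on_sub Cu'.
have p_cont x : Omega x -> {for x, continuous p} by exact: Ck_on_continuous Cp.
have mO : measurable (Omega : set (borel M)) by exact: open_borel.
(* Outside Omega the exponent may vanish, and 0 `^ 0 = 1; so the test
   function phi is cut off there. *)
pose psi x := u x `^ p x / f (v x).
pose phi x := if x \in Omega then psi x else 0.
have fv0 x : Omega x -> 0 < f (v x) by move=> /v_gt0 /f_gt0.
have Cpsi : Ck_on 1 Omega psi.
  apply: Ck_on_mul => //; first by apply: Ck1_on_powR.
  apply: Ck_on_inv => //; first by move=> x Ox; rewrite gt_eqF// fv0.
  exact: (Ck1_on_comp_real oOmega Cv v_gt0 f_derivable f_C1).
have phiE x : Omega x -> phi x = psi x by move=> Ox; rewrite /phi mem_set.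
have phiK x : phi x != 0 -> closure [set x | u x != 0] x.
  rewrite /phi; case: ifPn => [/set_mem Ox h|_]; last by rewrite eqxx.
  apply: subset_closure => /=; apply: contra h => /eqP ux0.
  by rewrite /psi ux0 powR0 ?mul0r// gt_eqF// (lt_trans _ (p1 x Ox)).
have Cphi : Ck_compact 1 Omega phi.
  split; last exact: compact_support_of cK KO phiK.
  apply: (Ck_zero_extend oOmega cK KO phiK).
  by apply: (Ck_on_ext oOmega _ Cpsi) => x /phiE.
have [i1 i2 E] := v_sol phi (hgrad X phi) (C1_compact_W01px hvol oOmega p_cont p1 p_le X Cphi).
have [[_ [mgu lgu] _] _] := C1_compact_W01px hvol oOmega p_cont p1 p_le X u_C0.
(* The orthogonality of the gradients of v and p removes the logarithmic term. *)
have pic x : Omega x -> enorm (hgrad X v x) `^ (p x - 2) *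
    dotp (hgrad X v x) (hgrad X phi x) <= enorm (hgrad X u x) `^ p x.
  move=> Ox.
  have -> : hgrad X phi x =
     (p x * u x `^ (p x - 1) / f (v x)) *: hgrad X u x
     + (u x `^ p x * ln (u x) / f (v x)) *: hgrad X p x
     - (u x `^ p x * derive1 f (v x) / f (v x) ^+ 2) *: hgrad X v x.
    apply/rowP => k; rewrite !mxE.
    rewrite -(vf_apply_test oOmega (X k) Cu Cp Cv)//.
    apply: vf_apply_near; have : \forall z \near x, Omega z by exact: open_nbhs_nbhs.
    by apply: filterS => z /phiE.
  rewrite dotp_lin3 (v_p x Ox) mulr0 addr0.
  apply: picone; [exact: p1|exact: u_ge0|exact: fv0|].
  by apply: f_ineq => //; exact: v_gt0.
have rhsE x : Omega x -> mu * (a x * f (v x)) * phi x = mu * (a x * `|u x| `^ p x).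
  move=> Ox; rewrite phiE// /psi ger0_norm//; field.
  by rewrite gt_eqF// fv0.
have ma : measurable_fun (Omega : set (borel M)) (a : borel M -> R).
  apply: open_measurable_funR => // x Ox.
  by move: a_cont; rewrite continuous_open_subspace// => h; apply: h; exact: mem_set.
have mu' : measurable_fun (Omega : set (borel M)) (u : borel M -> R).
  by apply: open_measurable_funR => // x; exact: Ck_on_continuous Cu.
have mup : measurable_fun (Omega : set (borel M)) ((fun x => a x * `|u x| `^ p x) : borel M -> R).
  by apply: measurable_funM => //; exact: measurable_Lpx_integrand.
rewrite -ge0_integralZl_EFin ?(ltW mu_gt0)//; last 2 first.
- by move=> x Ox; rewrite lee_fin mulr_ge0 ?powR_ge0// ltW// a_gt0.
- exact/measurable_EFinP.
have -> : (\int[vol]_(x in Omega) (mu%:E * (a x * `|u x| `^ p x)%:E) =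
    \int[vol]_(x in Omega) (mu * (a x * f (v x)) * phi x)%:E)%E.
  by apply: eq_integral => x /set_mem Ox; rewrite rhsE.
rewrite -(fineK (integrable_fin_num mO i2)).
have -> : fine (\int[vol]_(x in Omega) (mu * (a x * f (v x)) * phi x)%:E)%E =
   fine (\int[vol]_(x in Omega) (enorm (hgrad X v x) `^ (p x - 2) *
    dotp (hgrad X v x) (hgrad X phi x))%:E)%E by rewrite -[LHS]/(Rintegral _ _ _) -E.
rewrite (fineK (integrable_fin_num mO i1)).
apply: le_integral => //.
  have mgup := measurable_Lpx_integrand oOmega p_cont p1 mgu.
  apply/integrableP; split.
    apply/measurable_EFinP; apply: eq_measurable_fun mgup => x _.
    by rewrite ger0_norm// enorm_ge0.
  suff -> : (\int[vol]_(x in Omega) `|(enorm (hgrad X u x) `^ p x)%:E| =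
    \int[vol]_(x in Omega) (`|enorm (hgrad X u x)| `^ p x)%:E)%E by [].
  apply: eq_integral => x _.
  by rewrite /= ger0_norm ?powR_ge0// ger0_norm// enorm_ge0.
by move=> x /set_mem Ox; rewrite lee_fin pic.
Qed.
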